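(* For each $n\in\{0,\dots,m-1\}$, the map $\Omega_n:\mathfrak M^\tau(W_n)\to\mathcal R$ sends a point of $\mathfrak M^\tau(W_n)$ represented by a quadruple $(\bar X,\bar Y,\bar i,\bar j)$ to the class of the fractional ideal of $B^\tau$ $$M=e_n\det(\bar Y-yI)\,B^\tau+e_n\,\kappa\,\det(\bar X-xI)\,B^\tau,$$ where $\kappa$ is the element $$\kappa=1-\bar j\,(\bar Y-yI)^{-1}(\bar X-xI)^{-1}\,\bar i(e_n)$$ of the classical ring of quotients of $B^\tau$.
   Context: Setup. $\Gamma=\mathbb Z_m$ is a finite cyclic group embedded in $SL_2(\mathbb C)$ so that the natural two-dimensional representation is $L\cong\epsilon\oplus\epsilon^{-1}$, with $\epsilon$ a primitive character (a generator of the character group $\hat\Gamma$). $R=\mathbb C\langle x,y\rangle*\Gamma$ is the crossed product with $gx=\epsilon(g)xg$, $gy=\epsilon^{-1}(g)yg$ for $g\in\Gamma$. For $\tau\in\mathbb C\Gamma$, $B^\tau=R/R(xy-yx-\tau)R$. Modules are right modules. $W_n$ ($0\le n\le m-1$) is the one-dimensional $\Gamma$-module with character $\epsilon^n$, $e_n\in\mathbb C\Gamma$ is the corresponding idempotent (so $e_ng=\epsilon^n(g)e_n$), and $W_n$ is identified with $\mathbb Ce_n\subset\mathbb C\Gamma$. Throughout, $\tau$ is generic: if $\tau_i$ is the scalar by which $\tau$ acts on $W_i$, then $\sum_i\alpha_i\tau_i\ne0$ for every root $\alpha=(\alpha_0,\dots,\alpha_{m-1})$ (real or imaginary) of the affine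 root system of type $A_{m-1}$ attached to $\Gamma$ by the McKay correspondence. $B^\tau$ is then semiprime Noetherian and has a classical ring of quotients $Q=Q(B^\tau)$. $\mathcal R$ is the set of isomorphism classes of finitely generated projective $B^\tau$-modules whose class in $K_0(B^\tau)\cong K_0(\Gamma)$ has dimension $1$; here $K_0(\Gamma)$ is the representation ring, and the isomorphism is $[P]\mapsto[P\otimes_{\mathbb C\Gamma}B^\tau]$. Nakajima varieties. For a finite-dimensional $\Gamma$-module $U$, points of $\mathfrak M^\tau_\Gamma(U,W_n)$ are orbits, under the group of $\Gamma$-automorphisms $h$ of $U$ acting by $(h\bar Xh^{-1},h\bar Yh^{-1},h\bar i,\bar jh^{-1})$, of quadruples $\bar X,\bar Y\in\mathrm{End}_{\mathbb C}(U)$, $\bar i\in\mathrm{Hom}_\Gamma(W_n,U)$, $\bar j\in\mathrm{Hom}_\Gamma(U,W_n)$ with $\bar X\bar Y-\bar Y\bar X+\bar T=\bar i\,\bar j$, $\bar X\bar G=\epsilon(g)\bar G\bar X$, $\bar Y\bar G=\epsilon^{-1}(g)\bar G\bar Y$ for all $g\in\Gamma$ ($\bar T,\bar G$ being the actions of $\tau,g$ on $U$), and such that no proper $\Gamma$-submodule of $U$ contains $\bar i(W_n)$ and is stable under $\bar X,\bar Y$. $\mathfrak M^\tau(W_n)=\bigsqcup_U\mathfrak M^\tau_\Gamma(U,W_n)$ over isomorphism classes of finite-dimensional $\Gamma$-modules $U$, and $\mathfrak M^\tau=\bigsqcup_n\mathfrak M^\tau(W_n)$. The map $\Omega$. Let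 $\mathbf B=I\oplus R$ be the DG algebra with $R$ in degree $0$, $I=R\nu R$ (the ideal $R(xy-yx-\tau)R$ with generator $\nu$ corresponding to $xy-yx-\tau$) in degree $-1$, and differential the inclusion. Given a quadruple $(\bar X,\bar Y,\bar i,\bar j)$ representing a point of $\mathfrak M^\tau_\Gamma(U,W_n)$, put $L^1=U$, a right $R$-module by $u.x=\bar Xu$, $u.y=\bar Yu$, $u.g=\bar Gu$; put $\bar i_n=\bar i(e_n)$ and define $\lambda:R\to\mathbb C$ by $\bar j(\bar i_n.a)=\lambda(a)e_n$. Let $L^0$ be the quotient of $W_n\otimes_{\mathbb C\Gamma}R$ by the right $R$-submodule generated by all $e_n\otimes(a(xy-yx-\tau)+\lambda(a))$, $a\in R$; let $d_{\mathbf L}:L^0\to L^1$, $w\otimes a\mapsto\bar i(w).a$; let $\nu$ act by $L^0.\nu=0$, $(\bar i_n.a).\nu=\lambda(a)(e_n\otimes1)$. This gives a DG-module $\mathbf L=L^0\oplus L^1$ over $\mathbf B$, and $H^0(\mathbf L)=\ker d_{\mathbf L}$ is a $B^\tau$-module with class in $\mathcal R$. $\Omega:\mathfrak M^\tau\to\mathcal R$ sends the point represented by $(\bar X,\bar Y,\bar i,\bar j)$ to the class of $H^0(\mathbf L)$, and $\Omega_n=\Omega|_{\mathfrak M^\tau(W_n)}$. Conventions. $I=\mathrm{Id}_U$ in the displayed formulas; $\bar X-xI$ and $\bar Y-yI$ are viewed in $\mathrm{End}_{\mathbb C}(U)\otimes_{\mathbb C}Q$ (tensor product algebra), where they are invertible;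 $\det(\bar X-xI)\in\mathbb C[x]$, $\det(\bar Y-yI)\in\mathbb C[y]$; $\bar j$ is regarded as a functional $U\to\mathbb C$ via $W_n=\mathbb Ce_n\cong\mathbb C$ and extended to $U\otimes_{\mathbb C}Q\to Q$. The fractional ideal is a right $B^\tau$-submodule of $e_nQ$. *)

(* Defs.v *)
From HB Require Import structures.
From mathcomp Require Import all_boot all_order all_algebra.
From mathcomp Require Import all_fingroup all_solvable all_character.
From mathcomp Require Import finmap monalg complex boolp reals.

Set Implicit Arguments.
Unset Strict Implicit.
Unset Printing Implicit Defensive.

Import GRing.Theory.
Local Open Scope ring_scope.
Local Open Scope quotient_scope.

(** * Quotients of noncommutative rings and right modules

    A right module over [A] is a left module over the converse ring [A^c]:
    [v.a] is written [(a : A^c) *: v].  In particular [(A^c)^o] is [A] as a right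
    module over itself. *)

Section TwoSidedQuotient.
Variables (A : nzRingType) (r : A).

Inductive ideal2 : A -> Prop :=
| Ideal2Gen a b : ideal2 (a * r * b)
| Ideal2_0 : ideal2 0
| Ideal2D u v : ideal2 u -> ideal2 v -> ideal2 (u + v).

Lemma ideal2N u : ideal2 u -> ideal2 (- u).
Proof.
elim=> [a b||v w _ IHv _ IHw]; last by rewrite opprD; exact: Ideal2D.
  by rewrite -!mulNr; exact: Ideal2Gen.
by rewrite oppr0; exact: Ideal2_0.
Qed.

Lemma ideal2Ml c u : ideal2 u -> ideal2 (c * u).
Proof.
elim=> [a b||v w _ IHv _ IHw]; last by rewrite mulrDr; exact: Ideal2D.
  by rewrite !mulrA; exact: Ideal2Gen.
by rewrite mulr0; exact: Ideal2_0.
Qed.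

Lemma ideal2Mr c u : ideal2 u -> ideal2 (u * c).
Proof.
elim=> [a b||v w _ IHv _ IHw]; last by rewrite mulrDl; exact: Ideal2D.
  by rewrite -mulrA; exact: Ideal2Gen.
by rewrite mul0r; exact: Ideal2_0.
Qed.

Definition ideal2_pred : {pred A} := fun z => `[< ideal2 z >].

Lemma ideal2_closed : zmod_closed ideal2_pred.
Proof.
split=> [|u v /asboolP Iu /asboolP Iv]; first by apply/asboolP/Ideal2_0.
by apply/asboolP/Ideal2D => //; exact: ideal2N.
Qed.

HB.instance Definition _ := GRing.isZmodClosed.Build A ideal2_pred ideal2_closed.

Definition ringquot : Type := Quotient.quot ideal2_pred.
HB.instance Definition _ := GRing.Zmodule.on ringquot.

Definition to_quot (a : A) : ringquot := \pi_(Quotient.quot ideal2_pred) a.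
Definition of_quot (b : ringquot) : A := generic_quotient.repr (b : Quotient.quot ideal2_pred).

Lemma of_quotK : cancel of_quot to_quot.
Proof. by move=> b; rewrite /to_quot /of_quot reprK. Qed.

Lemma to_quot_eq a b : to_quot a = to_quot b <-> ideal2 (a - b).
Proof.
rewrite /to_quot; split=> [/eqP|I]; first by rewrite -Quotient.idealrBE => /asboolP.
by apply/eqP; rewrite -Quotient.idealrBE; apply/asboolP.
Qed.

Lemma to_quotB : zmod_morphism to_quot.
Proof. by move=> a b; rewrite /to_quot raddfB. Qed.
HB.instance Definition _ := GRing.isZmodMorphism.Build A ringquot to_quot to_quotB.

Definition quot_one : ringquot := to_quot 1.
Definition quot_mul (u v : ringquot) : ringquot := to_quot (of_quot u * of_quot v).

Lemma quot_mulE a b : quot_mul (to_quot a) (to_quot b) = to_quot (a * b).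
Proof.
apply/to_quot_eq; set a' := of_quot _; set b' := of_quot _.
have Ia : ideal2 (a' - a) by apply/to_quot_eq; rewrite /a' of_quotK.
have Ib : ideal2 (b' - b) by apply/to_quot_eq; rewrite /b' of_quotK.
have -> : a' * b' - a * b = (a' - a) * b' + a * (b' - b).
  by rewrite mulrBl mulrBr addrA subrK.
by apply: Ideal2D; [exact: ideal2Mr | exact: ideal2Ml].
Qed.

Lemma quot_mulA : associative quot_mul.
Proof.
move=> u v w; rewrite -[u]of_quotK -[v]of_quotK -[w]of_quotK.
by rewrite !quot_mulE mulrA.
Qed.
Lemma quot_mul1 : left_id quot_one quot_mul.
Proof. by move=> u; rewrite -[u]of_quotK quot_mulE mul1r. Qed.
Lemma quot_1mul : right_id quot_one quot_mul.
Proof. by move=> u; rewrite -[u]of_quotK quot_mulE mulr1. Qed.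
Lemma quot_mulDl : left_distributive quot_mul +%R.
Proof.
move=> u v w; rewrite -[u]of_quotK -[v]of_quotK -[w]of_quotK.
by rewrite -raddfD !quot_mulE mulrDl raddfD.
Qed.
Lemma quot_mulDr : right_distributive quot_mul +%R.
Proof.
move=> u v w; rewrite -[u]of_quotK -[v]of_quotK -[w]of_quotK.
by rewrite -raddfD !quot_mulE mulrDr raddfD.
Qed.

HB.instance Definition _ := GRing.Zmodule_isPzRing.Build ringquot
  quot_mulA quot_mul1 quot_1mul quot_mulDl quot_mulDr.

Lemma to_quotM : monoid_morphism to_quot.
Proof. by split=> // a b; rewrite -quot_mulE. Qed.
HB.instance Definition _ := GRing.isMonoidMorphism.Build A ringquot to_quot to_quotM.

End TwoSidedQuotient.

Section CyclicRightModule.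
Variables (A : nzRingType) (S : A -> Prop).

Inductive rspan : A -> Prop :=
| RspanGen s a : S s -> rspan (s * a)
| Rspan0 : rspan 0
| RspanD u v : rspan u -> rspan v -> rspan (u + v).

Lemma rspanN u : rspan u -> rspan (- u).
Proof.
elim=> [s a Ss||v w _ IHv _ IHw]; last by rewrite opprD; exact: RspanD.
  by rewrite -mulrN; exact: RspanGen.
by rewrite oppr0; exact: Rspan0.
Qed.

Lemma rspanM c u : rspan u -> rspan (u * c).
Proof.
elim=> [s a Ss||v w _ IHv _ IHw]; last by rewrite mulrDl; exact: RspanD.
  by rewrite -mulrA; exact: RspanGen.
by rewrite mul0r; exact: Rspan0.
Qed.

Definition rspan_pred : {pred A} := fun z => `[< rspan z >].

Lemma rspan_closed : zmod_closed rspan_pred.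
Proof.
split=> [|u v /asboolP Iu /asboolP Iv]; first by apply/asboolP/Rspan0.
by apply/asboolP/RspanD => //; exact: rspanN.
Qed.

HB.instance Definition _ := GRing.isZmodClosed.Build A rspan_pred rspan_closed.

(* The right [A]-module [A / S A]. *)
Definition cycmod : Type := Quotient.quot rspan_pred.
HB.instance Definition _ := GRing.Zmodule.on cycmod.

Definition to_cyc (a : A) : cycmod := \pi_(Quotient.quot rspan_pred) a.
Definition of_cyc (v : cycmod) : A := generic_quotient.repr (v : Quotient.quot rspan_pred).

Lemma of_cycK : cancel of_cyc to_cyc.
Proof. by move=> b; rewrite /to_cyc /of_cyc reprK. Qed.

Lemma to_cyc_eq a b : to_cyc a = to_cyc b <-> rspan (a - b).
Proof.
rewrite /to_cyc; split=> [/eqP|I]; first by rewrite -Quotient.idealrBE => /asboolP.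
by apply/eqP; rewrite -Quotient.idealrBE; apply/asboolP.
Qed.

Lemma to_cycB : zmod_morphism to_cyc.
Proof. by move=> a b; rewrite /to_cyc raddfB. Qed.
HB.instance Definition _ := GRing.isZmodMorphism.Build A cycmod to_cyc to_cycB.

Definition cyc_scale (a : A^c) (v : cycmod) : cycmod := to_cyc (of_cyc v * (a : A)).

Lemma cyc_scaleE (a : A^c) b : cyc_scale a (to_cyc b) = to_cyc (b * (a : A)).
Proof.
apply/to_cyc_eq; rewrite -mulrBl; apply: rspanM.
by apply/to_cyc_eq; rewrite of_cycK.
Qed.

Lemma cyc_scaleA (a b : A^c) v : cyc_scale a (cyc_scale b v) = cyc_scale (a * b) v.
Proof. by rewrite -[v]of_cycK !cyc_scaleE -mulrA. Qed.
Lemma cyc_scale1 : left_id 1 cyc_scale.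
Proof. by move=> v; rewrite -[v]of_cycK cyc_scaleE mulr1. Qed.
Lemma cyc_scaleDr : right_distributive cyc_scale +%R.
Proof.
move=> a u v; rewrite -[u]of_cycK -[v]of_cycK -raddfD !cyc_scaleE.
by rewrite mulrDl raddfD.
Qed.
Lemma cyc_scaleDl v : {morph cyc_scale^~ v : a b / a + b}.
Proof. by move=> a b; rewrite -[v]of_cycK !cyc_scaleE mulrDr raddfD. Qed.

HB.instance Definition _ := GRing.Zmodule_isLmodule.Build A^c cycmod
  cyc_scaleA cyc_scale1 cyc_scaleDr cyc_scaleDl.

End CyclicRightModule.

Definition isomorphic (A : pzRingType) (V W : lmodType A) : Prop :=
  exists f : {linear V -> W}, bijective f.

(** * The classical ring of quotients and fractional ideals *)

Definition regular_elt (A : pzRingType) (s : A) : Prop := GRing.lreg s /\ GRing.rreg s.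

Definition classical_quotient_ring (B : pzRingType) (Q : unitRingType)
    (iota : {rmorphism B -> Q}) : Prop :=
  [/\ injective iota,
      forall s, regular_elt s -> iota s \is a GRing.unit,
      forall q, exists b s, regular_elt s /\ q = iota b / iota s
    & forall q, exists b s, regular_elt s /\ q = (iota s)^-1 * iota b].

Section RightSubmodulesOfQ.
Variables (B : pzRingType) (Q : unitRingType) (iota : {rmorphism B -> Q}).

(* [Q] as a right [B]-module. *)
Definition rmodQ of {rmorphism B -> Q} : Type := Q.
Notation QB := (rmodQ iota).
HB.instance Definition _ := GRing.Zmodule.on QB.

Definition rmodQ_scale (b : B^c) (q : QB) : QB := (q : Q) * iota b.

Lemma rmodQ_scaleA (a b : B^c) q :
  rmodQ_scale a (rmodQ_scale b q) = rmodQ_scale (a * b) q.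
Proof. by rewrite /rmodQ_scale -mulrA -rmorphM. Qed.
Lemma rmodQ_scale1 : left_id 1 rmodQ_scale.
Proof. by move=> q; rewrite /rmodQ_scale rmorph1 mulr1. Qed.
Lemma rmodQ_scaleDr : right_distributive rmodQ_scale +%R.
Proof. by move=> a u v; rewrite /rmodQ_scale mulrDl. Qed.
Lemma rmodQ_scaleDl q : {morph rmodQ_scale^~ q : a b / a + b}.
Proof. by move=> a b; rewrite /rmodQ_scale rmorphD mulrDr. Qed.

HB.instance Definition _ := GRing.Zmodule_isLmodule.Build B^c QB
  rmodQ_scaleA rmodQ_scale1 rmodQ_scaleDr rmodQ_scaleDl.

Variables u v : Q.

Definition frac_ideal_pred : {pred QB} :=
  fun q : Q => `[< exists b c : B, q = u * iota b + v * iota c >].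

Lemma frac_ideal_closed : submod_closed frac_ideal_pred.
Proof.
split=> [|a p q /asboolP[b [c ->]] /asboolP[b' [c' ->]]]; apply/asboolP.
  by exists 0, 0; rewrite rmorph0 !mulr0 addr0.
exists (b * (a : B) + b'), (c * (a : B) + c').
have -> : a *: (u * iota b + v * iota c : QB) + (u * iota b' + v * iota c' : QB) =
  (u * iota b + v * iota c) * iota a + (u * iota b' + v * iota c') by [].
by rewrite !rmorphD !rmorphM mulrDl !mulrDr !mulrA addrACA.
Qed.

HB.instance Definition _ :=
  GRing.isSubmodClosed.Build B^c QB frac_ideal_pred frac_ideal_closed.

(* The right [B]-submodule [uB + vB] of [Q]. *)
Definition frac_ideal : Type := {q : QB | q \in frac_ideal_pred}.
HB.instance Definition _ := SubChoice.on frac_ideal.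
HB.instance Definition _ := [SubChoice_isSubLmodule of frac_ideal by <:].

End RightSubmodulesOfQ.

(** * Cyclic groups, characters and the affine root system *)

Section Characters.
Variables (F : fieldType) (gT : finGroupType).

Definition is_character (chi : gT -> F) : Prop :=
  chi 1%g = 1 /\ forall g h, chi (g * h)%g = chi g * chi h.

(* A finite cyclic group with a generator [eps] of its character group; it embeds
   in [SL_2] by [g |-> diag (eps g, (eps g)^-1)]. *)
Record primitive_char := PrimitiveChar {
  pchar_fun :> gT -> F;
  pchar_cyclic : cyclic [set: gT];
  pchar_char : is_character pchar_fun;
  pchar_gen : forall chi, is_character chi ->
    exists k : nat, forall g, chi g = pchar_fun g ^+ k
}.

End Characters.

Section Roots.
Variable m : nat.

(* The generalized Cartan matrix [2 I - N], where [N i j] is the multiplicity of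
   [W_j] in [W_i (x) (eps + eps^-1)].  This gives the entries [-2] off the diagonal
   for [m = 2], and the zero matrix for [m = 1]. *)
Definition cartan (i j : 'I_m) : int :=
  (i == j)%:Z *+ 2 - (j == ordS i)%:Z - (j == ord_pred i)%:Z.

Definition simple_root (i : 'I_m) : {ffun 'I_m -> int} := [ffun k => (k == i)%:Z].

Definition reflection (i : 'I_m) (alpha : {ffun 'I_m -> int}) : {ffun 'I_m -> int} :=
  [ffun k => alpha k - (k == i)%:Z * \sum_j cartan i j * alpha j].

Inductive real_root : {ffun 'I_m -> int} -> Prop :=
| RealSimple i : real_root (simple_root i)
| RealReflection i alpha : real_root alpha -> real_root (reflection i alpha).

Definition imaginary_root (alpha : {ffun 'I_m -> int}) : Prop :=
  exists2 k : int, k != 0 & alpha = [ffun => k].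

Definition affine_root (alpha : {ffun 'I_m -> int}) : Prop :=
  real_root alpha \/ imaginary_root alpha.

End Roots.

(** * The crossed product [R = F<x,y> * Gamma] *)

(* Words in [x] and [y]: the letter [false] is [x] and the letter [true] is [y]. *)
Definition xyword : monomType := {fmonom bool}.
Definition letters (w : xyword) : seq bool := fmonom_val w.
Definition xyletter (z : bool) : xyword := fmu z.

Lemma letters1 : letters mone = [::]. Proof. exact: fm1. Qed.
Lemma lettersM v w : letters (mmul v w) = letters v ++ letters w.
Proof. exact: fmM. Qed.
Lemma lettersU z : letters (xyletter z) = [:: z]. Proof. exact: fmU. Qed.

Notation free_alg F := {malg F[xyword]}.

Section FreeAlgebraAction.
Variables (F : fieldType) (gT : finGroupType) (eps : primitive_char F gT).

Lemma eps1 : eps 1%g = 1. Proof. by case: (pchar_char eps). Qed.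
Lemma epsM g h : eps (g * h)%g = eps g * eps h.
Proof. by case: (pchar_char eps). Qed.
Lemma gT_comm (g h : gT) : (g * h = h * g)%g.
Proof.
have /centsP/(_ g (in_setT _) h (in_setT _)) := cyclic_abelian (pchar_cyclic eps).
by [].
Qed.

Lemma eps_neq0 g : eps g != 0.
Proof.
apply/eqP => e0; have /eqP := eps1.
by rewrite -(mulgV g) epsM e0 mul0r eq_sym oner_eq0.
Qed.

Definition word_weight (g : gT) (w : xyword) : F :=
  \prod_(z <- letters w) (if z then (eps g)^-1 else eps g).

Lemma word_weightM g w w' :
  word_weight g (mmul w w') = word_weight g w * word_weight g w'.
Proof. by rewrite /word_weight lettersM big_cat. Qed.

Lemma word_weightMg g h w :
  word_weight (g * h)%g w = word_weight g w * word_weight h w.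
Proof.
rewrite /word_weight -big_split; apply: eq_bigr => z _.
by case: z; rewrite epsM ?invfM.
Qed.

Lemma word_weight1g w : word_weight 1%g w = 1.
Proof. by apply: big1 => z _; case: z; rewrite eps1 ?invr1. Qed.

(* The automorphism of the free algebra given by [x |-> eps g x],
   [y |-> (eps g)^-1 y]. *)
Definition free_act (g : gT) (p : free_alg F) : free_alg F :=
  [malg w in msupp p => word_weight g w * p@_w].

Lemma free_actE g p w : (free_act g p)@_w = word_weight g w * p@_w.
Proof. by rewrite mcoeffE; case: msuppP => // _; rewrite mulr0. Qed.

Lemma free_actB g : zmod_morphism (free_act g).
Proof. by move=> p q; apply/malgP => w; rewrite !(free_actE, mcoeffB) mulrBr. Qed.
HB.instance Definition _ g :=
  GRing.isZmodMorphism.Build (free_alg F) (free_alg F) (free_act g) (@free_actB g).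

Lemma free_actU g c w :
  free_act g << c *g w >> = << word_weight g w * c *g w >>.
Proof.
apply/malgP=> w'; rewrite free_actE !mcoeffU.
by case: eqP => [->|_] //; rewrite !mulr0.
Qed.

Lemma free_actM g p q : free_act g (p * q) = free_act g p * free_act g q.
Proof.
rewrite malgME raddf_sum [in RHS](monalgE p) [in RHS](monalgE q).
rewrite !raddf_sum mulr_suml; apply: eq_bigr => w _.
rewrite raddf_sum mulr_sumr; apply: eq_bigr => w' _.
by rewrite /= !free_actU malgM_def fgmulUU word_weightM mulrACA.
Qed.

Lemma free_act_comp g h p : free_act g (free_act h p) = free_act (g * h)%g p.
Proof.
by apply/malgP=> w; rewrite !free_actE word_weightMg mulrA.
Qed.

Lemma free_act1g p : free_act 1%g p = p.
Proof. by apply/malgP=> w; rewrite free_actE word_weight1g mul1r. Qed.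

Lemma free_act1 g : free_act g 1 = 1.
Proof.
by rewrite free_actU /word_weight letters1 big_nil mulr1.
Qed.

Lemma free_actZ g c p : free_act g (c *: p) = c *: free_act g p.
Proof. by apply/malgP=> w; rewrite mcoeffZ !free_actE mcoeffZ mulrCA. Qed.

End FreeAlgebraAction.

(* [a] stands for the finite sum of the [a g . g], with coefficients written on
   the left of the group elements. *)
Definition crossed (F : fieldType) (gT : finGroupType) (eps : primitive_char F gT) : Type :=
  {ffun gT -> free_alg F}.

(* The operations are locked: unification would otherwise unfold them down to
   finitely supported functions. *)
HB.lock Definition cr_mono (F : fieldType) (gT : finGroupType)
    (eps : primitive_char F gT) (p : free_alg F) (g : gT) : crossed eps :=
  [ffun k => if k == g then p else 0].

HB.lock Definition cr_mul (F : fieldType) (gT : finGroupType)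
    (eps : primitive_char F gT) (a b : crossed eps) : crossed eps :=
  [ffun k => \sum_g a g * free_act eps g (b (g^-1 * k)%g)].

HB.lock Definition cr_x (F : fieldType) (gT : finGroupType)
    (eps : primitive_char F gT) : crossed eps :=
  cr_mono eps << xyletter false >> 1%g.

HB.lock Definition cr_y (F : fieldType) (gT : finGroupType)
    (eps : primitive_char F gT) : crossed eps :=
  cr_mono eps << xyletter true >> 1%g.

Section CrossedProduct.
Variables (F : fieldType) (gT : finGroupType) (eps : primitive_char F gT).

HB.instance Definition _ := GRing.Lmodule.on (crossed eps).

Notation cr_mul := (@cr_mul F gT eps).

Lemma cr_monoE p g k : cr_mono eps p g k = if k == g then p else 0.
Proof. by rewrite cr_mono.unlock ffunE. Qed.
Lemma cr_mulE a b k : cr_mul a b k = \sum_g a g * free_act eps g (b (g^-1 * k)%g).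
Proof. by rewrite cr_mul.unlock ffunE. Qed.

Definition cr_one : crossed eps := cr_mono eps 1 1%g.

Lemma cr_mulA : associative cr_mul.
Proof.
move=> a b c; apply/ffunP => k; rewrite !cr_mulE.
transitivity (\sum_g \sum_h a g * free_act eps g (b h)
                 * free_act eps (g * h)%g (c ((g * h)^-1 * k)%g)).
  apply: eq_bigr => g _; rewrite cr_mulE raddf_sum mulr_sumr.
  apply: eq_bigr => h _.
  by rewrite /= free_actM free_act_comp mulrA invMg mulgA.
rewrite [RHS](eq_bigr (fun l => \sum_g a g * free_act eps g (b (g^-1 * l)%g)
                 * free_act eps l (c (l^-1 * k)%g))); last first.
  by move=> l _; rewrite cr_mulE mulr_suml.
rewrite [RHS]exchange_big; apply: eq_bigr => g _.
rewrite [RHS](reindex_inj (mulgI g)); apply: eq_bigr => h _.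
by rewrite mulKg.
Qed.

Lemma cr_mul1 : left_id cr_one cr_mul.
Proof.
move=> a; apply/ffunP => k; rewrite cr_mulE (bigD1 1%g) //= cr_monoE eqxx.
rewrite mul1r invg1 mul1g free_act1g big1 ?addr0 // => g /negPf g1.
by rewrite cr_monoE g1 mul0r.
Qed.

Lemma cr_1mul : right_id cr_one cr_mul.
Proof.
move=> a; apply/ffunP => k; rewrite cr_mulE (bigD1 k) //= cr_monoE mulVg eqxx.
rewrite free_act1 mulr1 big1 ?addr0 // => g gk.
by rewrite cr_monoE -eq_mulVg1 (negPf gk) raddf0 mulr0.
Qed.

Lemma cr_mulDl : left_distributive cr_mul +%R.
Proof.
move=> a b c; apply/ffunP => k; rewrite ffunE !cr_mulE -big_split.
by apply: eq_bigr => g _; rewrite ffunE mulrDl.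
Qed.

Lemma cr_mulDr : right_distributive cr_mul +%R.
Proof.
move=> a b c; apply/ffunP => k; rewrite ffunE !cr_mulE -big_split.
by apply: eq_bigr => g _; rewrite ffunE raddfD mulrDr.
Qed.

Lemma cr_oner_neq0 : cr_one != 0.
Proof.
apply/eqP => /ffunP/(_ 1%g); rewrite cr_monoE ffunE eqxx => /eqP.
by rewrite oner_eq0.
Qed.

HB.instance Definition _ := GRing.Zmodule_isNzRing.Build (crossed eps)
  cr_mulA cr_mul1 cr_1mul cr_mulDl cr_mulDr cr_oner_neq0.

Lemma cr_scaleE (c : F) (a : crossed eps) k : (c *: a) k = c *: a k.
Proof. exact: ffunE. Qed.

Lemma cr_scaleAl (c : F) (a b : crossed eps) : c *: (a * b) = (c *: a) * b.
Proof.
apply/ffunP => k; rewrite cr_scaleE !cr_mulE scaler_sumr; apply: eq_bigr => g _.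
by rewrite cr_scaleE scalerAl.
Qed.
HB.instance Definition _ := GRing.Lmodule_isLalgebra.Build F (crossed eps) cr_scaleAl.

Lemma free_scaleAr (c : F) (p q : free_alg F) : c *: (p * q) = p * (c *: q).
Proof.
have sU (d : F) k : c *: << d *g k >> = << c * d *g k >> :> free_alg F.
  by apply/malgP=> l; rewrite mcoeffZ !mcoeffU mulrnAr.
rewrite malgME (malgMEw (fsubset_refl _) (msuppZ_le c q)) scaler_sumr.
apply: eq_bigr => w _; rewrite scaler_sumr; apply: eq_bigr => w' _.
by rewrite sU mcoeffZ mulrCA.
Qed.

Lemma cr_scaleAr (c : F) (a b : crossed eps) : c *: (a * b) = a * (c *: b).
Proof.
apply/ffunP => k; rewrite cr_scaleE !cr_mulE scaler_sumr; apply: eq_bigr => g _.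
by rewrite cr_scaleE free_actZ free_scaleAr.
Qed.
HB.instance Definition _ := GRing.Lalgebra_isAlgebra.Build F (crossed eps) cr_scaleAr.

Definition cr_g (g : gT) : crossed eps := cr_mono eps 1 g.

Lemma cr_monoM p q g h :
  cr_mono eps p g * cr_mono eps q h = cr_mono eps (p * free_act eps g q) (g * h)%g.
Proof.
apply/ffunP => k; rewrite cr_mulE cr_monoE (bigD1 g) //= !cr_monoE eqxx.
rewrite big1 ?addr0 => [|l /negPf lg]; last by rewrite cr_monoE lg mul0r.
by rewrite (canF_eq (mulKVg g)); case: eqP => // _; rewrite raddf0 mulr0.
Qed.

Lemma cr_monoZ c p g : cr_mono eps (c *: p) g = c *: cr_mono eps p g.
Proof. by apply/ffunP => k; rewrite cr_scaleE !cr_monoE; case: eqP; rewrite ?scaler0. Qed.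

Lemma free_act_letter g z :
  free_act eps g << xyletter z >> =
  (if z then (eps g)^-1 else eps g) *: (<< xyletter z >> : free_alg F).
Proof.
apply/malgP=> w; rewrite free_actE mcoeffZ mcoeffU.
case: eqP => [<-|_]; last by rewrite !mulr0.
by rewrite /word_weight lettersU big_seq1.
Qed.

Lemma cr_gx g : cr_g g * cr_x eps = eps g *: (cr_x eps * cr_g g).
Proof.
rewrite cr_x.unlock !cr_monoM mulg1 mul1g mul1r free_act1 mulr1.
by rewrite free_act_letter cr_monoZ.
Qed.

Lemma cr_gy g : cr_g g * cr_y eps = (eps g)^-1 *: (cr_y eps * cr_g g).
Proof.
rewrite cr_y.unlock !cr_monoM mulg1 mul1g mul1r free_act1 mulr1.
by rewrite free_act_letter cr_monoZ.
Qed.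

Lemma cr_gM g h : cr_g g * cr_g h = cr_g (g * h)%g.
Proof. by rewrite cr_monoM free_act1 mulr1. Qed.

(* [tau g] is the coefficient of [g] in the element [tau] of the group algebra. *)
Definition cr_tau (tau : {ffun gT -> F}) : crossed eps := \sum_g tau g *: cr_g g.

(* The idempotent with [e_n g = eps(g)^n e_n]. *)
Definition cr_idem (n : nat) : crossed eps :=
  (#|gT|%:R : F)^-1 *: \sum_g (eps g ^+ n)^-1 *: cr_g g.

Lemma cr_idem_mulg n g : cr_idem n * cr_g g = eps g ^+ n *: cr_idem n.
Proof.
rewrite /cr_idem -scalerAl scalerA mulrC -scalerA; congr (_ *: _).
rewrite mulr_suml scaler_sumr [RHS](reindex_inj (mulIg g)) /=.
apply: eq_bigr => h _; rewrite -scalerAl cr_gM scalerA; congr (_ *: _).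
by rewrite epsM exprMn invfM mulrCA mulfV ?mulr1 ?expf_neq0 ?eps_neq0.
Qed.

Definition cr_rel (tau : {ffun gT -> F}) : crossed eps :=
  cr_x eps * cr_y eps - cr_y eps * cr_x eps - cr_tau tau.

(* [tau_i], the scalar by which [tau] acts on [W_i]. *)
Definition tau_scalar (tau : {ffun gT -> F}) (i : nat) : F :=
  \sum_g tau g * eps g ^+ i.

Definition generic (tau : {ffun gT -> F}) : Prop :=
  forall alpha : {ffun 'I_#|gT| -> int}, affine_root alpha ->
    \sum_i (alpha i)%:~R * tau_scalar tau i != 0.

End CrossedProduct.

Notation Btau eps tau := (ringquot (cr_rel eps tau)).
Notation to_B eps tau := (@to_quot _ (cr_rel eps tau)).

(** * Projective right modules of dimension one *)

Section DimensionOne.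
Variables (F : fieldType) (gT : finGroupType) (eps : primitive_char F gT).
Variable tau : {ffun gT -> F}.
Notation B := (Btau eps tau).

Variable s : seq nat.

Definition induced_pred : {pred {ffun 'I_(size s) -> (B^c)^o}} :=
  fun f => `[< forall k : 'I_(size s), to_B eps tau (cr_idem eps (nth 0%N s k)) * (f k : B) = f k >].

Lemma induced_closed : submod_closed induced_pred.
Proof.
split=> [|a f h /asboolP Hf /asboolP Hh]; apply/asboolP => k.
  by rewrite ffunE mulr0.
have -> : (a *: f + h) k = (f k : B) * (a : B) + h k :> B by rewrite !ffunE.
by rewrite mulrDr mulrA Hf Hh.
Qed.

HB.instance Definition _ :=
  GRing.isSubmodClosed.Build B^c _ induced_pred induced_closed.

(* The right [B]-module [V (x)_Gamma B] for [V] the direct sum of the [W_n], [n] in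
   [s], as [W_n (x)_Gamma B = e_n B]. *)
Definition induced : Type := {f : {ffun 'I_(size s) -> (B^c)^o} | f \in induced_pred}.
HB.instance Definition _ := SubChoice.on induced.
HB.instance Definition _ := [SubChoice_isSubLmodule of induced by <:].

End DimensionOne.

(* [P] is finitely generated projective and its class in [K_0(B) = K_0(Gamma)] has
   dimension one, i.e. [P] + [V (x) B] = [V' (x) B] in [K_0(B)] for some
   finite-dimensional [Gamma]-modules with [dim V' = dim V + 1].  Equality in [K_0]
   is stable isomorphism, and the stabilizing free module, being itself induced
   from [Gamma], is absorbed in [V] and [V']; projectivity of [P] is implied. *)
Definition in_calR (F : fieldType) (gT : finGroupType) (eps : primitive_char F gT)
    (tau : {ffun gT -> F}) (P : lmodType (Btau eps tau)^c) : Prop :=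
  exists s t : seq nat, size s = (size t).+1 /\
    isomorphic (P * induced eps tau t)%type (induced eps tau s).

(** * Nakajima quadruples and the DG-module [L] *)

Section Nakajima.
Variables (F : fieldType) (gT : finGroupType) (eps : primitive_char F gT).
Variables (tau : {ffun gT -> F}) (n d : nat).

(* A point of the quiver variety with [U = F^d] (column vectors): [ibar] is the
   vector [i(e_n)] and [jbar] is [j] as a functional via [W_n = F e_n]. *)
Record quadruple := Quadruple {
  Gbar : mx_representation F [set: gT] d;
  Xbar : 'M[F]_d;
  Ybar : 'M[F]_d;
  ibar : 'cV[F]_d;
  jbar : 'rV[F]_d;
  ibar_equiv : forall g, Gbar g *m ibar = eps g ^+ n *: ibar;
  jbar_equiv : forall g, jbar *m Gbar g = eps g ^+ n *: jbar;
  quad_rel : Xbar *m Ybar - Ybar *m Xbar + \sum_g tau g *: Gbar g = ibar *m jbar;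
  Xbar_equiv : forall g, Xbar *m Gbar g = eps g *: (Gbar g *m Xbar);
  Ybar_equiv : forall g, Ybar *m Gbar g = (eps g)^-1 *: (Gbar g *m Ybar);
  quad_stable : forall S : 'cV[F]_d -> Prop,
    S 0 -> (forall a u v, S u -> S v -> S (a *: u + v)) ->
    (forall g u, S u -> S (Gbar g *m u)) ->
    (forall u, S u -> S (Xbar *m u)) -> (forall u, S u -> S (Ybar *m u)) ->
    S ibar -> forall u, S u
}.

Variable q : quadruple.
Notation R := (crossed eps).
Notation G := (Gbar q).

(* [u.w] for a word [w]: the leftmost letter acts first. *)
Definition word_mx (w : xyword) : 'M[F]_d :=
  foldl (fun A (z : bool) => (if z then Ybar q else Xbar q) *m A) 1%:M (letters w).

(* The matrix of [u |-> u.a]. *)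
Definition act_mx (a : R) : 'M[F]_d :=
  \sum_g \sum_(w <- msupp (a g)) (a g)@_w *: (G g *m word_mx w).

Lemma foldl_mx (A : 'M[F]_d) (s : seq bool) :
  foldl (fun A (z : bool) => (if z then Ybar q else Xbar q) *m A) A s =
  foldl (fun A (z : bool) => (if z then Ybar q else Xbar q) *m A) 1%:M s *m A.
Proof.
elim/last_ind: s => [|s z IH]; first by rewrite /= mul1mx.
by rewrite !foldl_rcons IH mulmxA.
Qed.

Lemma word_mx1 : word_mx mone = 1%:M. Proof. by rewrite /word_mx letters1. Qed.

Lemma word_mxM v w : word_mx (mmul v w) = word_mx w *m word_mx v.
Proof. by rewrite /word_mx lettersM foldl_cat foldl_mx. Qed.

Lemma G1 : G 1%g = 1%:M.
Proof. exact: repr_mx1. Qed.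
Lemma GM g h : G (g * h)%g = G g *m G h.
Proof. by rewrite repr_mxM ?in_setT. Qed.

Lemma word_mxG w g : word_mx w *m G g = word_weight eps g w *: (G g *m word_mx w).
Proof.
rewrite /word_mx /word_weight; elim/last_ind: (letters w) => [|s z IH] /=.
  by rewrite big_nil scale1r mulmx1 mul1mx.
rewrite foldl_rcons -cats1 big_cat big_seq1 -mulmxA IH -scalemxAr !mulmxA.
by case: z; rewrite ?Xbar_equiv ?Ybar_equiv -scalemxAl scalerA.
Qed.

Definition free_mx (p : free_alg F) : 'M[F]_d := \sum_(w <- msupp p) p@_w *: word_mx w.

Lemma free_mxEw (D : {fset xyword}) p : (msupp p `<=` D)%fset ->
  free_mx p = \sum_(w <- D) p@_w *: word_mx w.
Proof.
move=> le; rewrite /free_mx [LHS](big_fset_incl _ le) => //= w _ /mcoeff_outdom ->.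
by rewrite scale0r.
Qed.

Lemma free_mxB : zmod_morphism free_mx.
Proof.
move=> p r; pose D := (msupp p `|` msupp r)%fset.
rewrite (@free_mxEw D (p - r)) ?msuppB_le // (@free_mxEw D p) ?fsubsetUl //.
rewrite (@free_mxEw D r) ?fsubsetUr // -sumrB.
by apply: eq_bigr => w _; rewrite mcoeffB scalerBl.
Qed.
HB.instance Definition _ :=
  GRing.isZmodMorphism.Build (free_alg F) 'M[F]_d free_mx free_mxB.

Lemma free_mxU c w : free_mx << c *g w >> = c *: word_mx w.
Proof. by rewrite (free_mxEw msuppU_le) big_seq_fset1 mcoeffUU. Qed.

Lemma free_mxM p r : free_mx (p * r) = free_mx r *m free_mx p.
Proof.
have E l : free_mx l = \sum_(w <- msupp l) l@_w *: word_mx w by [].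
rewrite malgME raddf_sum [in RHS](E p) mulmx_sumr; apply: eq_bigr => v _.
rewrite raddf_sum [in RHS](E r) mulmx_suml; apply: eq_bigr => w _.
by rewrite /= free_mxU word_mxM -scalemxAl -scalemxAr scalerA mulrC.
Qed.

Lemma free_mxG g p : free_mx p *m G g = G g *m free_mx (free_act eps g p).
Proof.
rewrite [p]monalgE (raddf_sum (free_act eps g)) !(raddf_sum free_mx).
rewrite mulmx_suml mulmx_sumr; apply: eq_bigr => w _.
rewrite /= free_actU !free_mxU -scalemxAl word_mxG -scalemxAr scalerA.
by rewrite mulrC.
Qed.

Lemma act_mxE a : act_mx a = \sum_g G g *m free_mx (a g).
Proof.
by apply: eq_bigr => g _; rewrite mulmx_sumr; apply: eq_bigr => w _;
  rewrite scalemxAr.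
Qed.

Lemma act_mxB : zmod_morphism act_mx.
Proof.
move=> a b; rewrite !act_mxE -sumrB; apply: eq_bigr => g _.
by rewrite !ffunE raddfB mulmxBr.
Qed.
HB.instance Definition _ := GRing.isZmodMorphism.Build R 'M[F]_d act_mx act_mxB.

Lemma act_mx_mono p g : act_mx (cr_mono eps p g) = G g *m free_mx p.
Proof.
rewrite act_mxE (bigD1 g) //= cr_monoE eqxx big1 ?addr0 // => h /negPf hg.
by rewrite cr_monoE hg raddf0 mulmx0.
Qed.

Lemma act_mx1 : act_mx 1 = 1%:M.
Proof. by rewrite act_mx_mono G1 mul1mx free_mxU scale1r word_mx1. Qed.

Lemma act_mxM a b : act_mx (a * b) = act_mx b *m act_mx a.
Proof.
rewrite [LHS]act_mxE.
rewrite (eq_bigr (fun k => \sum_g G k *m (free_mx (free_act eps g (b (g^-1 * k)%g))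
          *m free_mx (a g)))); last first.
  move=> k _; rewrite cr_mulE (raddf_sum free_mx) mulmx_sumr; apply: eq_bigr => g _.
  by rewrite /= free_mxM.
rewrite exchange_big [act_mx a]act_mxE mulmx_sumr; apply: eq_bigr => g _.
rewrite (reindex_inj (mulgI g)) act_mxE mulmx_suml; apply: eq_bigr => h _.
rewrite mulKg (gT_comm eps) GM -!mulmxA; congr (_ *m _).
by rewrite !mulmxA free_mxG.
Qed.

Lemma act_mxZ c a : act_mx (c *: a) = c *: act_mx a.
Proof.
rewrite !act_mxE scaler_sumr; apply: eq_bigr => g _.
rewrite cr_scaleE (free_mxEw (msuppZ_le _ _)) scalemxAr scaler_sumr.
by congr (_ *m _); apply: eq_bigr => w _; rewrite mcoeffZ scalerA.
Qed.

Lemma act_mx_g g : act_mx (cr_g eps g) = G g.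
Proof. by rewrite act_mx_mono free_mxU scale1r word_mx1 mulmx1. Qed.
Lemma act_mx_x : act_mx (cr_x eps) = Xbar q.
Proof.
by rewrite cr_x.unlock act_mx_mono G1 mul1mx free_mxU scale1r /word_mx lettersU /= mulmx1.
Qed.
Lemma act_mx_y : act_mx (cr_y eps) = Ybar q.
Proof.
by rewrite cr_y.unlock act_mx_mono G1 mul1mx free_mxU scale1r /word_mx lettersU /= mulmx1.
Qed.

Lemma act_mx_rel : act_mx (cr_rel eps tau) = - (ibar q *m jbar q).
Proof.
have tauE : act_mx (cr_tau eps tau) = \sum_g tau g *: G g.
  rewrite /cr_tau (raddf_sum act_mx); apply: eq_bigr => g _.
  by rewrite /= act_mxZ act_mx_g.
rewrite /cr_rel 2!act_mxB tauE 2!act_mxM act_mx_x act_mx_y -quad_rel.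
by rewrite !opprD opprK; congr (_ - _); rewrite addrC.
Qed.

(** The right [R]-module [L^1 = U]. *)
Definition L1 (_ : quadruple) : Type := 'cV[F]_d.
HB.instance Definition _ := GRing.Zmodule.on (L1 q).

Definition L1_scale (a : R^c) (u : L1 q) : L1 q := act_mx a *m (u : 'cV[F]_d).

Lemma L1_scaleA (a b : R^c) u : L1_scale a (L1_scale b u) = L1_scale (a * b) u.
Proof. by rewrite /L1_scale mulmxA -act_mxM. Qed.
Lemma L1_scale1 : left_id 1 L1_scale.
Proof. by move=> u; rewrite /L1_scale act_mx1 mul1mx. Qed.
Lemma L1_scaleDr : right_distributive L1_scale +%R.
Proof. by move=> a u v; rewrite /L1_scale mulmxDr. Qed.
Lemma L1_scaleDl u : {morph L1_scale^~ u : a b / a + b}.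
Proof. by move=> a b; rewrite /L1_scale raddfD mulmxDl. Qed.
HB.instance Definition _ := GRing.Zmodule_isLmodule.Build R^c (L1 q)
  L1_scaleA L1_scale1 L1_scaleDr L1_scaleDl.

Definition lambda (a : R) : F := (jbar q *m (act_mx a *m ibar q)) 0 0.

(* [W_n (x)_Gamma R] is the cyclic right [R]-module with generator [e_n (x) 1] and
   relations [e_n (x) g = eps(g)^n (e_n (x) 1)]; in the quotient [L^0] the class of
   [a] is that of [e_n (x) a]. *)
Inductive L0_relator : R -> Prop :=
| RelGamma g : L0_relator (cr_g eps g - (eps g ^+ n)%:A)
| RelLambda a : L0_relator (a * cr_rel eps tau + (lambda a)%:A).

Definition L0 : Type := cycmod L0_relator.
HB.instance Definition _ := GRing.Lmodule.on L0.

Definition dL (v : L0) : L1 q := act_mx (of_cyc v) *m ibar q.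

Lemma act_mx_relator a : L0_relator a -> act_mx a *m ibar q = 0.
Proof.
case=> [g|b].
  by rewrite raddfB /= act_mx_g act_mxZ act_mx1 mulmxBl -scalemxAl mul1mx ibar_equiv subrr.
rewrite raddfD /= act_mxM act_mx_rel act_mxZ act_mx1 mulmxDl -scalemxAl mul1mx.
rewrite mulNmx mulNmx -!mulmxA [_ *m (act_mx b *m _)]mx11_scalar.
by rewrite mul_mx_scalar addrC subrr.
Qed.

Lemma act_mx_rspan a : rspan L0_relator a -> act_mx a *m ibar q = 0.
Proof.
elim=> [s b /act_mx_relator Hs||u v _ Hu _ Hv].
- by rewrite act_mxM -mulmxA Hs mulmx0.
- by rewrite raddf0 mul0mx.
- by rewrite raddfD mulmxDl Hu Hv addr0.
Qed.

(* [d_L (e_n (x) a) = i(e_n).a] *)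
Lemma dLE a : dL (to_cyc L0_relator a) = act_mx a *m ibar q.
Proof.
apply/eqP; rewrite -subr_eq0 /dL -mulmxBl -raddfB.
by rewrite act_mx_rspan //; apply/to_cyc_eq; rewrite of_cycK.
Qed.

Lemma dL_linear : linear dL.
Proof.
move=> a u v; rewrite -[u]of_cycK -[v]of_cycK [a *: _](cyc_scaleE _ a) -raddfD !dLE.
by rewrite (raddfD act_mx) mulmxDl /= act_mxM -mulmxA.
Qed.
HB.instance Definition _ := GRing.isLinear.Build R^c L0 (L1 q) *:%R dL dL_linear.

(** [H^0(L) = ker d_L]; it is a right module over [R], killed by the two-sided ideal
    of [cr_rel tau], hence over [B]. *)
Definition H0_pred : {pred L0} := fun v => dL v == 0.
Lemma H0_closed : submod_closed H0_pred.
Proof.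
split=> [|a u v /eqP du /eqP dv]; first by rewrite unfold_in /H0_pred raddf0.
by rewrite unfold_in /H0_pred dL_linear du dv scaler0 addr0.
Qed.
HB.instance Definition _ := GRing.isSubmodClosed.Build R^c L0 H0_pred H0_closed.

Definition H0 : Type := {v : L0 | v \in H0_pred}.
HB.instance Definition _ := SubChoice.on H0.
HB.instance Definition _ := [SubChoice_isSubZmodule of H0 by <:].

Lemma H0_killed (z : R^c) (v : L0) :
  v \in H0_pred -> ideal2 (cr_rel eps tau) (z : R) -> z *: v = 0.
Proof.
move=> + Iz; elim: {z} Iz v => [a b||z1 z2 _ IH1 _ IH2] v Hv; last 2 first.
- by rewrite scale0r.
- by rewrite scalerDl IH1 // IH2 // addr0.
move: Hv; rewrite unfold_in /H0_pred -[v]of_cycK; set c := of_cyc v.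
rewrite dLE => /eqP dc; rewrite [_ *: _](cyc_scaleE _ _ c).
have lam0 : lambda (c * a) = 0.
  by rewrite /lambda act_mxM -mulmxA dc !mulmx0 mxE.
have -> : c * (a * cr_rel eps tau * b) =
          (c * a * cr_rel eps tau + (lambda (c * a))%:A) * b - 0.
  by rewrite lam0 scale0r addr0 subr0 !mulrA.
rewrite -(raddf0 (to_cyc L0_relator)); apply/to_cyc_eq; rewrite !subr0.
by apply: RspanGen; exact: RelLambda.
Qed.

Lemma H0_actP (b : (Btau eps tau)^c) (v : H0) :
  ((of_quot (b : Btau eps tau) : R^c) *: val v) \in H0_pred.
Proof. by rewrite rpredZ // (valP v). Qed.

Definition H0_scale (b : (Btau eps tau)^c) (v : H0) : H0 := exist (fun u : L0 => u \in H0_pred) _ (H0_actP b v).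

(* [v.pi(a) = v.a] for [a : R], with [pi : R -> B] the projection. *)
Lemma H0_scaleE (a : R) (v : H0) :
  val (H0_scale (to_B eps tau a) v) = (a : R^c) *: val v.
Proof.
apply/eqP; rewrite -subr_eq0 /= -scalerBl; apply/eqP.
apply: H0_killed (valP v) _; apply/to_quot_eq; exact: of_quotK.
Qed.

Lemma H0_valD (u v : H0) : val (u + v) = val u + val v.
Proof. exact: raddfD. Qed.

Lemma H0_scaleA (a b : (Btau eps tau)^c) v :
  H0_scale a (H0_scale b v) = H0_scale (a * b) v.
Proof.
apply/val_inj; rewrite -[a]of_quotK -[b]of_quotK H0_scaleE H0_scaleE scalerA.
rewrite [X in H0_scale X](_ : _ = to_B eps tau (of_quot b * of_quot a)).
  by rewrite H0_scaleE.
by rewrite rmorphM.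
Qed.
Lemma H0_scale1 : left_id 1 H0_scale.
Proof.
move=> v; apply/val_inj; rewrite [X in H0_scale X](_ : _ = to_B eps tau 1).
  by rewrite H0_scaleE scale1r.
by rewrite rmorph1.
Qed.
Lemma H0_scaleDr : right_distributive H0_scale +%R.
Proof.
move=> a u v; apply/val_inj; rewrite -[a]of_quotK H0_scaleE.
by rewrite H0_valD scalerDr H0_valD 2!H0_scaleE.
Qed.
Lemma H0_scaleDl v : {morph H0_scale^~ v : a b / a + b}.
Proof.
move=> a b; apply/val_inj; rewrite -[a]of_quotK -[b]of_quotK.
rewrite [X in H0_scale X](_ : _ = to_B eps tau (of_quot a + of_quot b)).
  by rewrite H0_valD 3!H0_scaleE scalerDl.
by rewrite raddfD.
Qed.
HB.instance Definition _ := GRing.Zmodule_isLmodule.Build (Btau eps tau)^c H0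
  H0_scaleA H0_scale1 H0_scaleDr H0_scaleDl.

End Nakajima.

(** * The fractional ideal attached to a quadruple *)

Definition mutually_inverse (Q : pzRingType) (d : nat) (A A' : 'M[Q]_d) : Prop :=
  A *m A' = 1%:M /\ A' *m A = 1%:M.

Section FractionalIdeal.
Variables (F : fieldType) (gT : finGroupType) (eps : primitive_char F gT).
Variables (tau : {ffun gT -> F}) (Q : unitRingType).
Variables (iota : {rmorphism Btau eps tau -> Q}) (n d : nat).
Variable q : quadruple eps tau n d.

Definition crQ (a : crossed eps) : Q := iota (to_B eps tau a).
Definition scalarQ (c : F) : Q := crQ c%:A.

(* [End(U) (x) Q] is the ring of [d x d] matrices over [Q]. *)
Definition X_pencil : 'M[Q]_d := map_mx scalarQ (Xbar q) - (crQ (cr_x eps))%:M.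
Definition Y_pencil : 'M[Q]_d := map_mx scalarQ (Ybar q) - (crQ (cr_y eps))%:M.

(* The determinants are polynomials over [F], evaluated at [x] and [y]. *)
Definition detX : Q :=
  crQ (horner_alg (cr_x eps) (\det (map_mx polyC (Xbar q) - 'X%:M))).
Definition detY : Q :=
  crQ (horner_alg (cr_y eps) (\det (map_mx polyC (Ybar q) - 'X%:M))).

(* [Xinv] and [Yinv] are meant to be the inverses of [X_pencil] and [Y_pencil];
   [Q] is not commutative, so [invmx] is not available. *)
Definition kappa (Xinv Yinv : 'M[Q]_d) : Q :=
  1 - (map_mx scalarQ (jbar q) *m Yinv *m Xinv *m map_mx scalarQ (ibar q)) 0 0.

Definition nakajima_ideal (Xinv Yinv : 'M[Q]_d) : lmodType (Btau eps tau)^c :=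
  frac_ideal iota (crQ (cr_idem eps n) * detY)
                  (crQ (cr_idem eps n) * kappa Xinv Yinv * detX).

End FractionalIdeal.

(* Main.v *)
(** The matrices [X - x], [Y - y], [i], [j] over [B] form a monad

      E_0 B^d --(Y - y, X - x, j)--> E_(-1) B^d + E_1 B^d + e_n B --(X - x, -(Y - y), -i)--> E_0 B^d

    where [E_c] projects onto the vectors of weight [eps^c] under the twisted action of the
    group.  Stability splits its last map, and genericity splits its first one because [B]
    has no nonzero finite-dimensional module.  The homology therefore has a class of
    dimension one, and [(v1, v2, w) |-> w - j (Y - y)^-1 v1] embeds it in [e_n Q].  Fox
    derivatives of the relations defining [L^0] turn an element of [H^0(L)] into a cycle of the
    monad, and PBW normal forms show that this identifies [H^0(L)] with the homology.  By
    Cayley-Hamilton, [det(Y - y)] and [det(X - x)] represent elements of [H^0(L)]; they are sent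
    to [e_n det(Y - y)] and [e_n kappa det(X - x)].  These two generate a submodule of finite
    codimension, hence everything, again because [B] has no finite-dimensional module. *)

(* The formula for [kappa] is forced by the cycle condition: a cycle with [v2 = 0] and last
   component [w] has [v1 = (X - x)^-1 i w], so its image is [w - j (Y - y)^-1 (X - x)^-1 i w], that
   is [kappa w]; a cycle with [v1 = 0] has image [w].

   The weights [-1], [0], [1] appear because [x] and [y] do not commute with the group: [X - x]
   raises the weight by one and [Y - y] lowers it. The two maps of the monad compose to zero only on
   the image of [E_0], where the group acts on [U] as it does on the left of [B].

   The obstacle is that [H0] is cut out of a quotient of [R], whose relators involve [lambda] and do
   not vanish in [B]. Fox derivatives repair this: the derivatives of the relator of [a] are the
   first components of the boundary of [E_0 (i.a)], and [lambda a] supplies the component along [j].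

   PBW bases are needed in both orders of the letters: division by [Y - y] leaves remainders without
   [y], division by [X - x] remainders without [x], and both are used. *)
Require Import Defs.
From HB Require Import structures.
From mathcomp Require Import all_boot all_order all_algebra.
From mathcomp Require Import all_fingroup all_solvable all_character.
From mathcomp Require Import finmap monalg complex boolp functions reals.
From mathcomp Require Import separable cyclotomic ring zify.

Set Implicit Arguments.
Unset Strict Implicit.
Unset Printing Implicit Defensive.

Import GRing.Theory.
Local Open Scope ring_scope.

(** * The crossed product and its right modules *)

Section CrossedProduct.
Variables (F : fieldType) (gT : finGroupType) (eps : primitive_char F gT).
Notation R := (crossed eps).

Definition cr_letter (z : bool) : R := if z then cr_y eps else cr_x eps.

Lemma cr_letterE z : cr_letter z = cr_mono eps << xyletter z >> 1%g.
Proof. by case: z; rewrite /= ?cr_x.unlock ?cr_y.unlock. Qed.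

Definition word (s : seq bool) : xyword := FMonom s.

Lemma word_letters w : word (letters w) = w.
Proof. by case: w. Qed.

Lemma word_rcons s z : word (rcons s z) = mmul (word s) (xyletter z).
Proof. by apply: val_inj; rewrite /= [RHS]lettersM lettersU -cats1. Qed.

Lemma cr_mono_letter c w g z :
  cr_mono eps << c *g w >> g * cr_letter z =
  cr_mono eps << (if z then (eps g)^-1 else eps g) * c *g mmul w (xyletter z) >> g.
Proof.
rewrite cr_letterE cr_monoM mulg1 free_act_letter malgM_def.
have -> : (if z then (eps g)^-1 else eps g) *: (<< xyletter z >> : free_alg F) =
  << (if z then (eps g)^-1 else eps g) *g xyletter z >>.
  by apply/malgP=> k; rewrite mcoeffZ !mcoeffU mulrnAr mulr1.
by rewrite fgmulUU mulrC.
Qed.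

Lemma cr_mono_g p g h : cr_mono eps p g * cr_g eps h = cr_mono eps p (g * h)%g.
Proof. by rewrite cr_monoM free_act1 mulr1. Qed.

Lemma cr_monoD p q g : cr_mono eps (p + q) g = cr_mono eps p g + cr_mono eps q g.
Proof. by apply/ffunP => k; rewrite ffunE !cr_monoE; case: eqP; rewrite ?addr0. Qed.

Lemma cr_mono0 g : cr_mono eps 0 g = 0.
Proof. by apply/ffunP => k; rewrite ffunE !cr_monoE; case: eqP. Qed.

Lemma cr_mono_sum (I : Type) (r : seq I) (f : I -> free_alg F) g :
  cr_mono eps (\sum_(i <- r) f i) g = \sum_(i <- r) cr_mono eps (f i) g.
Proof. by apply: (big_morph (cr_mono eps ^~ g)) => [p q|]; [exact: cr_monoD|exact: cr_mono0]. Qed.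

Lemma cr_decomp (a : R) :
  a = \sum_g \sum_(w <- msupp (a g)) cr_mono eps << (a g)@_w *g w >> g.
Proof.
apply/ffunP => k; rewrite sum_ffunE (bigD1 k) //= [X in _ + X]big1 ?addr0 => [|g gk].
  by rewrite -cr_mono_sum cr_monoE eqxx -monalgE.
by rewrite -cr_mono_sum cr_monoE -monalgE eq_sym (negPf gk).
Qed.

Lemma cr_monoUZ c w g : cr_mono eps << c *g w >> g = c *: cr_mono eps << w >> g.
Proof.
rewrite -cr_monoZ; congr cr_mono.
by apply/malgP=> k; rewrite mcoeffZ !mcoeffU mulrnAr mulr1.
Qed.

Lemma crossed_ind (P : R -> Prop) :
  P 1 -> (forall c a b, P a -> P b -> P (c *: a + b)) ->
  (forall a z, P a -> P (a * cr_letter z)) ->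
  (forall a g, P a -> P (a * cr_g eps g)) -> forall a, P a.
Proof.
move=> P1 PD Pz Pg a.
have P0 : P 0 by have := PD (-1) 1 1 P1 P1; rewrite scaleN1r addNr.
have Pw w : P (cr_mono eps << w >> 1%g).
  rewrite -[w]word_letters; elim/last_ind: (letters w) => [|s z IH].
    have -> : word [::] = mone by apply: val_inj; rewrite /= [RHS]letters1.
    exact: P1.
  rewrite word_rcons; have := Pz _ z IH; rewrite cr_mono_letter.
  by case: z {IH}; rewrite eps1 ?invr1 mul1r.
rewrite [a]cr_decomp; elim/big_ind: _ => // [u v Pu Pv|g _].
  by rewrite -[u]scale1r; exact: PD.
elim/big_ind: _ => // [u v Pu Pv|w _]; first by rewrite -[u]scale1r; exact: PD.
rewrite cr_monoUZ -[_ *: _]addr0; apply: PD => //.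
by have := Pg _ g (Pw w); rewrite cr_mono_g mul1g.
Qed.

Lemma cr_scale_mulA c (a b : R) : a * (c *: b) = c *: (a * b).
Proof. by rewrite -cr_scaleAr. Qed.

End CrossedProduct.

(** * Right [R]-modules given by operators *)

Section UniversalAction.
Variables (F : fieldType) (gT : finGroupType) (eps : primitive_char F gT).
Variable V : zmodType.
Variables (sc : F -> V -> V) (opz : bool -> V -> V) (opg : gT -> V -> V).
Notation R := (crossed eps).

(** A presentation of right [R]-modules, with [opg_z] the relation [g x = eps(g) x g] and its
    analogue for [y], read from left to right. It serves both the PBW model and the Fox module,
    whose relations are easier to verify on generators. *)
Record action_axioms := ActionAxioms {
  sc_add : forall c u v, sc c (u + v) = sc c u + sc c v;
  sc_addl : forall c d v, sc (c + d) v = sc c v + sc d v;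
  sc_mul : forall c d v, sc (c * d) v = sc c (sc d v);
  sc_one : forall v, sc 1 v = v;
  opz_add : forall z u v, opz z (u + v) = opz z u + opz z v;
  opg_add : forall g u v, opg g (u + v) = opg g u + opg g v;
  opz_sc : forall z c v, opz z (sc c v) = sc c (opz z v);
  opg_sc : forall g c v, opg g (sc c v) = sc c (opg g v);
  opg_one : forall v, opg 1%g v = v;
  opg_mul : forall g h v, opg (g * h)%g v = opg h (opg g v);
  opg_z : forall g z v,
    opz z (opg g v) = sc (if z then (eps g)^-1 else eps g) (opg g (opz z v))
}.
Hypothesis ax : action_axioms.

Let sc0 v : sc 0 v = 0.
Proof. by apply: (addrI (sc 0 v)); rewrite addr0 -sc_addl // addr0. Qed.
Let scr0 c : sc c 0 = 0.
Proof. by apply: (addrI (sc c 0)); rewrite addr0 -sc_add // addr0. Qed.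
Let opz0 z : opz z 0 = 0.
Proof. by rewrite -(sc0 0) opz_sc // sc0. Qed.
Let opg0 g : opg g 0 = 0.
Proof. by rewrite -(sc0 0) opg_sc // sc0. Qed.

Definition word_act (w : xyword) (v : V) : V := foldl (fun u z => opz z u) v (letters w).

Definition act (a : R) (v : V) : V :=
  \sum_g \sum_(w <- msupp (a g)) sc (a g)@_w (opg g (word_act w v)).

Definition free_action (p : free_alg F) g (v : V) : V :=
  \sum_(w <- msupp p) sc p@_w (opg g (word_act w v)).

Lemma free_actionEw (D : {fset xyword}) p g v : (msupp p `<=` D)%fset ->
  free_action p g v = \sum_(w <- D) sc p@_w (opg g (word_act w v)).
Proof.
move=> le; rewrite /free_action [LHS](big_fset_incl _ le) => //= w _ /mcoeff_outdom ->.
exact: sc0.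
Qed.

Lemma free_actionD p r g v :
  free_action (p + r) g v = free_action p g v + free_action r g v.
Proof.
pose D := (msupp p `|` msupp r)%fset.
rewrite (@free_actionEw D (p + r)) ?msuppD_le // (@free_actionEw D p) ?fsubsetUl //.
rewrite (@free_actionEw D r) ?fsubsetUr // -big_split.
by apply: eq_bigr => w _; rewrite mcoeffD sc_addl.
Qed.

Lemma free_actionZ c p g v : free_action (c *: p) g v = sc c (free_action p g v).
Proof.
rewrite (free_actionEw _ _ (msuppZ_le c p)) /free_action.
rewrite (big_morph (sc c) (sc_add ax c) (scr0 c)).
by apply: eq_bigr => w _; rewrite mcoeffZ sc_mul.
Qed.

Lemma actE a v : act a v = \sum_g free_action (a g) g v.
Proof. by []. Qed.

Lemma actDl a b v : act (a + b) v = act a v + act b v.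
Proof.
rewrite !actE -big_split; apply: eq_bigr => g _.
by rewrite (_ : (a + b) g = a g + b g) ?free_actionD // ffunE.
Qed.

Lemma actZl c a v : act (c *: a) v = sc c (act a v).
Proof.
rewrite !actE (big_morph (sc c) (sc_add ax c) (scr0 c)).
by apply: eq_bigr => g _; rewrite cr_scaleE free_actionZ.
Qed.

Lemma act0l v : act 0 v = 0.
Proof. by rewrite -(scale0r 0) actZl sc0. Qed.

Lemma actNl a v : act (- a) v = - act a v.
Proof. by apply: (addrI (act a v)); rewrite -actDl !subrr act0l. Qed.

Lemma act_mono c w g v : act (cr_mono eps << c *g w >> g) v = sc c (opg g (word_act w v)).
Proof.
rewrite actE (bigD1 g) //= big1 ?addr0 => [|h hg]; last first.
  by rewrite cr_monoE (negPf hg) /free_action msupp0 big_seq_fset0.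
by rewrite cr_monoE eqxx (free_actionEw _ _ msuppU_le)
  big_seq_fset1 mcoeffUU.
Qed.

Lemma act1l v : act 1 v = v.
Proof. by rewrite /= act_mono sc_one // opg_one // /word_act letters1. Qed.

Lemma act_mul_letter a z v : act (a * cr_letter eps z) v = opz z (act a v).
Proof.
rewrite [a]cr_decomp mulr_suml.
rewrite (big_morph (act ^~ v) (fun b c => actDl b c v) (act0l v)).
rewrite (big_morph (act ^~ v) (fun b c => actDl b c v) (act0l v)).
rewrite (big_morph (opz z) (opz_add ax z) (opz0 z)); apply: eq_bigr => g _.
rewrite mulr_suml.
rewrite (big_morph (act ^~ v) (fun b c => actDl b c v) (act0l v)).
rewrite (big_morph (act ^~ v) (fun b c => actDl b c v) (act0l v)).
rewrite (big_morph (opz z) (opz_add ax z) (opz0 z)); apply: eq_bigr => w _.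
rewrite cr_mono_letter !act_mono opz_sc // opg_z // -sc_mul // mulrC.
by rewrite /word_act lettersM lettersU foldl_cat.
Qed.

Lemma act_mul_g a g v : act (a * cr_g eps g) v = opg g (act a v).
Proof.
rewrite [a]cr_decomp mulr_suml.
rewrite (big_morph (act ^~ v) (fun b c => actDl b c v) (act0l v)).
rewrite (big_morph (act ^~ v) (fun b c => actDl b c v) (act0l v)).
rewrite (big_morph (opg g) (opg_add ax g) (opg0 g)); apply: eq_bigr => h _.
rewrite mulr_suml.
rewrite (big_morph (act ^~ v) (fun b c => actDl b c v) (act0l v)).
rewrite (big_morph (act ^~ v) (fun b c => actDl b c v) (act0l v)).
rewrite (big_morph (opg g) (opg_add ax g) (opg0 g)); apply: eq_bigr => w _.
by rewrite cr_mono_g !act_mono opg_sc // opg_mul.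
Qed.

Lemma actM a b v : act (a * b) v = act b (act a v).
Proof.
elim/crossed_ind: b => [|c b b' IH IH'|b z IH|b g IH].
- by rewrite mulr1 act1l.
- by rewrite mulrDr cr_scale_mulA !actDl !actZl IH IH'.
- by rewrite mulrA !act_mul_letter IH.
- by rewrite mulrA !act_mul_g IH.
Qed.

Lemma actDr a u v : act a (u + v) = act a u + act a v.
Proof.
elim/crossed_ind: a => [|c b b' IH IH'|b z IH|b g IH].
- by rewrite !act1l.
- by rewrite !actDl !actZl IH IH' sc_add // addrACA.
- by rewrite !act_mul_letter IH opz_add.
- by rewrite !act_mul_g IH opg_add.
Qed.

Lemma act_letter z v : act (cr_letter eps z) v = opz z v.
Proof. by rewrite -[cr_letter eps z]mul1r act_mul_letter act1l. Qed.

Lemma act_g g v : act (cr_g eps g) v = opg g v.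
Proof. by rewrite -[cr_g eps g]mul1r act_mul_g act1l. Qed.

Lemma act_tau (tau : {ffun gT -> F}) v :
  act (cr_tau eps tau) v = \sum_g sc (tau g) (opg g v).
Proof.
rewrite /cr_tau (big_morph (act ^~ v) (fun b c => actDl b c v) (act0l v)).
by apply: eq_bigr => g _; rewrite actZl act_g.
Qed.

End UniversalAction.

(** * Characters of a cyclic group *)

Section PrimitiveRoot.
Variables (F : numClosedFieldType) (gT : finGroupType) (eps : primitive_char F gT).
Notation m := #|gT|.
Import Num.Theory.

Lemma primitive_root_exists n : (0 < n)%N -> {z : F | n.-primitive_root z}.
Proof.
move=> n_gt0; have [r] := closed_field_poly_normal ('X^n - 1 : {poly F}).
rewrite lead_coefXnsubC // scale1r => Dp.
have rn1: all n.-unity_root r by apply/allP=> z; rewrite -root_prod_XsubC -Dp.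
have sz_r: (n < (size r).+1)%N by rewrite -(size_prod_XsubC r id) -Dp size_XnsubC.
apply/sig_eqW; have [|z _] := hasP (has_prim_root n_gt0 rn1 _ sz_r); last by exists z.
by rewrite -separable_prod_XsubC -Dp separable_Xn_sub_1 // pnatr_eq0 -lt0n.
Qed.

Lemma epsX k g : eps (g ^+ k)%g = eps g ^+ k.
Proof. by elim: k => [|k IH]; rewrite ?expg0 ?eps1 // expgS epsM IH exprS. Qed.

(** Algebraic closure in characteristic zero gives a primitive [m]-th root [z], and sending a
    generator [g0] to [z] defines a character. As it is a power of [eps], the order of [eps g0], a
    divisor of [m], is also a multiple of [m]. *)
Lemma eps_primitive :
  exists2 g0, (forall g, exists k, g = (g0 ^+ k)%g) & m.-primitive_root (eps g0).
Proof.
have [g0 Dg] := cyclicP (pchar_cyclic eps).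
have og : #[g0]%g = m by rewrite /order -Dg cardsT.
have gen g : exists i : 'I_m, g == (g0 ^+ i)%g.
  have : g \in <[g0]>%g by rewrite -Dg in_setT.
  by case/cyclePmin=> i; rewrite og => lt_i ->; exists (Ordinal lt_i).
have m_gt0 : (0 < m)%N by rewrite -og order_gt0.
have [z pz] := primitive_root_exists m_gt0.
pose chi g := z ^+ xchoose (gen g).
have chiE k : chi (g0 ^+ k)%g = z ^+ k.
  have /eqP := xchooseP (gen (g0 ^+ k)%g) => /eqP; rewrite eq_expg_mod_order og.
  by move=> e; apply/eqP; rewrite eq_sym (eq_prim_root_expr pz).
have chi_hom : is_character chi.
  split=> [|g h]; first by rewrite -(expg0 g0) chiE expr0.
  have [[i /eqP->] [j /eqP->]] := (gen g, gen h).
  by rewrite -expgD !chiE exprD.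
exists g0 => [g|]; first by have [i /eqP->] := gen g; exists i.
have [k Dchi] := pchar_gen eps chi_hom.
have : chi g0 = z by rewrite -(expg1 g0) chiE.
rewrite Dchi => De; have em : eps g0 ^+ m = 1 by rewrite -epsX -og expg_order eps1.
have [q pq dvq] := prim_order_exists m_gt0 em.
suff -> : m = q by [].
apply/eqP; rewrite eqn_dvd dvq andbT (prim_order_dvd pz) -De -exprM mulnC exprM.
by rewrite (prim_expr_order pq) expr1n.
Qed.

Lemma card_neq0 : (m%:R : F) != 0.
Proof. by rewrite pnatr_eq0 -lt0n; apply/card_gt0P; exists 1%g. Qed.

Lemma card_gt0G : (0 < m)%N.
Proof. by apply/card_gt0P; exists 1%g. Qed.

Lemma eps_expm g : eps g ^+ m = 1.
Proof.
have [g0 gen pz] := eps_primitive; have [k ->] := gen g.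
by rewrite epsX exprAC (prim_expr_order pz) expr1n.
Qed.

Lemma eps_inj g : eps g = 1 -> g = 1%g.
Proof.
have [g0 gen pz] := eps_primitive; have [k ->] := gen g.
rewrite epsX => /eqP; rewrite -(prim_order_dvd pz) => /dvdnP[q ->].
rewrite expgM; have [|] := eqVneq (g0 ^+ q)%g 1%g => [->|_]; first by rewrite expg1n.
rewrite -expgM mulnC expgM.
by have := expg_cardG (in_setT g0); rewrite cardsT => ->; rewrite expg1n.
Qed.

Lemma eps_expr_inj (k l : nat) : (k < m)%N -> (l < m)%N ->
  (forall g, eps g ^+ k = eps g ^+ l) -> k = l.
Proof.
move=> lk ll E; have [g0 _ pz] := eps_primitive.
have /eqP := E g0; rewrite (eq_prim_root_expr pz) !modn_small //.
by move=> /eqP.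
Qed.

Lemma sum_character (chi : gT -> F) : (forall g h, chi (g * h)%g = chi g * chi h) ->
  (exists h, chi h != 1) -> \sum_g chi g = 0.
Proof.
move=> chiM [h nh]; have : (chi h - 1) * \sum_g chi g = 0.
  rewrite mulrBl mul1r mulr_sumr [X in _ - X](reindex_inj (mulgI h)).
  by apply/eqP; rewrite subr_eq0; apply/eqP/eq_bigr => g _.
by move/eqP; rewrite mulf_eq0 subr_eq0 (negPf nh) => /eqP.
Qed.

Lemma sum_eps_expr g : \sum_(k < m) eps g ^+ k = if g == 1%g then m%:R else 0.
Proof.
case: eqP => [->|ng].
  by under eq_bigr do rewrite eps1 expr1n; rewrite sumr_const card_ord.
have : (eps g - 1) * \sum_(k < m) eps g ^+ k = 0.
  by rewrite -subrX1 eps_expm subrr.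
move/eqP; rewrite mulf_eq0 subr_eq0 => /orP[/eqP/eps_inj //|/eqP //].
Qed.

Lemma cr_idem_sum : \sum_(k < m) cr_idem eps k = 1.
Proof.
rewrite /cr_idem -scaler_sumr exchange_big /= (bigD1 1%g) //= [X in _ + X]big1.
  rewrite addr0 -scaler_suml; under eq_bigr do rewrite eps1 expr1n invr1.
  by rewrite sumr_const card_ord scalerA mulVf ?card_neq0 // scale1r.
move=> g ng; rewrite -scaler_suml.
rewrite (_ : \sum_(k < m) _ = 0) ?scale0r //.
rewrite -[RHS](_ : \sum_(k < m) eps g^-1%g ^+ k = 0); last first.
  by rewrite sum_eps_expr invg_eq1 (negPf ng).
apply: eq_bigr => k _; rewrite -exprVn; congr (_ ^+ _).
by apply: (mulfI (eps_neq0 eps g)); rewrite mulfV ?eps_neq0 // -epsM mulgV eps1.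
Qed.

End PrimitiveRoot.

(** * A PBW basis of [B] *)

Section PBW.
Variables (F : numClosedFieldType) (gT : finGroupType) (eps : primitive_char F gT).
Variables (tau : {ffun gT -> F}) (t : bool).
Notation R := (crossed eps).
Notation B := (Btau eps tau).
Notation m := #|gT|.

Notation pbw_mod := (nat -> nat -> F).

(** The scalar [c] in [z g = c (g z)]. *)
Definition letter_weight (z : bool) (g : gT) : F := if z then eps g else (eps g)^-1.

Lemma letter_weight_neq0 z g : letter_weight z g != 0.
Proof. by case: z; rewrite /letter_weight ?invr_eq0 eps_neq0. Qed.

Lemma letter_weightM z g h :
  letter_weight z (g * h)%g = letter_weight z g * letter_weight z h.
Proof. by case: z; rewrite /letter_weight epsM ?invfM. Qed.

(** The scalar by which [g] acts on the right of [e_nu p^k q^l], where [p] is the letter [t] and [q]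
    the other one; the two letters have inverse weights. *)
Definition mon_weight (nu k l : nat) (g : gT) : F :=
  eps g ^+ nu * letter_weight t g ^+ k / letter_weight t g ^+ l.

Lemma mon_weightM nu k l g h :
  mon_weight nu k l (g * h)%g = mon_weight nu k l g * mon_weight nu k l h.
Proof.
rewrite /mon_weight epsM letter_weightM !exprMn invfM.
by rewrite (mulrACA (eps g ^+ nu)) [LHS]mulrACA.
Qed.

Lemma mon_weight1 nu k l : mon_weight nu k l 1%g = 1.
Proof.
have l1 : letter_weight t 1%g = 1 by rewrite /letter_weight eps1 invr1; case: t.
by rewrite /mon_weight eps1 l1 !expr1n invr1 !mulr1.
Qed.

Lemma mon_weightSl nu k l g :
  mon_weight nu k.+1 l g = letter_weight t g * mon_weight nu k l g.
Proof. by rewrite /mon_weight exprS; ring. Qed.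

Lemma mon_weightSr nu k l g :
  mon_weight nu k l g = letter_weight t g * mon_weight nu k l.+1 g.
Proof.
rewrite /mon_weight exprS invfM [_^-1 * _]mulrC [_ * (_ * _^-1)]mulrA.
by rewrite [RHS]mulrC mulfVK ?letter_weight_neq0.
Qed.

(** The scalar by which [q p - p q] acts on the right of [e_nu p^k q^l]; this commutator is [tau]
    when [q] is [x], and [- tau] when [q] is [y]. *)
Definition mon_tau nu k l : F :=
  (if t then 1 else -1) * \sum_g tau g * mon_weight nu k l g.

(* The coefficient of [p^k q^(l-1)] in [p^k q^l p], for [p], [q] the letters [t] and
   [~~ t], on vectors of weight [eps ^+ nu]. *)
Definition swap_coef nu k l : F := \sum_(s < l) mon_tau nu k s.

Variable nu : nat.

Definition pbw_sc (c : F) (f : pbw_mod) : pbw_mod := fun k l => c * f k l.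
(** Right multiplication by [p]. Only [p^(k-1) q^l] and [p^k q^(l+1)] contribute to [p^k q^l], so
    supports need not be finite and all coefficient functions form a module. *)
Definition pbw_first (f : pbw_mod) : pbw_mod :=
  fun k l => (if k is k'.+1 then f k' l else 0) + swap_coef nu k l.+1 * f k l.+1.
Definition pbw_second (f : pbw_mod) : pbw_mod :=
  fun k l => if l is l'.+1 then f k l' else 0.
Definition pbw_z (z : bool) : pbw_mod -> pbw_mod :=
  if z == t then pbw_first else pbw_second.
Definition pbw_g (g : gT) (f : pbw_mod) : pbw_mod :=
  fun k l => mon_weight nu k l g * f k l.

Lemma pbwP (f h : pbw_mod) : (forall k l, f k l = h k l) -> f = h.
Proof. by move=> E; apply/funext => k; apply/funext => l. Qed.

Lemma pbw_addE (f h : pbw_mod) k l : (f + h : pbw_mod) k l = f k l + h k l.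
Proof. by []. Qed.

Lemma pbw_oppE (f : pbw_mod) k l : (- f : pbw_mod) k l = - f k l.
Proof. by []. Qed.

Lemma pbw_sumE (I : Type) (r : seq I) (f : I -> pbw_mod) k l :
  (\sum_(i <- r) f i : pbw_mod) k l = \sum_(i <- r) f i k l.
Proof. by elim/big_rec2: _ => // i u v _ <-. Qed.

Lemma pbw_axioms : action_axioms eps pbw_sc pbw_z pbw_g.
Proof.
split.
- by move=> c u v; apply: pbwP => k l; rewrite /pbw_sc !pbw_addE mulrDr.
- by move=> c d v; apply: pbwP => k l; rewrite /pbw_sc !pbw_addE mulrDl.
- by move=> c d v; apply: pbwP => k l; rewrite /pbw_sc mulrA.
- by move=> v; apply: pbwP => k l; rewrite /pbw_sc mul1r.
- move=> z u v; apply: pbwP => k l; rewrite /pbw_z; case: (z == t); rewrite pbw_addE.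
    rewrite /pbw_first pbw_addE mulrDr [RHS]addrACA; congr (_ + _).
    by case: k; rewrite ?addr0.
  by case: l => [|l]; rewrite /pbw_second ?addr0.
- by move=> g u v; apply: pbwP => k l; rewrite /pbw_g !pbw_addE mulrDr.
- move=> z c v; apply: pbwP => k l; rewrite /pbw_z; case: (z == t).
    by rewrite /pbw_first /pbw_sc mulrDr; case: k => [|k]; rewrite ?mulr0; ring.
  by case: l => [|l]; rewrite /pbw_second /pbw_sc ?mulr0.
- by move=> g c v; apply: pbwP => k l; rewrite /pbw_g /pbw_sc mulrCA.
- by move=> v; apply: pbwP => k l; rewrite /pbw_g mon_weight1 mul1r.
- move=> g h v; apply: pbwP => k l; rewrite /pbw_g mon_weightM.
  by rewrite mulrA [_ h * _]mulrC.
- move=> g z v; apply: pbwP => k l; rewrite /pbw_z /pbw_sc /pbw_g.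
  have [->|nz] := eqVneq z t.
    have -> : (if t then (eps g)^-1 else eps g) = (letter_weight t g)^-1.
      by rewrite /letter_weight; case: t; rewrite ?invrK.
    rewrite /pbw_first !mulrDr; congr (_ + _).
      case: k => [|k]; rewrite ?mulr0 // mon_weightSl !mulrA mulVf ?mul1r //.
      exact: letter_weight_neq0.
    by rewrite (mon_weightSr nu k l) -(mulrA (letter_weight t g)) mulKf
      ?letter_weight_neq0 // mulrCA.
  have -> : (if z then (eps g)^-1 else eps g) = letter_weight t g.
    by move: nz; rewrite /letter_weight; case: t; case: z.
  by case: l => [|l]; rewrite /pbw_second ?mulr0 // mon_weightSr mulrA.
Qed.

Definition pbw_act (a : R) (f : pbw_mod) : pbw_mod := act pbw_sc pbw_z pbw_g a f.
Notation ax := pbw_axioms.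

(** As [swap_coef] is a sum of consecutive [mon_tau], the commutator of the two letter operators
    telescopes to multiplication by [mon_tau], which up to sign is how [tau] acts. *)
Lemma pbw_act_rel f : pbw_act (cr_rel eps tau) f = 0.
Proof.
have z0 : pbw_z (~~ t) = pbw_second by rewrite /pbw_z; case: t.
have z1 : pbw_z t = pbw_first by rewrite /pbw_z eqxx.
have swap : pbw_first (pbw_second f) - pbw_second (pbw_first f) =
    (fun k l => mon_tau nu k l * f k l).
  apply: pbwP => k l; rewrite pbw_addE pbw_oppE /pbw_first /pbw_second.
  case: l => [|l].
    rewrite /swap_coef big_ord1 subr0; case: k => [|k]; ring.
  by rewrite [swap_coef nu k l.+2]/swap_coef big_ord_recr -/(swap_coef nu k l.+1) /=; ring.
have Etau : act pbw_sc pbw_z pbw_g (cr_tau eps tau) f =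
    fun k l => (if t then 1 else -1) * (mon_tau nu k l * f k l).
  rewrite act_tau; last exact: ax.
  apply: pbwP => k l; rewrite pbw_sumE.
  have -> : (if t then 1 else -1) * (mon_tau nu k l * f k l) =
      (\sum_g tau g * mon_weight nu k l g) * f k l.
    by rewrite /mon_tau; case: t; rewrite ?mulN1r ?mul1r ?mulrNN // mulNr opprK.
  by rewrite mulr_suml; apply: eq_bigr => g _; rewrite /pbw_sc /pbw_g mulrA.
have Ex : cr_x eps = cr_letter eps false by [].
have Ey : cr_y eps = cr_letter eps true by [].
rewrite /pbw_act /cr_rel !(actDl ax) !(actNl ax) Etau Ex Ey !(actM ax) !(act_letter ax).
move: z0 z1 swap; rewrite /mon_tau; case: t => z0 z1 swap; rewrite z0 z1.
  rewrite swap; apply: pbwP => k l; rewrite pbw_addE pbw_oppE.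
  by rewrite !mul1r subrr.
rewrite -[X in X - _]opprB swap; apply: pbwP => k l; rewrite pbw_addE !pbw_oppE.
by rewrite !mulN1r !mulNr opprK subrr.
Qed.

Lemma pbw_act_ideal a f : ideal2 (cr_rel eps tau) a -> pbw_act a f = 0.
Proof.
have act0 b : pbw_act b 0 = 0.
  by apply: (addrI (pbw_act b 0)); rewrite -(actDr ax) !addr0.
elim=> [b c||b c _ IHb _ IHc].
- by rewrite /pbw_act !(actM ax) -/(pbw_act _ _) -/(pbw_act _ (act _ _ _ _ _))
    pbw_act_rel act0.
- exact: (act0l ax).
- by rewrite /pbw_act (actDl ax) -!/(pbw_act _ _) IHb IHc addr0.
Qed.

Definition pbw_one : pbw_mod := fun k l => ((k == 0%N) && (l == 0%N))%:R.

End PBW.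

(* Locked, lest unification unfold products of generators into the quotient. *)
HB.lock Definition Bs (F : fieldType) (gT : finGroupType) (eps : primitive_char F gT)
    (tau : {ffun gT -> F}) (c : F) : Btau eps tau := to_B eps tau c%:A.
HB.lock Definition Bz (F : fieldType) (gT : finGroupType) (eps : primitive_char F gT)
    (tau : {ffun gT -> F}) (z : bool) : Btau eps tau := to_B eps tau (cr_letter eps z).
HB.lock Definition Bg (F : fieldType) (gT : finGroupType) (eps : primitive_char F gT)
    (tau : {ffun gT -> F}) (g : gT) : Btau eps tau := to_B eps tau (cr_g eps g).
HB.lock Definition Be (F : fieldType) (gT : finGroupType) (eps : primitive_char F gT)
    (tau : {ffun gT -> F}) (k : nat) : Btau eps tau := to_B eps tau (cr_idem eps k).

(** * Generators and relations of [B] *)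

Section BtauGenerators.
Variables (F : fieldType) (gT : finGroupType) (eps : primitive_char F gT).
Variable tau : {ffun gT -> F}.
Notation B := (Btau eps tau).

Notation Bs := (Bs eps tau).
Notation Bz := (Bz eps tau).
Notation Bg := (Bg eps tau).
Notation Be := (Be eps tau).

Lemma Bs_zmod_morphism : zmod_morphism Bs.
Proof. by move=> c d; rewrite Bs.unlock scalerBl rmorphB. Qed.
HB.instance Definition _ := GRing.isZmodMorphism.Build F B Bs Bs_zmod_morphism.
Lemma Bs_monoid_morphism : monoid_morphism Bs.
Proof.
split=> [|c d]; rewrite Bs.unlock; first by rewrite scale1r rmorph1.
by rewrite -rmorphM; congr (to_quot _ _); rewrite -scalerAl mul1r scalerA.
Qed.
HB.instance Definition _ := GRing.isMonoidMorphism.Build F B Bs Bs_monoid_morphism.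

Lemma to_BZ c a : to_B eps tau (c *: a) = Bs c * to_B eps tau a.
Proof. by rewrite Bs.unlock -rmorphM -scalerAl mul1r. Qed.

Lemma Bs_comm c b : b * Bs c = Bs c * b.
Proof.
rewrite -[b]of_quotK -to_BZ Bs.unlock -[LHS]rmorphM; congr (to_quot _ _).
by rewrite cr_scale_mulA mulr1.
Qed.

Lemma Btau_ind (P : B -> Prop) :
  P 1 -> (forall c a b, P a -> P b -> P (Bs c * a + b)) ->
  (forall a z, P a -> P (a * Bz z)) ->
  (forall a g, P a -> P (a * Bg g)) -> forall b, P b.
Proof.
move=> P1 PD Pz Pg b; rewrite -[b]of_quotK.
elim/crossed_ind: (of_quot b) => [|c a a' IH IH'|a z IH|a g IH].
- by rewrite rmorph1.
- by rewrite rmorphD /= to_BZ; exact: PD.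
- by rewrite rmorphM; have := Pz _ z IH; rewrite Bz.unlock.
- by rewrite rmorphM; have := Pg _ g IH; rewrite Bg.unlock.
Qed.

Lemma Bg1 : Bg 1%g = 1. Proof. by rewrite Bg.unlock; exact: rmorph1. Qed.

Lemma BgM g h : Bg (g * h)%g = Bg g * Bg h.
Proof. by rewrite Bg.unlock -rmorphM cr_gM. Qed.

Lemma Bgz g z :
  Bg g * Bz z = Bs (if z then (eps g)^-1 else eps g) * (Bz z * Bg g).
Proof.
rewrite Bg.unlock Bz.unlock -!rmorphM -to_BZ; congr (to_quot _ _).
by case: z; rewrite ?cr_gx ?cr_gy.
Qed.

Lemma Btau_rel : Bz false * Bz true - Bz true * Bz false = to_B eps tau (cr_tau eps tau).
Proof.
apply/eqP; rewrite Bz.unlock -subr_eq0 -!rmorphM -!rmorphB -(rmorph0 (to_B eps tau)).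
apply/eqP/to_quot_eq; rewrite subr0 -[X in ideal2 _ X]mul1r -[X in ideal2 _ X]mulr1.
exact: Ideal2Gen.
Qed.

Lemma BtauE : to_B eps tau (cr_tau eps tau) = \sum_g Bs (tau g) * Bg g.
Proof. by rewrite Bg.unlock raddf_sum; apply: eq_bigr => g _; exact: to_BZ. Qed.

Lemma BeE k : Be k = Bs (#|gT|%:R^-1) * \sum_g Bs (eps g ^+ k)^-1 * Bg g.
Proof.
transitivity (Bs (#|gT|%:R^-1) * to_B eps tau (\sum_g (eps g ^+ k)^-1 *: cr_g eps g)).
  by rewrite Be.unlock; exact: to_BZ.
rewrite Bg.unlock (raddf_sum (to_B eps tau)); congr (_ * _).
by apply: eq_bigr => g _; exact: to_BZ.
Qed.

Lemma Be_Bg k g : Be k * Bg g = Bs (eps g ^+ k) * Be k.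
Proof. by rewrite Be.unlock Bg.unlock -rmorphM cr_idem_mulg; exact: to_BZ. Qed.

Lemma Bg_comm g h : Bg g * Bg h = Bg h * Bg g.
Proof. by rewrite -!BgM (gT_comm eps). Qed.

End BtauGenerators.

Section Coefficients.
Variables (F : numClosedFieldType) (gT : finGroupType) (eps : primitive_char F gT).
Variables (tau : {ffun gT -> F}) (t : bool).
Notation B := (Btau eps tau).
Notation m := #|gT|.
Notation pbw_mod := (nat -> nat -> F).
Notation Bs := (Bs eps tau).
Notation Bz := (Bz eps tau).
Notation Bg := (Bg eps tau).
Notation Be := (Be eps tau).

Section OneWeight.
Variable nu : nat.
Notation ax := (pbw_axioms eps tau t nu).

Definition pbwB (b : B) (f : pbw_mod) : pbw_mod := pbw_act tau t nu (of_quot b) f.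

Lemma pbwB_to_B a f : pbwB (to_B eps tau a) f = pbw_act tau t nu a f.
Proof.
apply/eqP; rewrite -subr_eq0 -(actNl ax) -(actDl ax); apply/eqP.
by apply: pbw_act_ideal; apply/to_quot_eq; rewrite of_quotK.
Qed.

Lemma pbwB1 f : pbwB 1 f = f.
Proof. by rewrite -(rmorph1 (to_B eps tau)) pbwB_to_B; apply: (act1l ax). Qed.

Lemma pbwBM a b f : pbwB (a * b) f = pbwB b (pbwB a f).
Proof.
by rewrite -[a]of_quotK -[b]of_quotK -rmorphM !pbwB_to_B; apply: (actM ax).
Qed.

Lemma pbwB_lin c a b f k l : pbwB (Bs c * a + b) f k l = c * pbwB a f k l + pbwB b f k l.
Proof.
rewrite -[a]of_quotK -[b]of_quotK -to_BZ -rmorphD !pbwB_to_B.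
by rewrite /pbw_act (actDl ax) (actZl ax).
Qed.

Lemma pbwB0 f k l : pbwB 0 f k l = 0.
Proof.
have := pbwB_lin 1 0 0 f k l; rewrite mulr0 add0r mul1r => /eqP.
by rewrite -subr_eq subrr eq_sym => /eqP.
Qed.

Lemma pbwBD a b f k l : pbwB (a + b) f k l = pbwB a f k l + pbwB b f k l.
Proof. by rewrite -[a]mul1r -(rmorph1 Bs) pbwB_lin rmorph1 !mul1r. Qed.

Lemma pbwBN a f k l : pbwB (- a) f k l = - pbwB a f k l.
Proof. by apply/eqP; rewrite -subr_eq0 opprK -pbwBD addNr pbwB0. Qed.

Lemma pbwBs c a f k l : pbwB (Bs c * a) f k l = c * pbwB a f k l.
Proof. by rewrite -[X in pbwB X]addr0 pbwB_lin pbwB0 addr0. Qed.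

Lemma pbwB_sum (I : Type) (r : seq I) (P : pred I) (h : I -> B) f k l :
  pbwB (\sum_(i <- r | P i) h i) f k l = \sum_(i <- r | P i) pbwB (h i) f k l.
Proof. by elim/big_rec2: _ => [|i u v _ <-]; rewrite ?pbwB0 ?pbwBD. Qed.

Lemma pbwB_first f : pbwB (Bz t) f = pbw_first eps tau t nu f.
Proof. by rewrite Bz.unlock pbwB_to_B /pbw_act (act_letter ax) /pbw_z eqxx. Qed.

Lemma pbwB_second f : pbwB (Bz (~~ t)) f = pbw_second f.
Proof. by rewrite Bz.unlock pbwB_to_B /pbw_act (act_letter ax) /pbw_z; case: t. Qed.

Lemma pbwB_g g f k l : pbwB (Bg g) f k l = mon_weight eps t nu k l g * f k l.
Proof. by rewrite Bg.unlock pbwB_to_B /pbw_act (act_g ax). Qed.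

(* The coefficient of [p^k q^l] in [e_nu b], for [p], [q] the letters [t] and [~~ t]. *)
Definition bcoef (b : B) : pbw_mod := pbwB b (@pbw_one F).

Lemma bcoef0 k l : bcoef 0 k l = 0. Proof. exact: pbwB0. Qed.
Lemma bcoefD a b k l : bcoef (a + b) k l = bcoef a k l + bcoef b k l.
Proof. exact: pbwBD. Qed.
Lemma bcoefN a k l : bcoef (- a) k l = - bcoef a k l.
Proof. exact: pbwBN. Qed.
Lemma bcoefZ c a k l : bcoef (Bs c * a) k l = c * bcoef a k l.
Proof. exact: pbwBs. Qed.
Lemma bcoef_sum (I : Type) (r : seq I) (P : pred I) (h : I -> B) k l :
  bcoef (\sum_(i <- r | P i) h i) k l = \sum_(i <- r | P i) bcoef (h i) k l.
Proof. exact: pbwB_sum. Qed.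

Lemma bcoef_mul_second b k l :
  bcoef (b * Bz (~~ t)) k l = if l is l'.+1 then bcoef b k l' else 0.
Proof. by rewrite /bcoef pbwBM pbwB_second. Qed.

Lemma bcoef_Bg_mul g b k l : bcoef (Bg g * b) k l = eps g ^+ nu * bcoef b k l.
Proof.
rewrite /bcoef pbwBM; have -> : pbwB (Bg g) (@pbw_one F) = pbwB (Bs (eps g ^+ nu)) (@pbw_one F).
  apply: pbwP => k' l'; rewrite pbwB_g -[Bs _]mulr1 pbwBs pbwB1 /pbw_one.
  case: k' => [|k']; case: l' => [|l']; rewrite ?mulr0 //.
  by rewrite /mon_weight !expr0 invr1 !mulr1.
by rewrite -pbwBM pbwBs.
Qed.

Lemma bcoef_Be_mul mu b k l : (mu < m)%N -> (nu < m)%N ->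
  bcoef (Be mu * b) k l = (mu == nu)%:R * bcoef b k l.
Proof.
move=> lmu lnu; rewrite BeE -mulrA bcoefZ mulr_suml bcoef_sum.
under eq_bigr do rewrite -mulrA bcoefZ bcoef_Bg_mul mulrA.
rewrite -mulr_suml mulrA; congr (_ * _).
have [->|ne] := eqVneq mu nu.
  under eq_bigr do rewrite mulVf ?expf_neq0 ?eps_neq0 //.
  by rewrite sumr_const mulVf ?(card_neq0 F).
rewrite (@sum_character F gT (fun g => (eps g ^+ mu)^-1 * eps g ^+ nu)) ?mulr0 //.
  by move=> g h; rewrite epsM !exprMn invfM mulrACA.
have /existsNP[h /eqP nh] : ~ forall g, eps g ^+ mu = eps g ^+ nu.
  by move=> E; move/eqP: ne; apply; apply: eps_expr_inj E.
exists h; apply: contra nh => /eqP E.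
by rewrite -[X in _ == X](mulVKf (expf_neq0 mu (eps_neq0 eps h))) E mulr1.
Qed.

End OneWeight.

(** The right module does not show left multiplication directly. But [e_nu p = p e_nu'], so shifting
    [k] intertwines the module of weight [nu'] with that of weight [nu], and [p] sends [pbw_one] to
    its shift. *)
Lemma bcoef_first_mul nu nu' b k l :
  (forall g, eps g ^+ nu' = eps g ^+ nu * letter_weight eps t g) ->
  bcoef nu (Bz t * b) k l = if k is k'.+1 then bcoef nu' b k' l else 0.
Proof.
move=> E; pose sh (f : pbw_mod) : pbw_mod := fun k l => if k is k'.+1 then f k' l else 0.
have wE k' l' g : mon_weight eps t nu k'.+1 l' g = mon_weight eps t nu' k' l' g.
  by rewrite /mon_weight E exprS; ring.
have sE k' l' : swap_coef eps tau t nu k'.+1 l' = swap_coef eps tau t nu' k' l'.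
  by apply: eq_bigr => s _; rewrite /mon_tau; congr (_ * _);
    apply: eq_bigr => g _; rewrite wE.
have shE : forall f, pbwB nu b (sh f) = sh (pbwB nu' b f).
  elim/Btau_ind: b => [|c a b IHa IHb|a z IH|a g IH] f; apply: pbwP => k' l'.
  - by rewrite !pbwB1.
  - rewrite pbwB_lin IHa IHb /sh; case: k' => [|k']; rewrite ?pbwB_lin //.
    by rewrite mulr0 addr0.
  - rewrite !pbwBM IH; have [->|zt] := eqVneq z t.
      rewrite !pbwB_first /pbw_first /sh; case: k' => [|k']; first by rewrite mulr0 addr0.
      by rewrite sE; case: k'.
    have -> : z = ~~ t by move: zt; case: z; case: t.
    by rewrite !pbwB_second /pbw_second /sh; case: k'; case: l'.
  - rewrite !pbwBM IH /sh; case: k' => [|k']; rewrite pbwB_g ?mulr0 //.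
    by rewrite pbwB_g wE.
rewrite /bcoef pbwBM pbwB_first.
have -> : pbw_first eps tau t nu (@pbw_one F) = sh (@pbw_one F).
  apply: pbwP => k' l'; rewrite /pbw_first /pbw_one /sh andbF mulr0 addr0.
  by case: k'.
by rewrite shE.
Qed.

End Coefficients.

Section MonomialBasis.
Variables (F : numClosedFieldType) (gT : finGroupType) (eps : primitive_char F gT).
Variables (tau : {ffun gT -> F}).
Notation B := (Btau eps tau).
Notation m := #|gT|.
Notation Bs := (Bs eps tau).
Notation Bz := (Bz eps tau).
Notation Bg := (Bg eps tau).
Notation Be := (Be eps tau).

(** Adding [m.-1] replaces subtracting one: weights are natural numbers of which only the class
    modulo [m] matters. *)
Definition next_weight (z : bool) (nu : nat) : nat := if z then nu.+1 else (nu + m.-1)%N.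

Lemma next_weightE z nu g :
  eps g ^+ next_weight z nu = eps g ^+ nu * letter_weight eps z g.
Proof.
case: z; rewrite /next_weight /letter_weight ?exprSr // exprD; congr (_ * _).
apply: (mulfI (eps_neq0 eps g)); rewrite -exprS prednK ?(card_gt0G gT) //.
by rewrite eps_expm mulfV ?eps_neq0.
Qed.

Lemma next_weightK z nu g :
  eps g ^+ nu = eps g ^+ next_weight (~~ z) nu * letter_weight eps z g.
Proof.
rewrite next_weightE -mulrA; case: z; rewrite /letter_weight ?mulVf ?mulfV ?mulr1 //;
  exact: eps_neq0.
Qed.

Lemma Bzg z g : Bz z * Bg g = Bs (letter_weight eps z g) * (Bg g * Bz z).
Proof.
rewrite Bgz mulrA -(rmorphM Bs).
have -> : letter_weight eps z g * (if z then (eps g)^-1 else eps g) = 1.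
  by rewrite /letter_weight; case: z; rewrite ?mulVf ?mulfV ?eps_neq0.
by rewrite rmorph1 mul1r.
Qed.

Lemma Be_Bz z mu : Be mu * Bz z = Bz z * Be (next_weight z mu).
Proof.
rewrite !BeE [RHS]mulrA Bs_comm -!mulrA; congr (_ * _); rewrite mulr_suml mulr_sumr.
apply: eq_bigr => g _; rewrite [RHS]mulrA Bs_comm. rewrite -[RHS]mulrA Bzg. rewrite -[LHS]mulrA.
rewrite [RHS]mulrA -(rmorphM Bs); congr (Bs _ * _).
by rewrite next_weightE invfM -mulrA mulVf ?mulr1 ?letter_weight_neq0.
Qed.

Variable t : bool.

Definition monom mu k l : B := Be mu * Bz t ^+ k * Bz (~~ t) ^+ l.

Inductive monom_span : B -> Prop :=
| Monom0 : monom_span 0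
| MonomD c mu k l b : (mu < m)%N -> monom_span b ->
    monom_span (Bs c * monom mu k l + b).

Lemma monom_spanD a b : monom_span a -> monom_span b -> monom_span (a + b).
Proof.
elim=> [|c mu k l a' lt_mu _ IH] Hb; first by rewrite add0r.
by rewrite -addrA; apply: MonomD => //; exact: IH.
Qed.

Lemma monom_spanZ c a : monom_span a -> monom_span (Bs c * a).
Proof.
elim=> [|c' mu k l a' lt_mu _ IH]; first by rewrite mulr0; exact: Monom0.
by rewrite mulrDr mulrA -(rmorphM Bs); exact: MonomD.
Qed.

Lemma monom_span_monom mu k l : (mu < m)%N -> monom_span (monom mu k l).
Proof.
move=> lt_mu; rewrite -[monom _ _ _]addr0 -[monom _ _ _]mul1r -(rmorph1 Bs).
by apply: MonomD => //; exact: Monom0.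
Qed.

Lemma Bz_exp_g z k g : Bz z ^+ k * Bg g = Bs (letter_weight eps z g ^+ k) * (Bg g * Bz z ^+ k).
Proof.
elim: k => [|k IH]; first by rewrite !expr0 mul1r mulr1 rmorph1 mul1r.
rewrite [in LHS]exprS -mulrA IH mulrA Bs_comm -mulrA [Bz z * _]mulrA Bzg.
by rewrite !mulrA -(rmorphM Bs) -exprSr -!mulrA -exprS.
Qed.

Lemma monom_g mu k l g : exists c, monom mu k l * Bg g = Bs c * monom mu k l.
Proof.
exists (letter_weight eps (~~ t) g ^+ l * (letter_weight eps t g ^+ k * eps g ^+ mu)).
rewrite /monom -mulrA Bz_exp_g mulrA Bs_comm -mulrA [_ * (Bg g * _)]mulrA -[_ * Bg g]mulrA.
rewrite Bz_exp_g [Be mu * _]mulrA Bs_comm -[Bs _ * Be mu * _]mulrA [Be mu * (Bg g * _)]mulrA Be_Bg.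
by rewrite !rmorphM !mulrA.
Qed.

Lemma monom_span_mulg a g : monom_span a -> monom_span (a * Bg g).
Proof.
elim=> [|c mu k l a' lt_mu _ IH]; first by rewrite mul0r; exact: Monom0.
rewrite mulrDl -mulrA; apply: monom_spanD => //; apply: monom_spanZ.
have [c' ->] := monom_g mu k l g.
by apply: monom_spanZ; exact: monom_span_monom.
Qed.

Lemma monom_span_mul_second a : monom_span a -> monom_span (a * Bz (~~ t)).
Proof.
elim=> [|c mu k l a' lt_mu _ IH]; first by rewrite mul0r; exact: Monom0.
rewrite mulrDl -mulrA; apply: monom_spanD => //; apply: monom_spanZ.
by rewrite /monom -mulrA -exprSr; exact: monom_span_monom.
Qed.

Lemma Btau_swap : exists s : F, 
  Bz (~~ t) * Bz t = Bz t * Bz (~~ t) + Bs s * to_B eps tau (cr_tau eps tau).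
Proof.
exists (if t then 1 else -1); rewrite -Btau_rel; case: t => /=.
  by rewrite rmorph1 mul1r addrC subrK.
by rewrite rmorphN rmorph1 mulN1r opprB addrC subrK.
Qed.

(** Moving [p] to the left past one [q] costs a multiple of [tau], and group elements only rescale
    monomials; hence induction on the exponent of [q]. *)
Lemma monom_span_mul_first a : monom_span a -> monom_span (a * Bz t).
Proof.
elim=> [|c mu k l a' lt_mu _ IH]; first by rewrite mul0r; exact: Monom0.
rewrite mulrDl -mulrA; apply: monom_spanD => //; apply: monom_spanZ.
elim: l => [|l IHl].
  rewrite /monom expr0 mulr1 -mulrA -exprSr -[X in monom_span X]mulr1.
  exact: (monom_span_monom k.+1 0).
have [s Es] := Btau_swap.
have -> : monom mu k l.+1 * Bz t = monom mu k l * Bz t * Bz (~~ t) +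
    monom mu k l * (Bs s * to_B eps tau (cr_tau eps tau)).
  by rewrite {1}/monom exprSr !mulrA -/(monom mu k l) -mulrA Es mulrDr !mulrA.
apply: monom_spanD; first exact: monom_span_mul_second.
rewrite mulrA Bs_comm -mulrA; apply: monom_spanZ.
rewrite BtauE mulr_sumr; elim/big_ind: _ => [|u v Hu Hv|g _].
- exact: Monom0.
- exact: monom_spanD.
rewrite mulrA Bs_comm -mulrA; apply: monom_spanZ.
by apply: monom_span_mulg; exact: monom_span_monom.
Qed.

Lemma monom_span_all b : monom_span b.
Proof.
elim/Btau_ind: b => [|c a b IHa IHb|a z IH|a g IH].
- have -> : 1 = \sum_(mu < m) monom mu 0 0 :> B.
    rewrite -(rmorph1 (to_B eps tau)) -cr_idem_sum raddf_sum /monom Be.unlock.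
    by apply: eq_bigr => mu _; rewrite !expr0 !mulr1.
  elim/big_ind: _ => [|u v Hu Hv|mu _]; [exact: Monom0|exact: monom_spanD|].
  exact: monom_span_monom.
- by apply: monom_spanD => //; exact: monom_spanZ.
- have [->|zt] := eqVneq z t; first exact: monom_span_mul_first.
  have -> : z = ~~ t by move: zt; case: z; case: t.
  exact: monom_span_mul_second.
- exact: monom_span_mulg.
Qed.

Lemma bcoef_Bz_exp nu k l k' l' :
  bcoef t nu (Bz t ^+ k * Bz (~~ t) ^+ l) k' l' = ((k' == k) && (l' == l))%:R.
Proof.
elim: l l' => [|l IH] l'; last first.
  rewrite exprSr mulrA bcoef_mul_second; case: l' => [|l']; last by rewrite IH.
  by rewrite andbF.
rewrite expr0 mulr1; elim: k nu k' => [|k IH] nu k'; first by rewrite expr0 /bcoef pbwB1.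
rewrite exprS (bcoef_first_mul _ _ _ (next_weightE t nu)).
by case: k' => [|k'] //; rewrite IH.
Qed.

Lemma bcoef_monom nu mu k l k' l' : (mu < m)%N -> (nu < m)%N ->
  bcoef t nu (monom mu k l) k' l' = [&& mu == nu, k' == k & l' == l]%:R.
Proof.
move=> lmu lnu; rewrite /monom -mulrA bcoef_Be_mul // bcoef_Bz_exp.
by rewrite -natrM mulnb.
Qed.

Lemma bcoef_finite (b : B) : exists K, forall nu k l, (K <= k)%N -> bcoef t nu b k l = 0.
Proof.
elim: (monom_span_all b) => [|c mu k l a lt_mu _ [K HK]].
  by exists 0%N => nu k l _; exact: bcoef0.
exists (maxn K k.+1) => nu k' l'; rewrite geq_max => /andP[leK lek].
rewrite bcoefD bcoefZ HK // addr0 /monom BeE -!mulrA bcoefZ mulr_suml bcoef_sum.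
rewrite big1 ?mulr0 // => g _; rewrite -mulrA bcoefZ bcoef_Bg_mul bcoef_Bz_exp.
by rewrite gtn_eqF ?mulr0 //= !mulr0.
Qed.

(** The bound is a threshold, so that the expansions of two summands can be taken over a common
    square. *)
Lemma bcoef_reconstruct (b : B) : exists K, forall K', (K <= K')%N ->
  b = \sum_(mu < m) \sum_(k < K') \sum_(l < K') Bs (bcoef t mu b k l) * monom mu k l.
Proof.
elim: (monom_span_all b) => [|c mu k l a lt_mu _ [K HK]].
  exists 0%N => K' _; rewrite big1 // => mu _; rewrite big1 // => k _.
  by rewrite big1 // => l _; rewrite bcoef0 rmorph0 mul0r.
exists (maxn K (maxn k.+1 l.+1)) => K'; rewrite !geq_max => /and3P[leK lek lel].
rewrite {1}(HK K') //.
have E : Bs c * monom mu k l = \sum_(mu' < m) \sum_(k' < K') \sum_(l' < K')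
    Bs (c * bcoef t mu' (monom mu k l) k' l') * monom mu' k' l'.
  rewrite (bigD1 (Ordinal lt_mu)) //= (bigD1 (Ordinal lek)) //= (bigD1 (Ordinal lel)) //=.
  rewrite bcoef_monom // !eqxx mulr1 !big1 ?addr0 // => [mu'|k'|l']; rewrite -val_eqE /= => ne.
  - rewrite big1 // => k' _; rewrite big1 // => l' _.
    by rewrite bcoef_monom // eq_sym (negPf ne) mulr0 rmorph0 mul0r.
  - rewrite big1 // => l' _.
    by rewrite bcoef_monom // (negPf ne) andbF mulr0 rmorph0 mul0r.
  - by rewrite bcoef_monom // (negPf ne) !andbF mulr0 rmorph0 mul0r.
rewrite {1}E -big_split; apply: eq_bigr => mu' _; rewrite -big_split; apply: eq_bigr => k' _.
rewrite -big_split; apply: eq_bigr => l' _ /=.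
by rewrite bcoefD bcoefZ rmorphD mulrDl.
Qed.

Lemma bcoef_eq0 (b : B) : (forall nu k l, bcoef t nu b k l = 0) -> b = 0.
Proof.
move=> E; have [K /(_ K (leqnn K)) ->] := bcoef_reconstruct b.
rewrite big1 // => mu _; rewrite big1 // => k _; rewrite big1 // => l _.
by rewrite E rmorph0 mul0r.
Qed.

(** Comparing coefficients of [p^k] gives [b_(k-1) = c b_k] up to a shift of weight. For [c = 0]
    this is enough; otherwise [b_0 = 0] and the vanishing propagates upwards. *)
Lemma letter_sub_inj_l c b : (Bz t - Bs c) * b = 0 -> b = 0.
Proof.
move=> E; apply: bcoef_eq0.
have Ek nu nu' k l : (forall g, eps g ^+ nu' = eps g ^+ nu * letter_weight eps t g) ->
    (if k is k'.+1 then bcoef t nu' b k' l else 0) = c * bcoef t nu b k l.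
  move=> Enu; have := bcoef0 eps tau t nu k l; rewrite -E mulrBl bcoefD bcoefN bcoefZ.
  rewrite (bcoef_first_mul _ _ _ Enu) => /eqP.
  by rewrite subr_eq0 => /eqP.
have [c0|c_neq0] := eqVneq c 0 => nu k l.
  by have := Ek _ _ k.+1 l (next_weightK t nu); rewrite c0 mul0r.
elim: k nu => [|k IH] nu; apply: (mulfI c_neq0); rewrite mulr0.
  by rewrite -(Ek _ _ 0%N l (next_weightE t nu)).
by rewrite -(Ek _ _ k.+1 l (next_weightE t nu)) IH.
Qed.

Lemma letter_sub_inj_r c b : b * (Bz (~~ t) - Bs c) = 0 -> b = 0.
Proof.
move=> E; apply: bcoef_eq0 => nu k.
have El l : (if l is l'.+1 then bcoef t nu b k l' else 0) = c * bcoef t nu b k l.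
  have := bcoef0 eps tau t nu k l; rewrite -E mulrBr bcoefD bcoefN Bs_comm bcoefZ.
  by rewrite bcoef_mul_second => /eqP; rewrite subr_eq0 => /eqP.
have [c0|c_neq0] := eqVneq c 0 => l; first by have := El l.+1; rewrite c0 mul0r.
elim: l => [|l IH]; apply: (mulfI c_neq0); rewrite mulr0 -El //.
Qed.

End MonomialBasis.

(** * Reduction modulo a pencil *)

Section Reduction.
Variables (F : numClosedFieldType) (gT : finGroupType) (eps : primitive_char F gT).
Variables (tau : {ffun gT -> F}).
Notation B := (Btau eps tau).
Notation m := #|gT|.
Notation Bs := (Bs eps tau).
Notation Bz := (Bz eps tau).
Notation Bg := (Bg eps tau).
Notation Be := (Be eps tau).

(** Each side uses the PBW order in which the letter stands on that side. This is the source of all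
    invertible elements of [Q] that are needed. *)
Lemma letter_sub_regular z c : regular_elt (Bz z - Bs c).
Proof.
split=> u v /= /eqP; rewrite -subr_eq0 => /eqP E; apply/eqP; rewrite -subr_eq0; apply/eqP.
  by apply: (@letter_sub_inj_l _ _ eps tau z c); rewrite mulrBr.
apply: (@letter_sub_inj_r _ _ eps tau (~~ z) c); rewrite negbK.
by rewrite mulrBl.
Qed.

Variable t : bool.

(** The subring generated by the scalars, one letter and the group: it contains the remainders of
    division by a pencil in the other letter. *)
Inductive subring_of : B -> Prop :=
| SubS c : subring_of (Bs c)
| SubZ : subring_of (Bz t)
| SubG g : subring_of (Bg g)
| SubD a b : subring_of a -> subring_of b -> subring_of (a + b)
| SubM a b : subring_of a -> subring_of b -> subring_of (a * b).

Lemma subring_of0 : subring_of 0. Proof. by rewrite -(rmorph0 Bs); exact: SubS. Qed.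
Lemma subring_of1 : subring_of 1. Proof. by rewrite -(rmorph1 Bs); exact: SubS. Qed.
Lemma subring_ofN a : subring_of a -> subring_of (- a).
Proof. by rewrite -mulN1r -(rmorph1 Bs) -rmorphN => Ha; apply: SubM => //; exact: SubS. Qed.
Lemma subring_ofB a b : subring_of a -> subring_of b -> subring_of (a - b).
Proof. by move=> Ha Hb; apply: SubD => //; exact: subring_ofN. Qed.
Lemma subring_of_sum (I : Type) (r : seq I) (P : pred I) (f : I -> B) :
  (forall i, P i -> subring_of (f i)) -> subring_of (\sum_(i <- r | P i) f i).
Proof. by move=> H; elim/big_ind: _ => //; [exact: subring_of0|exact: SubD]. Qed.
Lemma subring_ofX a k : subring_of a -> subring_of (a ^+ k).
Proof.
by move=> Ha; elim: k => [|k IH]; rewrite ?exprS ?expr0; [exact: subring_of1|exact: SubM].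
Qed.
Lemma subring_of_Be k : subring_of (Be k).
Proof.
rewrite BeE; apply: SubM; first exact: SubS.
by apply: subring_of_sum => g _; apply: SubM; [exact: SubS|exact: SubG].
Qed.

End Reduction.

Section Reduced.
Variables (F : numClosedFieldType) (gT : finGroupType) (eps : primitive_char F gT).
Variables (tau : {ffun gT -> F}) (t : bool).
Notation B := (Btau eps tau).
Notation m := #|gT|.
Notation Bs := (Bs eps tau).
Notation Bz := (Bz eps tau).
Notation Bg := (Bg eps tau).
Notation Be := (Be eps tau).

(* No monomial of the normal form of [b] contains the letter [t]. *)
Definition reduced (b : B) : Prop := forall nu k l, bcoef t nu b k.+1 l = 0.

Lemma subring_reduced b : subring_of (~~ t) b -> reduced b.
Proof.
move=> Hb nu; rewrite /bcoef.
(* A product acts factor by factor, so the induction must allow every start vector supported on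
   [k = 0], not only [pbw_one]. *)
suff: forall f : nat -> nat -> F, (forall k l, f k.+1 l = 0) ->
    forall k l, pbwB t nu b f k.+1 l = 0 by apply=> k l; rewrite /pbw_one.
elim: Hb => [c||g|a a' _ IH _ IH'|a a' _ IH _ IH'] f Hf k l.
- by rewrite -[Bs c]mulr1 pbwBs pbwB1 Hf mulr0.
- by rewrite pbwB_second /pbw_second; case: l.
- by rewrite pbwB_g Hf mulr0.
- by rewrite pbwBD IH ?IH' ?addr0.
- by rewrite pbwBM; apply: IH' => k' l'; exact: IH.
Qed.

(** Uniqueness of division by [Y - p]. When [(Y - p) c] is free of [p], the coefficients of [p^k] in
    [c] are determined by those of [p^(k+1)], and these vanish for large [k]. *)
Lemma pencil_reduced_eq0 d (Y : 'M[F]_d) (c : 'cV[B]_d) :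
  (forall i, reduced ((map_mx Bs Y *m c - (Bz t)%:M *m c) i 0)) -> c = 0.
Proof.
move=> H; have Hfin : exists K, forall i nu k l, (K <= k)%N -> bcoef t nu (c i 0) k l = 0.
  have /choice[K HK] : forall i, exists K, forall nu k l, (K <= k)%N ->
    bcoef t nu (c i 0) k l = 0 by move=> i; exact: bcoef_finite.
  exists (\max_i K i)%N => i nu k l leK; apply: HK; apply: leq_trans leK.
  exact: leq_bigmax.
have [K HK] := Hfin.
have Hrec i nu k l : bcoef t (next_weight gT t nu) (c i 0) k l =
    \sum_j Y i j * bcoef t nu (c j 0) k.+1 l.
  have := H i nu k l; rewrite mul_scalar_mx !mxE bcoefD bcoefN bcoef_sum.
  rewrite (bcoef_first_mul _ _ _ (next_weightE eps t nu)) => /eqP.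
  rewrite subr_eq0 => /eqP <-; apply: eq_bigr => j _.
  by rewrite mxE bcoefZ.
have Hrec' i nu k l : (forall j nu', bcoef t nu' (c j 0) k.+1 l = 0) ->
    bcoef t nu (c i 0) k l = 0.
  move=> Hk; have := H i (next_weight gT (~~ t) nu) k l.
  rewrite mul_scalar_mx !mxE bcoefD bcoefN bcoef_sum.
  rewrite (bcoef_first_mul _ _ _ (next_weightK eps t nu)) big1 ?add0r => [|j _].
    by move/eqP; rewrite oppr_eq0 => /eqP.
  by rewrite mxE bcoefZ Hk mulr0.
apply/matrixP => i j; rewrite ord1 mxE; apply: bcoef_eq0 => nu k l.
have: forall n i nu k, (K <= k + n)%N -> bcoef t nu (c i 0) k l = 0.
  elim=> [|n IH] i' nu' k' le; first by apply: HK; rewrite -[k']addn0.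
  by apply: Hrec' => j' nu''; apply: IH; rewrite addSnnS.
by apply; exact: leq_addl.
Qed.

Lemma Be_Bz_exp mu k : exists mu', Be mu * Bz t ^+ k = Bz t ^+ k * Be mu'.
Proof.
elim: k mu => [|k IH] mu; first by exists mu; rewrite mul1r mulr1.
have [mu' E] := IH (next_weight gT t mu); exists mu'.
by rewrite exprS mulrA Be_Bz -mulrA E mulrA.
Qed.

(** Existence of division by [Y - p]: for a constant vector [v],
    [p^(k+1) v = - (Y - p) p^k v + p^k (Y v)] lowers the exponent of [p], which stands leftmost in
    the normal form. *)
Lemma pencil_decomp d (Y : 'M[F]_d) (u : 'cV[B]_d) : exists c r : 'cV[B]_d,
  u = (map_mx Bs Y *m c - (Bz t)%:M *m c) + r /\ forall i, subring_of (~~ t) (r i 0).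
Proof.
pose Z (u : 'cV[B]_d) := exists c r : 'cV[B]_d,
  u = (map_mx Bs Y *m c - (Bz t)%:M *m c) + r /\ forall i, subring_of (~~ t) (r i 0).
have ZD u1 u2 : Z u1 -> Z u2 -> Z (u1 + u2).
  move=> [c [r [-> Hr]]] [c' [r' [-> Hr']]]; exists (c + c'), (r + r'); split.
    by rewrite !mulmxDr opprD addrACA; congr (_ + _); rewrite addrACA.
  by move=> i; rewrite mxE; exact: SubD.
have Z0 (r : 'cV[B]_d) : (forall i, subring_of (~~ t) (r i 0)) -> Z r.
  by move=> Hr; exists 0, r; rewrite !mulmx0 subr0 add0r.
have Zmon k s (v : 'cV[F]_d) : subring_of (~~ t) s -> Z (map_mx Bs v *m (Bz t ^+ k * s)%:M).
  move=> Hs; elim: k v => [|k IH] v.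
    rewrite mul1r; apply: Z0 => i; rewrite !mxE big_ord1 !mxE eqxx.
    by apply: SubM => //; exact: SubS.
  have -> : map_mx Bs v *m (Bz t ^+ k.+1 * s)%:M =
      (map_mx Bs Y *m (- (map_mx Bs v *m (Bz t ^+ k * s)%:M)) -
       (Bz t)%:M *m (- (map_mx Bs v *m (Bz t ^+ k * s)%:M))) +
      map_mx Bs (Y *m v) *m (Bz t ^+ k * s)%:M.
    rewrite map_mxM -mulmxA mulmxN mulmxN opprK addrAC addNr add0r.
    apply/matrixP => i j; rewrite ord1 mul_scalar_mx !mxE !big_ord1 !mxE eqxx !mulr1n.
    by rewrite [RHS]mulrA Bs_comm exprS !mulrA.
  apply: ZD; last exact: IH.
  by eexists; exists 0; rewrite addr0; split=> // i; rewrite mxE; exact: subring_of0.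
have Zb b (v : 'cV[F]_d) : Z (map_mx Bs v *m b%:M).
  elim: (monom_span_all t b) => [|c mu k l a _ _ IH].
    by apply: Z0 => i; rewrite raddf0 mulmx0 mxE; exact: subring_of0.
  rewrite raddfD mulmxDr; apply: ZD => //.
  have [mu' E] := Be_Bz_exp mu k.
  have -> : Bs c * monom eps tau t mu k l = Bz t ^+ k * (Bs c * Be mu' * Bz (~~ t) ^+ l).
    by rewrite /monom E !mulrA Bs_comm.
  apply: Zmon; apply: SubM; last by apply: subring_ofX; exact: SubZ.
  by apply: SubM; [exact: SubS|exact: subring_of_Be].
have -> : u = \sum_i map_mx Bs (delta_mx i 0) *m (u i 0)%:M.
  apply/matrixP => i j; rewrite ord1 summxE (bigD1 i) //= big1 ?addr0 => [|k ki].
    by rewrite !mxE big_ord1 !mxE !eqxx rmorph1 mul1r.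
  by rewrite !mxE big_ord1 !mxE eq_sym (negPf ki) rmorph0 mul0r.
elim/big_ind: _ => // [|i _]; last exact: Zb.
by apply: Z0 => i; rewrite mxE; exact: subring_of0.
Qed.

End Reduced.

(** * The monad of a quadruple *)

Section PencilInverse.
Variables (F : numClosedFieldType) (gT : finGroupType) (eps : primitive_char F gT).
Variables (tau : {ffun gT -> F}) (Q : unitRingType).
Variables (iota : {rmorphism Btau eps tau -> Q}).
Notation B := (Btau eps tau).
Notation Bs := (Bs eps tau).
Notation Bz := (Bz eps tau).

Definition polyQ z (p : {poly F}) : Q := crQ iota (horner_alg (cr_letter eps z) p).

Lemma polyQ_zmod_morphism z : zmod_morphism (polyQ z).
Proof.
move=> p r; rewrite /polyQ /crQ (rmorphB (horner_alg (cr_letter eps z))).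
by rewrite (rmorphB (to_B eps tau)) (rmorphB iota).
Qed.
HB.instance Definition _ z :=
  GRing.isZmodMorphism.Build {poly F} Q (polyQ z) (polyQ_zmod_morphism z).

Lemma polyQ_monoid_morphism z : monoid_morphism (polyQ z).
Proof.
split=> [|p r]; rewrite /polyQ /crQ.
  by rewrite (rmorph1 (horner_alg _)) (rmorph1 (to_B eps tau)) (rmorph1 iota).
rewrite (rmorphM (horner_alg (cr_letter eps z))).
by rewrite (rmorphM (to_B eps tau)) (rmorphM iota).
Qed.
HB.instance Definition _ z :=
  GRing.isMonoidMorphism.Build {poly F} Q (polyQ z) (polyQ_monoid_morphism z).

Lemma polyQC z c : polyQ z c%:P = iota (Bs c).
Proof. by rewrite /polyQ horner_algC Bs.unlock. Qed.

Lemma polyQX z : polyQ z 'X = iota (Bz z).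
Proof. by rewrite /polyQ horner_algX Bz.unlock. Qed.

Hypothesis iota_quotient : classical_quotient_ring iota.

Lemma polyQ_unit z (p : {poly F}) : p != 0 -> polyQ z p \is a GRing.unit.
Proof.
case: iota_quotient => _ iota_unit _ _ pn0.
have [r ->] := closed_field_poly_normal p.
rewrite -mul_polyC (rmorphM (polyQ z)) /= rpredM //.
  rewrite polyQC; apply/unitrP; exists (iota (Bs (lead_coef p)^-1)).
  by rewrite -!(rmorphM iota) -!(rmorphM Bs) mulVf ?mulfV ?lead_coef_eq0 // !rmorph1.
elim: r => [|c r IH]; first by rewrite big_nil (rmorph1 (polyQ z)) unitr1.
rewrite big_cons (rmorphM (polyQ z)) /=; apply: rpredM; last exact: IH.
rewrite (rmorphB (polyQ z)) /= polyQC polyQX.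
by rewrite -(rmorphB iota); exact/iota_unit/letter_sub_regular.
Qed.

(** The entries come from the commutative ring [F[z]], so the adjugate formula holds there and
    [polyQ] carries it to [Q]. The determinant is a characteristic polynomial up to sign, and its
    linear factors [z - c] are regular in [B]. *)
Lemma pencil_inverse z d (A : 'M[F]_d) :
  polyQ z (\det (map_mx polyC A - 'X%:M)) \is a GRing.unit /\
  exists A' : 'M[Q]_d, mutually_inverse
    (map_mx iota (map_mx Bs A - (Bz z)%:M)) A'.
Proof.
pose P := map_mx polyC A - 'X%:M : 'M[{poly F}]_d.
have unit_det : (polyQ z) (\det P) \is a GRing.unit.
  apply: polyQ_unit; rewrite -(opprK P) -scaleN1r detZ mulf_eq0 negb_or.
  rewrite expf_neq0 ?oppr_eq0 ?oner_eq0 //= opprB.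
  exact/monic_neq0/char_poly_monic.
split=> //; have comm p : (polyQ z) p * ((polyQ z) (\det P))^-1 = ((polyQ z) (\det P))^-1 *
  (polyQ z) p.
  by apply: commrV; rewrite /GRing.comm -[LHS](rmorphM (polyQ z)) mulrC -[RHS](rmorphM (polyQ z)).
exists (map_mx (polyQ z) (\adj P) *m ((polyQ z) (\det P))^-1%:M).
have -> : map_mx iota (map_mx Bs A - (Bz z)%:M) = map_mx (polyQ z) P.
  apply/matrixP => i j; rewrite /P !mxE (rmorphB (polyQ z)) (rmorphMn (polyQ z)) /= polyQC polyQX.
  by rewrite (rmorphB iota) (rmorphMn iota).
have adjC : map_mx (polyQ z) (\adj P) *m ((polyQ z) (\det P))^-1%:M =
    ((polyQ z) (\det P))^-1%:M *m map_mx (polyQ z) (\adj P).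
  apply/matrixP => i j; rewrite mul_scalar_mx mxE (bigD1 j) //= big1 ?addr0 => [|k kj].
    by rewrite !mxE eqxx mulr1n comm.
  by rewrite !mxE (negPf kj) mulr0.
split; last rewrite adjC.
  by rewrite mulmxA -map_mxM mul_mx_adj map_scalar_mx /= -scalar_mxM mulrV.
by rewrite -mulmxA -map_mxM mul_adj_mx map_scalar_mx /= -scalar_mxM mulVr.
Qed.

End PencilInverse.

(* Locked for the same reason as the generators. *)
HB.lock Definition BX (F : numClosedFieldType) (gT : finGroupType) (eps : primitive_char F gT)
    (tau : {ffun gT -> F}) (n d : nat) (q : quadruple eps tau n d) : 'M[Btau eps tau]_d :=
  map_mx (Bs eps tau) (Xbar q) - (Bz eps tau false)%:M.
HB.lock Definition BY (F : numClosedFieldType) (gT : finGroupType) (eps : primitive_char F gT)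
    (tau : {ffun gT -> F}) (n d : nat) (q : quadruple eps tau n d) : 'M[Btau eps tau]_d :=
  map_mx (Bs eps tau) (Ybar q) - (Bz eps tau true)%:M.
HB.lock Definition Bi (F : numClosedFieldType) (gT : finGroupType) (eps : primitive_char F gT)
    (tau : {ffun gT -> F}) (n d : nat) (q : quadruple eps tau n d) : 'cV[Btau eps tau]_d :=
  map_mx (Bs eps tau) (ibar q).
HB.lock Definition Bj (F : numClosedFieldType) (gT : finGroupType) (eps : primitive_char F gT)
    (tau : {ffun gT -> F}) (n d : nat) (q : quadruple eps tau n d) : 'rV[Btau eps tau]_d :=
  map_mx (Bs eps tau) (jbar q).
(* The action of [g] on [U (x) B] twisted by left multiplication by its inverse. *)
HB.lock Definition BU (F : numClosedFieldType) (gT : finGroupType) (eps : primitive_char F gT)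
    (tau : {ffun gT -> F}) (n d : nat) (q : quadruple eps tau n d) (g : gT) :
    'M[Btau eps tau]_d :=
  map_mx (Bs eps tau) (Gbar q g) *m (Bg eps tau g^-1%g)%:M.
(* The projection of [U (x) B] onto the vectors on which [g] acts on the left as
   [eps g ^+ c] times [g] on [U]; for [c = 0] its image is the tensor product of [U]
   and [B] over [Gamma]. *)
HB.lock Definition BE (F : numClosedFieldType) (gT : finGroupType) (eps : primitive_char F gT)
    (tau : {ffun gT -> F}) (n d : nat) (q : quadruple eps tau n d) (c : nat) :
    'M[Btau eps tau]_d :=
  \sum_g (Bs eps tau (#|gT|%:R^-1 * eps g ^+ c))%:M *m BU q g.

Lemma eq_sub (V : zmodType) (u u' v v' : V) : u = u' -> v = v' -> u - v = u' - v'.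
Proof. by move=> -> ->. Qed.

Lemma pencil_commutator (S : pzRingType) d (A C : 'M[S]_d) (x y : S) :
  A *m y%:M = y%:M *m A -> C *m x%:M = x%:M *m C ->
  (A - x%:M) *m (C - y%:M) - (C - y%:M) *m (A - x%:M) =
  (A *m C - C *m A) + (x * y - y * x)%:M.
Proof.
move=> Ay Cx; rewrite !mulmxBl !mulmxBr Ay Cx -!scalar_mxM (raddfB (@scalar_mx _ d)) /=.
move: (_ *m C) (_ *m A) (_%:M *m C) (_%:M *m A) (x * y)%:M (y * x)%:M => a b c e p r.
by rewrite !opprB !addrA [LHS](ACl (1*8*3*6*(2*5)*(4*7)))%AC /= !addNr !addr0.
Qed.

Section Monad.
Variables (F : numClosedFieldType) (gT : finGroupType) (eps : primitive_char F gT).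
Variables (tau : {ffun gT -> F}) (n d : nat) (q : quadruple eps tau n d).
Notation B := (Btau eps tau).
Notation m := #|gT|.
Notation Bs := (Bs eps tau).
Notation Bz := (Bz eps tau).
Notation Bg := (Bg eps tau).
Notation Be := (Be eps tau).
Notation G := (Gbar q).
Notation pX := (BX q).
Notation pY := (BY q).
Notation vi := (Bi q).
Notation vj := (Bj q).
Notation U := (BU q).
Notation E := (BE q).

Lemma map_Bs_comm k l (A : 'M[F]_(k, l)) b :
  map_mx Bs A *m b%:M = b%:M *m map_mx Bs A.
Proof.
apply/matrixP => i j; rewrite mul_scalar_mx mxE (bigD1 j) //= big1 ?addr0 => [|k' kj].
  by rewrite !mxE eqxx mulr1n Bs_comm.
by rewrite !mxE (negPf kj) mulr0.
Qed.

Lemma Bs_mx_comm k l (A : 'M[B]_(k, l)) c : A *m (Bs c)%:M = (Bs c)%:M *m A.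
Proof.
apply/matrixP => i j; rewrite mul_scalar_mx mxE (bigD1 j) //= big1 ?addr0 => [|k' kj].
  by rewrite !mxE eqxx mulr1n Bs_comm.
by rewrite !mxE (negPf kj) mulr0.
Qed.

Lemma map_BsZ k l c (A : 'M[F]_(k, l)) : map_mx Bs (c *: A) = (Bs c)%:M *m map_mx Bs A.
Proof. by rewrite -mul_scalar_mx map_mxM map_scalar_mx. Qed.

Lemma eps_inv g : eps g^-1%g = (eps g)^-1.
Proof.
by apply: (mulfI (eps_neq0 eps g)); rewrite -epsM mulgV eps1 mulfV ?eps_neq0.
Qed.

Lemma pencil_twist (A : 'M[F]_d) z c g : A *m G g = c *: (G g *m A) ->
  letter_weight eps z g^-1%g = c ->
  (map_mx Bs A - (Bz z)%:M) *m U g = (Bs c)%:M *m (U g *m (map_mx Bs A - (Bz z)%:M)).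
Proof.
move=> EA Ez; rewrite BU.unlock.
move: (map_mxM Bs A (G g)) (map_mxM Bs (G g) A); rewrite EA map_BsZ.
move: (map_Bs_comm (G g) (Bz z)) (map_Bs_comm A (Bg g^-1%g)) (Bzg eps tau z g^-1%g).
rewrite Ez; move: (map_mx Bs A) (map_mx Bs (G g)) (Bs_mx_comm (map_mx Bs (G g)) c).
move: (Bs c) (Bz z) (Bg g^-1%g) => s x b A' G' sG Gx Ab xb /[swap] -> AG.
rewrite [LHS]mulmxBl [X in _ = _ *m X]mulmxBr [RHS]mulmxBr; apply: eq_sub.
  by rewrite [LHS]mulmxA -AG -!mulmxA -Ab.
by rewrite [LHS]mulmxA -Gx -[LHS]mulmxA -!scalar_mxM xb scalar_mxM mulmxA sG -!mulmxA -scalar_mxM.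
Qed.

Lemma BX_BU g : pX *m U g = (Bs (eps g))%:M *m (U g *m pX).
Proof.
rewrite BX.unlock; apply: pencil_twist; first exact: Xbar_equiv.
by rewrite /letter_weight eps_inv invrK.
Qed.

Lemma BY_BU g : pY *m U g = (Bs (eps g)^-1)%:M *m (U g *m pY).
Proof.
rewrite BY.unlock; apply: pencil_twist; first exact: Ybar_equiv.
by rewrite /letter_weight eps_inv.
Qed.

Lemma BU_Bi g : U g *m vi = vi *m (Bs (eps g ^+ n) * Bg g^-1%g)%:M.
Proof.
rewrite BU.unlock Bi.unlock -mulmxA -map_Bs_comm mulmxA -map_mxM ibar_equiv map_BsZ.
by rewrite -Bs_mx_comm -mulmxA -scalar_mxM.
Qed.

Lemma Bj_BU g : vj *m U g = (Bs (eps g ^+ n) * Bg g^-1%g)%:M *m vj.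
Proof.
rewrite BU.unlock Bj.unlock mulmxA -map_mxM jbar_equiv map_BsZ -mulmxA map_Bs_comm.
by rewrite mulmxA -scalar_mxM.
Qed.

Lemma BU_mul g h : U g *m U h = U (g * h)%g.
Proof.
rewrite BU.unlock GM map_mxM -[X in _ = _ *m (Bg X)%:M](_ : (g^-1 * h^-1)%g = _); last first.
  by rewrite invMg (gT_comm eps).
rewrite BgM scalar_mxM -[LHS]mulmxA [X in _ *m X = _]mulmxA -map_Bs_comm.
by rewrite -[X in _ *m X = _]mulmxA [LHS]mulmxA.
Qed.

Lemma BU_Bg g h : U g *m (Bg h)%:M = (Bg h)%:M *m U g.
Proof.
by rewrite BU.unlock [RHS]mulmxA -[X in _ = X *m _]map_Bs_comm -[RHS]mulmxA -[LHS]mulmxA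
  -!scalar_mxM Bg_comm.
Qed.

Lemma map_G k g (u : 'M[F]_(d, k)) :
  map_mx Bs (G g *m u) = U g *m map_mx Bs u *m (Bg g)%:M.
Proof.
rewrite BU.unlock map_mxM -!mulmxA [map_mx Bs u *m _]map_Bs_comm.
by rewrite [X in _ = _ *m X]mulmxA -scalar_mxM -BgM mulVg Bg1 mul1mx.
Qed.

Lemma map_Gr k g (u : 'M[F]_(k, d)) :
  map_mx Bs (u *m G g) = (Bg g)%:M *m (map_mx Bs u *m U g).
Proof.
rewrite BU.unlock map_mxM map_Bs_comm [X in _ = _ *m X]mulmxA map_Bs_comm !mulmxA.
by rewrite -scalar_mxM -BgM mulgV Bg1 mul1mx.
Qed.

Lemma BEm : E m = E 0.
Proof. by rewrite BE.unlock; apply: eq_bigr => g _; rewrite eps_expm expr0. Qed.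

Lemma BX_BE c : pX *m E c = E c.+1 *m pX.
Proof.
rewrite BE.unlock mulmx_sumr mulmx_suml; apply: eq_bigr => g _.
by rewrite mulmxA Bs_mx_comm -mulmxA BX_BU mulmxA -scalar_mxM -rmorphM exprSr mulrA mulmxA.
Qed.

Lemma BY_BE c : pY *m E c.+1 = E c *m pY.
Proof.
rewrite BE.unlock mulmx_sumr mulmx_suml; apply: eq_bigr => g _.
rewrite mulmxA Bs_mx_comm -mulmxA BY_BU mulmxA -scalar_mxM -rmorphM exprSr mulrA.
by rewrite mulfK ?eps_neq0 // mulmxA.
Qed.

Lemma BU_BE c h : U h *m E c = (Bs (eps h ^- c))%:M *m E c.
Proof.
rewrite BE.unlock mulmx_sumr mulmx_sumr [RHS](reindex_inj (mulgI h)) /=.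
apply: eq_bigr => g _; rewrite mulmxA Bs_mx_comm -mulmxA BU_mul [RHS]mulmxA.
rewrite -scalar_mxM -rmorphM; congr ((Bs _)%:M *m _).
by rewrite epsM exprMn mulrCA mulKf ?expf_neq0 ?eps_neq0.
Qed.

Lemma BE_BU c h : E c *m U h = (Bs (eps h ^- c))%:M *m E c.
Proof.
rewrite -BU_BE BE.unlock mulmx_sumr mulmx_suml; apply: eq_bigr => g _.
by rewrite mulmxA Bs_mx_comm -!mulmxA !BU_mul (gT_comm eps).
Qed.

Lemma BE_idem c : E c *m E c = E c.
Proof.
rewrite {1}BE.unlock mulmx_suml.
rewrite (eq_bigr (fun=> (Bs m%:R^-1)%:M *m E c)) => [|g _].
  rewrite -mulmx_suml -(raddf_sum (@scalar_mx _ d)) -(raddf_sum Bs) sumr_const.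
  by rewrite -[_ *+ _]mulr_natr mulVf ?card_neq0 //= (rmorph1 Bs) mul1mx.
rewrite -[LHS]mulmxA BU_BE [LHS]mulmxA -scalar_mxM -(rmorphM Bs).
by rewrite -mulrA mulfV ?mulr1 // expf_neq0 ?eps_neq0.
Qed.

Lemma BE_Bi : E 0 *m vi = vi *m (Be n)%:M.
Proof.
rewrite BeE BE.unlock mulmx_suml mulr_sumr (raddf_sum (@scalar_mx _ 1)) mulmx_sumr.
rewrite [RHS](reindex_inj invg_inj) /=; apply: eq_bigr => g _.
rewrite -mulmxA BU_Bi mulmxA -Bs_mx_comm -mulmxA -scalar_mxM !mulrA -!(rmorphM Bs).
by rewrite expr0 mulr1 eps_inv exprVn invrK.
Qed.

Lemma Bj_BE : vj *m E 0 = (Be n)%:M *m vj.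
Proof.
rewrite BeE BE.unlock mulmx_sumr mulr_sumr (raddf_sum (@scalar_mx _ 1)) mulmx_suml.
rewrite [RHS](reindex_inj invg_inj) /=; apply: eq_bigr => g _.
rewrite mulmxA Bs_mx_comm -mulmxA Bj_BU mulmxA -scalar_mxM !mulrA -!(rmorphM Bs).
by rewrite expr0 mulr1 eps_inv exprVn invrK.
Qed.

Lemma map_G_BE g : map_mx Bs (G g) *m E 0 = (Bg g)%:M *m E 0.
Proof.
rewrite -[G g]mulmx1 map_G map_mx1 mulmx1 BU_Bg -mulmxA BU_BE expr0 invr1.
by rewrite rmorph1 mul1mx.
Qed.

(** By [[X, Y] - i j = - T] and [[x, y] = tau], the left factor is [tau] acting on [B] minus [tau]
    acting on [U]. On the image of [E 0] the action of [g] on [U] is left multiplication by [g], so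
    the two agree. *)
Lemma monad_comp : (pX *m pY - pY *m pX - vi *m vj) *m E 0 = 0.
Proof.
have -> : pX *m pY - pY *m pX - vi *m vj =
    (to_B eps tau (cr_tau eps tau))%:M - map_mx Bs (\sum_g tau g *: G g).
  have Hq : Xbar q *m Ybar q - Ybar q *m Xbar q - ibar q *m jbar q = - \sum_g tau g *: G g.
    by rewrite -quad_rel opprD addrA subrr add0r.
  rewrite BX.unlock BY.unlock pencil_commutator; try exact: map_Bs_comm.
  rewrite Bi.unlock Bj.unlock Btau_rel addrAC -!map_mxM -!(map_mxB Bs) Hq (map_mxN Bs).
  exact: addrC.
apply/eqP; rewrite mulmxBl subr_eq0 BtauE (raddf_sum (@scalar_mx _ d)).
rewrite (raddf_sum (map_mx Bs)) !mulmx_suml; apply/eqP/eq_bigr => g _ /=.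
by rewrite map_BsZ -[RHS]mulmxA map_G_BE mulmxA -scalar_mxM.
Qed.

End Monad.

(** * Finite-dimensional modules and genericity *)

Section Intervals.
Variable m : nat.

Definition interval_count (i k x : nat) : int := \sum_(s < k) (i + s == x %[mod m])%:R.

(* The sum of the simple roots [i], ..., [i + k - 1], with indices modulo [m]. *)
Definition interval_root (i k : nat) : {ffun 'I_m -> int} :=
  [ffun j : 'I_m => interval_count i k j].

Lemma interval_countS i k x :
  interval_count i k.+1 x = interval_count i k x + (i + k == x %[mod m])%:R.
Proof. by rewrite /interval_count big_ord_recr. Qed.

Lemma interval_countSl i k x :
  interval_count i k.+1 x = (i == x %[mod m])%:R + interval_count i.+1 k x.
Proof.
rewrite /interval_count big_ord_recl /= addn0; congr (_ + _).
by apply: eq_bigr => s _; rewrite /bump /= add1n addnS.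
Qed.

Lemma interval_count_shift i k x : interval_count i.+1 k x.+1 = interval_count i k x.
Proof. by apply: eq_bigr => s _; rewrite addSn -[(_ + _).+1]addn1 -[x.+1]addn1 eqn_modDr. Qed.

Lemma interval_count_mod i k x : interval_count i k (x %% m) = interval_count i k x.
Proof. by apply: eq_bigr => s _; rewrite modn_mod. Qed.

Lemma interval_countSS i k x : interval_count i.+1 k x =
  interval_count i k x + (i + k == x %[mod m])%:R - (i == x %[mod m])%:R.
Proof. by rewrite -interval_countS interval_countSl addrC addKr. Qed.

(** The index [r] follows the end of the interval. It also precedes its beginning exactly when the
    length is one short of a multiple of [m], which gives the extra [-1]; as [m] does not divide
    [k], it is not the beginning itself. *)
Lemma pairing_interval i k (r : 'I_m) : (1 < m)%N -> i + k = r %[mod m] ->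
  ~~ (m %| k)%N ->
  \sum_j cartan r j * interval_root i k j = - 1 - (m %| k.+1)%N%:R.
Proof.
move=> m_gt1 Er ndvd.
have -> : \sum_j cartan r j * interval_root i k j =
    interval_root i k r *+ 2 - interval_root i k (ordS r) - interval_root i k (ord_pred r).
  have pick (j0 : 'I_m) : \sum_j (j == j0)%:Z * interval_root i k j = interval_root i k j0.
    rewrite (bigD1 j0) //= eqxx mul1r big1 ?addr0 // => j /negPf->; exact: mul0r.
  rewrite -(pick (ordS r)) -(pick (ord_pred r)) -{1}(pick r) -sumrMnl -!sumrB.
  apply: eq_bigr => j _; rewrite /cartan [r == j]eq_sym !mulrBl; congr (_ - _ - _).
  by rewrite mulrnAl.
rewrite !ffunE /= !interval_count_mod.
have r_gt0 : (0 < r + m)%N by rewrite addn_gt0 (ltnW m_gt1) orbT.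
have E1 : interval_count i k (r + m).-1 = interval_count i k r + 1.
  rewrite -interval_count_shift prednK // interval_countSS.
  rewrite -(interval_count_mod _ _ (r + m)) modnDr interval_count_mod Er eqxx.
  have /negPf -> : (i != r %[mod m]).
    apply: contra ndvd => /eqP Ei; have := Er; rewrite -Ei -[X in _ = X %[mod m]]addn0.
    by move/eqP; rewrite eqn_modDl mod0n.
  by rewrite subr0.
have E2 : interval_count i k r.+1 = interval_count i k r + (m %| k.+1)%N%:R.
  rewrite -[in RHS]interval_count_shift interval_countSS.
  have /negPf -> : (i + k != r.+1 %[mod m]).
    rewrite Er -[X in X != _ %[mod m]]addn0 -addn1 eqn_modDl mod0n.
    by rewrite modn_small.
  have -> : (i == r.+1 %[mod m]) = (m %| k.+1)%N.
    rewrite -addn1 -[in RHS]addn1 -modnDml -Er modnDml -addnA -[X in X == _ %[mod m]]addn0.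
    by rewrite eqn_modDl mod0n eq_sym.
  by rewrite addr0 subrK.
by rewrite E1 E2; ring.
Qed.

Lemma reflect_interval i k (r : 'I_m) : (1 < m)%N -> i + k = r %[mod m] ->
  ~~ (m %| k)%N -> real_root (interval_root i k) ->
  real_root [ffun j : 'I_m => interval_count i k.+1 j + (j == r)%:R * (m %| k.+1)%N%:R].
Proof.
move=> m_gt1 Er ndvd Hr; have := RealReflection r Hr.
congr real_root; apply/ffunP => j; rewrite !ffunE pairing_interval //.
rewrite interval_countS; have -> : (i + k == j %[mod m]) = (j == r).
  by rewrite Er !modn_small ?ltn_ord // eq_sym.
by case: (j == r) => /=; ring.
Qed.

(** A reflection lengthens an interval at its end by one. This cannot start from an imaginary root;
    to reach length [k + 1] with [m] dividing [k], take the interval of length [k - 1] starting at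
    [i + 1]. Both its neighbours are the same simple root, and the reflection adds it twice. *)
Lemma interval_real i k : ~~ (m %| k)%N -> (0 < m)%N -> real_root (interval_root i k).
Proof.
move=> ndvd m_gt0; have m_gt1 : (1 < m)%N by case: m ndvd m_gt0 => [|[|]] //; rewrite dvd1n.
elim/ltn_ind: k i ndvd => [[|k] IH] i; first by rewrite dvdn0.
move=> ndvd; have ord x : exists r : 'I_m, x = r %[mod m].
  by exists (Ordinal (ltn_pmod x m_gt0)); rewrite /= modn_mod.
have [dvd_k|ndvd_k] := boolP (m %| k)%N; last first.
  have [r Er] := ord (i + k)%N.
  have := reflect_interval m_gt1 Er ndvd_k (IH k (ltnSn k) i ndvd_k).
  congr real_root; apply/ffunP => j; rewrite !ffunE (negPf ndvd) mulr0 addr0 //.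
case: k IH ndvd dvd_k => [|k] IH ndvd dvd_k.
  have [r Er] := ord i; have := RealSimple r; congr real_root.
  apply/ffunP => j; rewrite !ffunE /interval_count big_ord1 addn0 Er !modn_small //.
  by rewrite eq_sym natz.
have ndvd_k : ~~ (m %| k)%N.
  by apply/negP => dvd'; move: dvd_k; rewrite -addn1 dvdn_addr // dvdn1 gtn_eqF.
have [r Er] := ord (i.+1 + k)%N.
have := reflect_interval m_gt1 Er ndvd_k (IH k _ i.+1 ndvd_k).
have E : i = r %[mod m].
  by rewrite -Er addSnnS -modnDmr (eqP dvd_k) addn0.
rewrite dvd_k => /(_ (leqW (ltnSn k))); congr real_root; apply/ffunP => j.
rewrite !ffunE mulr1 [RHS]interval_countSl addrC; congr (_ + _).
by rewrite E !modn_small // eq_sym.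
Qed.

End Intervals.

(** * Values of [tau] on consecutive weights *)

Section GenericWeights.
Variables (F : numClosedFieldType) (gT : finGroupType) (eps : primitive_char F gT).
Variables (tau : {ffun gT -> F}).
Hypothesis tau_generic : generic eps tau.
Notation m := #|gT|.
Notation ts := (tau_scalar eps tau).
Import Num.Theory.

Lemma tau_scalar_period i : \sum_(s < m) ts (i + s)%N = m%:R * tau 1%g.
Proof.
rewrite /tau_scalar exchange_big /= (bigD1 1%g) //= [X in _ + X]big1 ?addr0 => [|g ng].
  under eq_bigr do rewrite eps1 expr1n mulr1.
  by rewrite sumr_const card_ord mulr_natl.
under eq_bigr do rewrite exprD mulrA.
by rewrite -mulr_sumr sum_eps_expr (negPf ng) mulr0.
Qed.

Lemma tau_scalar_period_rev i : \sum_(s < m) ts (i + s * m.-1)%N = m%:R * tau 1%g.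
Proof.
rewrite /tau_scalar exchange_big /= (bigD1 1%g) //= [X in _ + X]big1 ?addr0 => [|g ng].
  under eq_bigr do rewrite eps1 expr1n mulr1.
  by rewrite sumr_const card_ord mulr_natl.
have Eg : eps g ^+ m.-1 = eps g^-1%g.
  apply: (mulfI (eps_neq0 eps g)); rewrite -exprS prednK ?(card_gt0G gT) // eps_expm.
  by rewrite -epsM mulgV eps1.
under eq_bigr do rewrite exprD mulnC exprM Eg mulrA.
by rewrite -mulr_sumr sum_eps_expr invg_eq1 (negPf ng) mulr0.
Qed.

Lemma tau_total_neq0 : m%:R * tau 1%g != 0.
Proof.
have := @tau_generic [ffun=> 1] (or_intror (ex_intro2 _ _ (1 : int) (oner_neq0 _) erefl)).
rewrite -(tau_scalar_period 0); congr (_ != 0); apply: eq_bigr => i _.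
by rewrite ffunE mul1r.
Qed.

Lemma tau_scalar_mod i : ts (i %% m) = ts i.
Proof.
apply: eq_bigr => g _; congr (_ * _).
by rewrite [in RHS](divn_eq i m) exprD mulnC exprM eps_expm expr1n mul1r.
Qed.

Lemma period_sum (f : nat -> F) S : (forall i, \sum_(s < m) f (i + s)%N = S) ->
  forall i q, \sum_(s < q * m) f (i + s)%N = S *+ q.
Proof.
move=> Hf i q; elim: q i => [|q IH] i; first by rewrite mul0n big_ord0.
rewrite mulSn -(big_mkord xpredT (fun s => f (i + s)%N)) (big_cat_nat _ (leq_addr (q * m) m)) //=.
rewrite big_mkord Hf -{1}[m]add0n big_addn addKn big_mkord mulrS; congr (_ + _).
by rewrite -(IH (i + m)%N); apply: eq_bigr => s _; rewrite addnAC addnA.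
Qed.

(** For [k] divisible by [m] the sum is a positive multiple of the value on the imaginary root,
    nonzero in characteristic zero; otherwise it is the value on a real root. *)
Lemma tau_interval_neq0 i k : (0 < k)%N -> \sum_(s < k) ts (i + s)%N != 0.
Proof.
move=> k_gt0; have m_gt0 := card_gt0G gT.
have [/dvdnP[q Eq]|ndvd] := boolP (m %| k)%N.
  have E : \sum_(s < k) ts (i + s)%N = (m%:R * tau 1%g) *+ q.
    by rewrite Eq; apply: period_sum => j; exact: tau_scalar_period.
  rewrite E -mulr_natr mulf_eq0 negb_or tau_total_neq0 pnatr_eq0.
  by move: k_gt0; rewrite Eq; case: q {Eq E}.
have := tau_generic (or_introl (interval_real i ndvd m_gt0)); congr (_ != 0).
under eq_bigr => j _ do rewrite ffunE /interval_count raddf_sum mulr_suml.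
rewrite exchange_big; apply: eq_bigr => s _ /=.
rewrite (bigD1 (Ordinal (ltn_pmod (i + s) m_gt0))) //= big1 ?addr0 => [|j nj].
  by rewrite modn_mod eqxx rmorph1 mul1r tau_scalar_mod.
have -> : (i + s == j %[mod m]) = false.
  apply/negP => /eqP E; case/eqP: nj; apply: val_inj; rewrite /= E modn_small //.
by rewrite mul0r.
Qed.

End GenericWeights.

(** * Linear algebra modulo a subspace of finite codimension *)

Section FiniteDimensional.
Variables (F : numClosedFieldType) (V : lmodType F) (N : V -> Prop).
Hypothesis N0 : N 0.
Hypothesis ND : forall c u v, N u -> N v -> N (c *: u + v).
Hypothesis fd : exists (k : nat) (b : 'I_k -> V), forall v, exists c : 'I_k -> F,
  N (v - \sum_i c i *: b i).
Import Num.Theory.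

Lemma subspaceZ c u : N u -> N (c *: u).
Proof. by move=> Nu; rewrite -[_ *: _]addr0; exact: ND. Qed.
Lemma subspaceD u v : N u -> N v -> N (u + v).
Proof. by move=> Nu Nv; rewrite -[u]scale1r; exact: ND. Qed.
Lemma subspaceN u : N u -> N (- u).
Proof. by rewrite -scaleN1r; exact: subspaceZ. Qed.
Lemma subspaceB u v : N u -> N v -> N (u - v).
Proof. by move=> Nu /subspaceN; exact: subspaceD. Qed.
Lemma subspace_sum (I : Type) (r : seq I) (P : pred I) (f : I -> V) :
  (forall i, P i -> N (f i)) -> N (\sum_(i <- r | P i) f i).
Proof. by move=> H; elim/big_ind: _ => //; exact: subspaceD. Qed.
Lemma subspaceBl u v : N (u - v) -> N v -> N u.
Proof. by move=> Nuv Nv; rewrite -(subrK v u); exact: subspaceD. Qed.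
(** Linear combinations of a sequence are coded by polynomials; on the iterates of an operator [T]
    at [v] this is [p(T) v]. *)
Definition peval (u : nat -> V) (p : {poly F}) : V := \sum_(i < size p) p`_i *: u i.

Lemma pevalE u (p : {poly F}) n : (size p <= n)%N -> peval u p = \sum_(i < n) p`_i *: u i.
Proof.
move=> le; rewrite /peval (big_ord_widen n (fun i => p`_i *: u i) le) big_mkcond /=.
by apply: eq_bigr => i _; case: ltnP => // /(nth_default 0) ->; rewrite scale0r.
Qed.

(** The coordinates modulo [N] of [k + 1] terms form a matrix with [k] columns, which has a nonzero
    left kernel; a row in it is read as a polynomial. *)
Lemma dependence (u : nat -> V) : exists2 p : {poly F}, p != 0 & N (peval u p).
Proof.
have [k [b Hb]] := fd; have [A HA] := choice (fun i => Hb (u i)).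
pose M : 'M[F]_(k.+1, k) := \matrix_(i, j) A i j.
have : kermx M != 0.
  rewrite -mxrank_eq0 mxrank_ker subn_eq0 -ltnNge; exact: leq_ltn_trans (rank_leq_col _) _.
case/rowV0Pn=> c /sub_kermxP cM c_neq0; exists (rVpoly c).
  by apply: contra c_neq0 => /eqP Ep; rewrite -(rVpolyK c) Ep linear0.
rewrite (pevalE _ (size_poly _ _)).
have -> : \sum_(i < k.+1) (rVpoly c)`_i *: u i =
    \sum_(i < k.+1) c 0 i *: (u i - \sum_j A i j *: b j).
  rewrite (eq_bigr (fun i : 'I_k.+1 => c 0 i *: u i)); last first.
    by move=> i _; rewrite coef_rVpoly_ord.
  rewrite [RHS](eq_bigr (fun i : 'I_k.+1 => c 0 i *: u i - c 0 i *: \sum_j A i j *: b j));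
    last first.
    by move=> i _; rewrite scalerBr.
  rewrite sumrB [X in _ - X](_ : _ = 0) ?subr0 //.
  under eq_bigr do rewrite scaler_sumr.
  rewrite exchange_big big1 // => j _.
  under eq_bigr do rewrite scalerA.
  rewrite -scaler_suml.
  have /matrixP/(_ 0 j) := cM; rewrite !mxE => E.
  by rewrite [X in X *: _](_ : _ = 0) ?scale0r // -[RHS]E; apply: eq_bigr => i _; rewrite !mxE.
by apply: subspace_sum => i _; exact: subspaceZ.
Qed.

Lemma pevalD u p r : peval u (p + r) = peval u p + peval u r.
Proof.
pose n := maxn (size p) (size r).
rewrite !(@pevalE u _ n) ?leq_maxl ?leq_maxr //; last exact: size_polyD.
by rewrite -big_split; apply: eq_bigr => i _; rewrite coefD scalerDl.
Qed.

Lemma pevalZ u c p : peval u (c *: p) = c *: peval u p.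
Proof.
rewrite !(@pevalE u _ (size p)) ?size_scale_leq // scaler_sumr.
by apply: eq_bigr => i _; rewrite coefZ scalerA.
Qed.

Section Operators.
Variable T : V -> V.
Hypothesis TD : forall c u v, T (c *: u + v) = c *: T u + T v.

Lemma op0 : T 0 = 0.
Proof. by have := TD (-1) 0 0; rewrite scaleN1r addNr scaleN1r addNr. Qed.
Lemma opD u v : T (u + v) = T u + T v.
Proof. by rewrite -[u]scale1r TD !scale1r. Qed.
Lemma opZ c u : T (c *: u) = c *: T u.
Proof. by rewrite -[_ *: u]addr0 TD op0 addr0. Qed.
Lemma opB u v : T (u - v) = T u - T v.
Proof. by rewrite opD -scaleN1r opZ scaleN1r. Qed.
Lemma op_sum (I : Type) (r : seq I) (P : pred I) (f : I -> V) :
  T (\sum_(i <- r | P i) f i) = \sum_(i <- r | P i) T (f i).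
Proof. by elim/big_rec2: _ => [|i u v _ <-]; rewrite ?op0 ?opD. Qed.

Lemma pevalX v p : peval (fun i => iter i T v) ('X * p) = T (peval (fun i => iter i T v) p).
Proof.
rewrite (@pevalE _ ('X * p) (size p).+1); last first.
  by apply: leq_trans (size_polyMleq _ _) _; rewrite size_polyX.
rewrite big_ord_recl coefXM scale0r add0r op_sum.
by apply: eq_bigr => i _; rewrite coefXM /= opZ.
Qed.

(** Some nonzero polynomial in [T] sends [v] into [N]. Applying its linear factors one at a time,
    the last vector outside [N] is an eigenvector modulo [N]. *)
Lemma eigenvector (D : V -> Prop) (v : V) :
  (forall c u w, D u -> D w -> D (c *: u + w)) -> (forall u, D u -> D (T u)) ->
  D v -> ~ N v -> exists u c, [/\ D u, ~ N u & N (T u - c *: u)].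
Proof.
move=> DD DT Dv Nv; have [p p_neq0] := dependence (fun i => iter i T v).
have [r ->] := closed_field_poly_normal p; rewrite pevalZ => Np.
have {Np}: N (peval (fun i => iter i T v) (\prod_(c <- r) ('X - c%:P))).
  rewrite -[peval _ _]scale1r -(mulVf (_ : lead_coef p != 0)) ?lead_coef_eq0 //.
  by rewrite -scalerA; exact: subspaceZ.
suff H : forall r, D (peval (fun i => iter i T v) (\prod_(c <- r) ('X - c%:P))) /\
    (N (peval (fun i => iter i T v) (\prod_(c <- r) ('X - c%:P))) ->
     exists u c, [/\ D u, ~ N u & N (T u - c *: u)]) by move/(H r).2.
elim=> [|c s [Ds IH]].
  rewrite big_nil; have -> : peval (fun i => iter i T v) 1 = v.
    by rewrite /peval size_poly1 big_ord1 coef1 scale1r.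
  by split.
set w := peval _ _ in Ds IH.
have -> : peval (fun i => iter i T v) (\prod_(c0 <- c :: s) ('X - c0%:P)) = T w - c *: w.
  by rewrite big_cons mulrBl mul_polyC -scaleNr pevalD pevalX pevalZ scaleNr.
split; first by rewrite -scaleNr addrC; apply: DD => //; exact: DT.
move=> Nw; have [/IH //|Nw'] := pselect (N w).
by exists w, c.
Qed.

(* Applying [H] minus its top eigenvalue to a relation among the iterates kills the leading
   term; hence a relation of minimal degree is a monomial. *)
Lemma nilpotent_on (H : V -> V) (u : V) (c s : F) :
  (forall a x y, H (a *: x + y) = a *: H x + H y) -> (forall x, N x -> N (H x)) ->
  s != 0 -> (forall i, N (H (iter i T u) - (c + i%:R * s) *: iter i T u)) ->
  exists i, N (iter i T u).
Proof.
move=> HD HN s_neq0 Heig.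
have H0 : H 0 = 0 by have := HD (-1) 0 0; rewrite scaleN1r addNr scaleN1r addNr.
have [p] := dependence (fun i => iter i T u).
have [k le_p] := ubnP (size p).
elim: k p le_p => // k IH p le_p p_neq0 Np.
have size_p : size p = (size p).-1.+1 by rewrite prednK // lt0n size_poly_eq0.
set D := (size p).-1 in size_p.
pose p' := \poly_(i < D) (p`_i * ((i%:R - D%:R) * s)).
have Np' : N (peval (fun i => iter i T u) p').
  have E : peval (fun i => iter i T u) p' =
      (H (peval (fun i => iter i T u) p) - (c + D%:R * s) *: peval (fun i => iter i T u) p)
      - \sum_(i < D.+1) p`_i *: (H (iter i T u) - (c + i%:R * s) *: iter i T u).
    have -> : H (peval (fun i => iter i T u) p) = \sum_(i < D.+1) p`_i *: H (iter i T u).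
      rewrite /peval -size_p; by elim/big_rec2: _ => [|i x y _ <-] //; rewrite HD.
    rewrite (@pevalE _ p D.+1) ?size_p // scaler_sumr -!sumrB (@pevalE _ p' D.+1); last first.
      exact: leq_trans (size_poly _ _) (leqnSn _).
    apply: eq_bigr => i _. rewrite scalerBr !scalerA opprB addrCA [X in _ + X]addrAC subrr sub0r.
    rewrite -scalerBl coef_poly; congr (_ *: _); case: ltnP => [_|leDi]; first by ring.
    have -> : i = D :> nat by apply/eqP; rewrite eqn_leq leDi andbT -ltnS.
    by ring.
  rewrite E; apply: subspaceB; first by apply: subspaceB; [exact: HN|exact: subspaceZ].
  by apply: subspace_sum => i _; exact: subspaceZ.
have [p'0|p'_neq0] := eqVneq p' 0; last first.
  apply: IH p'_neq0 Np'; apply: leq_ltn_trans (size_poly _ _) _.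
  by rewrite -ltnS -size_p.
have pi0 i : (i < D)%N -> p`_i = 0.
  move=> ltiD; have := congr1 (fun r : {poly F} => r`_i) p'0.
  rewrite coef_poly ltiD coef0 => /eqP; rewrite mulf_eq0 => /orP[/eqP //|].
  by rewrite mulf_eq0 (negPf s_neq0) orbF subr_eq0 eqr_nat ltn_eqF.
exists D; move: Np; rewrite (@pevalE _ p D.+1) ?size_p // big_ord_recr /= big1 ?add0r => [Np|i _].
  rewrite -[iter _ _ _]scale1r -(mulVf (_ : p`_D != 0)); last by rewrite -lead_coefE lead_coef_eq0.
  by rewrite -scalerA; exact: subspaceZ.
by rewrite pi0 ?scale0r.
Qed.

End Operators.

End FiniteDimensional.

(** * Absence of finite-dimensional [B]-modules *)

Section NoFiniteDimensional.
Variables (F : numClosedFieldType) (gT : finGroupType) (eps : primitive_char F gT).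
Variables (tau : {ffun gT -> F}).
Hypothesis tau_generic : generic eps tau.
Notation m := #|gT|.
Notation ts := (tau_scalar eps tau).
Import Num.Theory.

Variables (V : lmodType F) (P N : V -> Prop).
Variables (opz : bool -> V -> V) (opg : gT -> V -> V).
Hypothesis N0 : N 0.
Hypothesis ND : forall c u v, N u -> N v -> N (c *: u + v).
Hypothesis PD : forall c u v, P u -> P v -> P (c *: u + v).
Hypothesis fd : exists (k : nat) (b : 'I_k -> V), forall v, exists c : 'I_k -> F,
  N (v - \sum_i c i *: b i).
Hypothesis opzD : forall z c u v, opz z (c *: u + v) = c *: opz z u + opz z v.
Hypothesis opgD : forall g c u v, opg g (c *: u + v) = c *: opg g u + opg g v.
Hypothesis Nz : forall z u, N u -> N (opz z u).
Hypothesis Pz : forall z u, P u -> P (opz z u).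
Hypothesis Pg : forall g u, P u -> P (opg g u).
Hypothesis opgM : forall g h v, opg (g * h)%g v = opg h (opg g v).
Hypothesis opg1 : forall v, opg 1%g v = v.
Hypothesis opgz : forall g z v,
  opz z (opg g v) = (if z then (eps g)^-1 else eps g) *: opg g (opz z v).
Hypothesis op_rel : forall v, P v ->
  N (opz true (opz false v) - opz false (opz true v) - \sum_g tau g *: opg g v).

Let NZ := subspaceZ N0 ND.
Let NaddD := subspaceD ND.
Let NaddB := subspaceB N0 ND.
Let NBl := subspaceBl ND.

(** The module under study is [P] modulo [N]: the codimension of [N] is measured in all of [V], but
    the relation of [B] is imposed on [P] alone. This covers subspaces of [U] and subquotients of
    [R], where the relation fails in the ambient space. *)
Definition has_weight (w : nat) (u : V) := forall g, opg g u = eps g ^+ w *: u.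

Lemma has_weight_z z w u : has_weight w u -> has_weight (next_weight gT z w) (opz z u).
Proof.
move=> Hu g; have := opgz g z u; rewrite Hu (opZ (opzD z)) next_weightE => E.
have {}E : (letter_weight eps z g * eps g ^+ w) *: opz z u =
    (letter_weight eps z g * (if z then (eps g)^-1 else eps g)) *: opg g (opz z u).
  by rewrite -!scalerA E.
rewrite mulrC E /letter_weight.
by case: z {E}; rewrite ?mulfV ?mulVf ?eps_neq0 // scale1r.
Qed.

Lemma has_weight_eq w w' u : (forall g, eps g ^+ w = eps g ^+ w') ->
  has_weight w u -> has_weight w' u.
Proof. by move=> E H g; rewrite H E. Qed.

Lemma op_rel_weight w v : P v -> has_weight w v ->
  N (opz true (opz false v) - opz false (opz true v) - ts w *: v).
Proof.
move=> Pv Hv; have := op_rel Pv; congr (N (_ - _)).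
by rewrite /tau_scalar scaler_suml; apply: eq_bigr => g _; rewrite Hv scalerA.
Qed.

Definition weight_part (w : nat) (v : V) : V :=
  \sum_g (m%:R^-1 * (eps g ^+ w)^-1) *: opg g v.

Lemma weight_partE v : v = \sum_(w < m) weight_part w v.
Proof.
rewrite exchange_big /= (bigD1 1%g) //= [X in _ + X]big1 ?addr0 => [|g ng].
  under eq_bigr do rewrite eps1 expr1n invr1 mulr1 opg1.
  by rewrite sumr_const card_ord -scaler_nat scalerA mulfV ?card_neq0 // scale1r.
rewrite -scaler_suml -mulr_sumr.
under eq_bigr do rewrite -exprVn -eps_inv.
by rewrite sum_eps_expr invg_eq1 (negPf ng) mulr0 scale0r.
Qed.

Lemma weight_part_weight w v : has_weight w (weight_part w v).
Proof.
move=> h; rewrite /weight_part (op_sum (opgD h)) scaler_sumr.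
rewrite [RHS](reindex_inj (mulIg h)) /=; apply: eq_bigr => g _.
rewrite (opZ (opgD h)) -opgM scalerA epsM exprMn; congr (_ *: _).
by rewrite invfM mulrCA [X in _ = _ * X]mulrCA mulfV ?expf_neq0 ?eps_neq0 ?mulr1.
Qed.

Lemma P0 v : P v -> P 0.
Proof. by move=> Pv; have := PD (-1) Pv Pv; rewrite scaleN1r addNr. Qed.

Lemma weight_part_P w v : P v -> P (weight_part w v).
Proof.
move=> Pv; have P_0 := P0 Pv; rewrite /weight_part; elim/big_ind: _ => //.
  by move=> x y Px Py; rewrite -[x]scale1r; exact: PD.
by move=> g _; rewrite -[_ *: _]addr0; apply: PD => //; exact: Pg.
Qed.

Notation X := (opz false).
Notation Y := (opz true).

Lemma iter_z_P z k u : P u -> P (iter k (opz z) u).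
Proof. by move=> Pu; elim: k => //= k; exact: Pz. Qed.

Lemma lowest_iterate T (u : V) : ~ N u -> (exists k, N (iter k T u)) ->
  exists k, ~ N (iter k T u) /\ N (T (iter k T u)).
Proof.
move=> Nu [k]; elim: k => [//|k IH] Nk.
by have [/IH //|Nk'] := pselect (N (iter k T u)); exists k.
Qed.

Lemma iter_iter z k i u : iter i (iter k (opz z)) u = iter (i * k) (opz z) u.
Proof. by elim: i => //= i ->; rewrite mulSn iterD. Qed.

Let HD c u v : Y (X (c *: u + v)) = c *: Y (X u) + Y (X v).
Proof. by rewrite !opzD. Qed.
Let HN u : N u -> N (Y (X u)).
Proof. by move=> Nu; do 2 apply: Nz. Qed.

Lemma letter_nilpotent z (u : V) (c s : F) : s != 0 ->
  (forall i, N (Y (X (iter (i * m) (opz z) u)) - (c + i%:R * s) *: iter (i * m) (opz z) u)) ->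
  exists k, N (iter k (opz z) u).
Proof.
move=> s0 H; have [|i] := nilpotent_on N0 ND fd (T := iter m (opz z)) (u := u) (c := c) HD HN s0.
  by move=> i; rewrite iter_iter.
by rewrite iter_iter => Ni; exists (i * m)%N.
Qed.

(* Take an eigenvector of [v |-> v.(xy)] in a weight space and push it by [x] to a nonzero
   [a] with [a.x = 0]; then [a.y^(k+1)x] is [- c a.y^k] with [c] a sum of consecutive [tau_i].
   Such sums are values at [tau] of positive roots, so no [a.y^k] can be the last nonzero one.
   Everything is taken modulo [N]. *)
Lemma no_finite_dimensional v : P v -> N v.
Proof.
move=> Pv; apply: contrapT => Nv.
have [w [Pw Nw]] : exists w, P (weight_part w v) /\ ~ N (weight_part w v).
  apply: contrapT => H; apply: Nv; rewrite [v]weight_partE.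
  apply: (subspace_sum N0 ND) => w _; apply: contrapT => Nw; apply: H.
  by exists w; split=> //; exact: weight_part_P.
have [u [c [[Pu Wu] Nu Hu]]] : exists u c,
    [/\ P u /\ has_weight w u, ~ N u & N (Y (X u) - c *: u)].
  apply: (eigenvector N0 ND fd HD (D := fun u => P u /\ has_weight w u) (v := weight_part w
    v)) => //.
  - move=> a x y [Px Wx] [Py Wy]; split; first exact: PD.
    by move=> g; rewrite opgD Wx Wy scalerDr !scalerA mulrC.
  - move=> x [Px Wx]; split; first by do 2 apply: Pz.
    apply: has_weight_eq (has_weight_z true (has_weight_z false Wx)) => g.
    rewrite !next_weightE -mulrA /letter_weight mulVf ?mulr1 ?eps_neq0 //.
  - by split=> //; exact: weight_part_weight.
have {Pv Nv Pw Nw v} Wx k : has_weight (w + k * m.-1) (iter k X u).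
  elim: k => [|k IH]; first by rewrite mul0n addn0.
  by have := has_weight_z false IH; rewrite /next_weight /= -addnA [(_ * _ + _)%N]addnC -mulSn.
(* The relation exchanges [xy] and [yx] at the cost of one [tau_i], so [u.x^k] stays an eigenvector
   and its eigenvalue collects one value per step, with indices descending modulo [m]. *)
have Hx k : N (Y (X (iter k X u)) -
    (c + \sum_(s < k) ts (w + m.-1 + s * m.-1)%N) *: iter k X u).
  elim: k => [|k IH]; first by rewrite big_ord0 addr0.
  have Nrel := op_rel_weight (iter_z_P false k.+1 Pu) (Wx k.+1).
  rewrite big_ord_recr /= addrA scalerDl opprD addrA.
  apply: NBl (Nz false IH).
  rewrite (opB (opzD false)) (opZ (opzD false)).
  move: Nrel; rewrite /= mulSn addnA; congr N.
  set a := opz true _; set b := opz false _; set e := _ *: _; set f := _ *: _.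
  by rewrite opprB addrA [RHS](ACl (1*5*3*(2*4)))%AC /= addNr addr0.
have [kx [Na Nxa]] : exists k, ~ N (iter k X u) /\ N (X (iter k X u)).
  apply: lowest_iterate Nu _.
  (* Each power of [x^m] adds a full period, always the nonzero number [m tau(1)], so the
     eigenvalues along these powers form an arithmetic progression. *)
  apply: (letter_nilpotent (c := c) (tau_total_neq0 tau_generic)) => i.
  have := Hx (i * m)%N; congr (N (_ - (_ + _) *: _)).
  have Hper j : \sum_(s < m) ts (w + m.-1 + (j + s) * m.-1)%N = m%:R * tau 1%g.
    under eq_bigr do rewrite mulnDl addnA.
    exact: tau_scalar_period_rev.
  by rewrite [RHS]mulr_natl -(period_sum (f := fun s => ts (w + m.-1 + s * m.-1)%N) Hper 0 i).
set a := iter kx X u in Na Nxa.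
have Pa : P a by exact: iter_z_P.
have [wa Wa] : exists wa, has_weight wa a by exists (w + kx * m.-1)%N; exact: Wx.
have Wy k : has_weight (wa + k) (iter k Y a).
  elim: k => [|k IH]; first by rewrite addn0.
  by have := has_weight_z true IH; rewrite /next_weight /= -addnS.
have Hy k : N (X (iter k.+1 Y a) + (\sum_(s < k.+1) ts (wa + s)%N) *: iter k Y a).
  have step j : N (X (iter j.+1 Y a) - Y (X (iter j Y a)) + ts (wa + j)%N *: iter j Y a).
    have := NZ (-1) (op_rel_weight (iter_z_P true j Pa) (Wy j)).
    by rewrite scaleN1r !opprB addrC.
  elim: k => [|k IH].
    rewrite big_ord1 /= addn0; have := NaddD (step 0%N) (Nz true Nxa).
    by rewrite /= addn0 addrAC subrK.
  rewrite big_ord_recr /= scalerDl.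
  have := NaddD (step k.+1) (Nz true IH).
  rewrite (opD (opzD true)) (opZ (opzD true)); congr N.
  by rewrite /= addrAC addrA subrK -addrA; congr (_ + _); rewrite addrC.
have [ky [Nb Nyb]] : exists k, ~ N (iter k Y a) /\ N (Y (iter k Y a)).
  apply: lowest_iterate Na _.
  (* Here [a.x = 0] makes the progression start at [0], and the sign of its step is that in [Hy]. *)
  apply: (letter_nilpotent (c := 0) (s := - (m%:R * tau 1%g))) => [|[|i]].
  - by rewrite oppr_eq0 (tau_total_neq0 tau_generic).
  - by rewrite mul0n /= mul0r addr0 scale0r subr0; exact: Nz.
  - have [n' Em] : exists n', (i.+1 * m = n'.+1)%N.
      by exists (i.+1 * m).-1; rewrite prednK // muln_gt0 (card_gt0G gT).
    have := Nz true (Hy n'); rewrite (opD (opzD true)) (opZ (opzD true)) -Em.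
    rewrite (period_sum (f := ts) (tau_scalar_period eps tau)) add0r mulrN scaleNr opprK.
    by rewrite -[_ *+ i.+1]mulr_natl Em.
have := Hy ky; have /= NX := Nz false Nyb => Hk; apply: Nb.
have /(NZ (\sum_(s < ky.+1) ts (wa + s)%N)^-1) := NaddB Hk NX.
by rewrite addrAC subrr add0r scalerA mulVf ?scale1r // (tau_interval_neq0 tau_generic).
Qed.

End NoFiniteDimensional.

(** * Splittings of the monad *)

Lemma sub2D (V : zmodType) (x x' y y' z z' : V) :
  (x + x') - (y + y') - (z + z') = (x - y - z) + (x' - y' - z').
Proof. by rewrite !opprD (addrACA x) [LHS]addrACA. Qed.

Lemma mul3B (S : pzRingType) d k l (U X Y : 'M[S]_d) (I : 'M[S]_(d, k))
    (v1 v2 : 'M[S]_(d, l)) (w : 'M[S]_(k, l)) (b : 'M[S]_l) :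
  U *m (X *m v1 - Y *m v2 - I *m w) *m b =
  U *m X *m v1 *m b - U *m Y *m v2 *m b - U *m I *m w *m b.
Proof. by rewrite !mulmxBr !mulmxBl !mulmxA. Qed.

Lemma mul3D (S : pzRingType) d k l (X Y : 'M[S]_d) (I : 'M[S]_(d, k))
    (v1 v2 u1 u2 : 'M[S]_(d, l)) (w w' : 'M[S]_(k, l)) (b : 'M[S]_l) :
  X *m (v1 *m b + u1) - Y *m (v2 *m b + u2) - I *m (w *m b + w') =
  (X *m v1 - Y *m v2 - I *m w) *m b + (X *m u1 - Y *m u2 - I *m w').
Proof. by rewrite !mulmxDr sub2D !mulmxBl !mulmxA. Qed.

Lemma mul3Dl (S : pzRingType) d k l (X Y : 'M[S]_d) (J : 'M[S]_(k, d))
    (v1 v2 u1 u2 : 'M[S]_(l, d)) (w w' : 'M[S]_(l, k)) (b : 'M[S]_l) :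
  (b *m v1 + u1) *m Y + (b *m v2 + u2) *m X + (b *m w + w') *m J =
  b *m (v1 *m Y + v2 *m X + w *m J) + (u1 *m Y + u2 *m X + w' *m J).
Proof. by rewrite !mulmxDl !mulmxDr !mulmxA (addrACA (b *m v1 *m Y)) [LHS]addrACA. Qed.

Lemma mul3Dr (S : pzRingType) d k l (X Y U : 'M[S]_d) (J : 'M[S]_(k, d))
    (v1 v2 : 'M[S]_(l, d)) (w : 'M[S]_(l, k)) (b : 'M[S]_l) :
  b *m ((v1 *m Y + v2 *m X + w *m J) *m U) =
  b *m (v1 *m (Y *m U)) + b *m (v2 *m (X *m U)) + b *m (w *m (J *m U)).
Proof. by rewrite !mulmxDl !mulmxDr !mulmxA. Qed.

Lemma eq_add3 (V : nmodType) (a b c a' b' c' : V) :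
  a = a' -> b = b' -> c = c' -> a + b + c = a' + b' + c'.
Proof. by move=> -> -> ->. Qed.

(** A predicate comes without a basis; a matrix of maximal rank with rows in [S] replaces it. By
    maximality its row space contains [S], and a rank below [d] would give a nonzero column killed
    by [S]. *)
Lemma proper_subspace_annihilator (F : fieldType) d (S : 'rV[F]_d -> Prop) :
  S 0 -> (forall a u v, S u -> S v -> S (a *: u + v)) ->
  (forall u : 'cV[F]_d, (forall r, S r -> r *m u = 0) -> u = 0) -> forall r, S r.
Proof.
move=> S0 SD Hann.
have Scomb k (A : 'M[F]_(k, d)) : (forall i, S (row i A)) -> forall c, S (c *m A).
  move=> HA c; rewrite mulmx_sum_row; elim/big_ind: _ => // [x y Sx Sy|i _].
    by rewrite -[x]scale1r; exact: SD.
  by rewrite -[_ *: _]addr0; exact: SD.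
pose good k := `[< exists A : 'M[F]_d, (forall i, S (row i A)) /\ \rank A = k >].
have good0 : exists k, good k.
  by exists 0%N; apply/asboolP; exists 0; rewrite mxrank0; split=> // i; rewrite row0.
have good_le k : good k -> (k <= d)%N by move=> /asboolP[A [_ <-]]; exact: rank_leq_row.
case: (ex_maxnP good0 good_le) => k /asboolP[A [HA rA]] max_k.
have subA r : S r -> (r <= A)%MS.
  move=> Sr; have : good (\rank (A + r)%MS).
    apply/asboolP; exists (A + r)%MS; split=> // i.
    have /sub_addsmxP[[c1 c2] /= ->] : (row i (A + r)%MS <= A + r)%MS by exact: row_sub.
    rewrite -[c1 *m A]scale1r; apply: SD; first exact: Scomb.
    by apply: Scomb => j; rewrite ord1 row_id.
  move/max_k; rewrite -rA => le_rk; apply: submx_trans (addsmxSr A r) _.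
  by rewrite -(geq_leqif (mxrank_leqif_sup (addsmxSl A r))).
have fullA : row_full A.
  rewrite row_full_unit -unitmx_tr -row_free_unit -kermx_eq0.
  apply/rowV0P => c /sub_kermxP cA; apply: trmx_inj; rewrite trmx0; apply: Hann => r /subA.
  case/submxP=> e ->; rewrite -mulmxA; apply: trmx_inj.
  by rewrite !trmx_mul trmxK cA trmx0 mul0mx.
by move=> r; have /submxP[e ->] := submx_full r fullA; exact: Scomb.
Qed.

Section Splitting.
Variables (F : numClosedFieldType) (gT : finGroupType) (eps : primitive_char F gT).
Variables (tau : {ffun gT -> F}) (n d : nat) (q : quadruple eps tau n d).
Notation B := (Btau eps tau).
Notation Bs := (Bs eps tau).
Notation Bz := (Bz eps tau).
Notation Bg := (Bg eps tau).
Notation G := (Gbar q).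
Notation pX := (BX q).
Notation pY := (BY q).
Notation vi := (Bi q).
Notation vj := (Bj q).
Notation U := (BU q).

(* Instances at [B], since rewriting with the general identities would unfold its quotient
   construction. *)
Lemma mul3BB k l (U X Y : 'M[B]_d) (I : 'M[B]_(d, k))
    (v1 v2 : 'M[B]_(d, l)) (w : 'M[B]_(k, l)) (b : 'M[B]_l) :
  U *m (X *m v1 - Y *m v2 - I *m w) *m b =
  U *m X *m v1 *m b - U *m Y *m v2 *m b - U *m I *m w *m b.
Proof. exact: mul3B. Qed.

Lemma mul3DB k l (X Y : 'M[B]_d) (I : 'M[B]_(d, k))
    (v1 v2 u1 u2 : 'M[B]_(d, l)) (w w' : 'M[B]_(k, l)) (b : 'M[B]_l) :
  X *m (v1 *m b + u1) - Y *m (v2 *m b + u2) - I *m (w *m b + w') =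
  (X *m v1 - Y *m v2 - I *m w) *m b + (X *m u1 - Y *m u2 - I *m w').
Proof. exact: mul3D. Qed.

Lemma mul3DlB k l (X Y : 'M[B]_d) (J : 'M[B]_(k, d))
    (v1 v2 u1 u2 : 'M[B]_(l, d)) (w w' : 'M[B]_(l, k)) (b : 'M[B]_l) :
  (b *m v1 + u1) *m Y + (b *m v2 + u2) *m X + (b *m w + w') *m J =
  b *m (v1 *m Y + v2 *m X + w *m J) + (u1 *m Y + u2 *m X + w' *m J).
Proof. exact: mul3Dl. Qed.

Lemma mul3DrB k l (X Y U : 'M[B]_d) (J : 'M[B]_(k, d))
    (v1 v2 : 'M[B]_(l, d)) (w : 'M[B]_(l, k)) (b : 'M[B]_l) :
  b *m ((v1 *m Y + v2 *m X + w *m J) *m U) =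
  b *m (v1 *m (Y *m U)) + b *m (v2 *m (X *m U)) + b *m (w *m (J *m U)).
Proof. exact: mul3Dr. Qed.

Lemma BU_BX g : U g *m pX = (Bs (eps g)^-1)%:M *m (pX *m U g).
Proof.
by rewrite BX_BU [RHS]mulmxA -scalar_mxM -(rmorphM Bs) mulVf ?eps_neq0 // (rmorph1 Bs) mul1mx.
Qed.

Lemma BU_BY g : U g *m pY = (Bs (eps g))%:M *m (pY *m U g).
Proof.
by rewrite BY_BU [RHS]mulmxA -scalar_mxM -(rmorphM Bs) mulfV ?eps_neq0 // (rmorph1 Bs) mul1mx.
Qed.

Lemma scalar_shuffle k (a : F) (b : B) (A C : 'M[B]_d) (v : 'M[B]_(d, k)) :
  (Bs a)%:M *m (A *m C) *m v *m b%:M = A *m (C *m v *m (Bs a * b)%:M).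
Proof. by rewrite -!mulmxA -Bs_mx_comm -!mulmxA -scalar_mxM Bs_comm. Qed.

Lemma scalar_shuffle_r k (a : F) (b : B) (A C : 'M[B]_d) (v : 'M[B]_(k, d)) :
  b%:M *m (v *m ((Bs a)%:M *m (A *m C))) = (b * Bs a)%:M *m (v *m A) *m C.
Proof. by rewrite [v *m _]mulmxA Bs_mx_comm scalar_mxM !mulmxA. Qed.

(* The constant vectors in the image of the last map of the monad form a subspace to which
   stability applies. *)
Lemma cokernel_splitting : exists (s1 s2 : 'M[B]_d) (s3 : 'rV[B]_d),
  pX *m s1 - pY *m s2 - vi *m s3 = 1%:M.
Proof.
pose S (u : 'cV[F]_d) := exists (v1 v2 : 'cV[B]_d) (w : 'M[B]_1),
  pX *m v1 - pY *m v2 - vi *m w = map_mx Bs u.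
have HS : forall u, S u.
  apply: (quad_stable (q := q)).
  - by exists 0, 0, 0; rewrite !mulmx0 !subr0 map_mx0.
  - move=> a u v [v1 [v2 [w E]]] [v1' [v2' [w' E']]].
    exists (v1 *m (Bs a)%:M + v1'), (v2 *m (Bs a)%:M + v2'), (w *m (Bs a)%:M + w').
    by rewrite map_mxD map_BsZ -Bs_mx_comm -E -E' mul3DB.
  - move=> g u [v1 [v2 [w E]]].
    (* [U g] passes the pencils at the cost of [eps g] or its inverse, and passes [i] by its weight;
       the factor [Bg g] on the right undoes the twist in [U g]. *)
    exists (U g *m v1 *m (Bs (eps g)^-1 * Bg g)%:M),
      (U g *m v2 *m (Bs (eps g) * Bg g)%:M),
      ((Bs (eps g ^+ n) * Bg g^-1%g)%:M *m w *m (Bg g)%:M).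
    rewrite map_G -E mul3BB BU_BX BU_BY BU_Bi.
    by rewrite 2!scalar_shuffle -!(mulmxA vi).
  - move=> u [v1 [v2 [w E]]].
    (* [X u = (X - x) u + u x], and the image is a right submodule. The case of [Y] is the same up
       to the sign of the middle term. *)
    exists (v1 *m (Bz false)%:M + map_mx Bs u), (v2 *m (Bz false)%:M + 0), (w *m (Bz false)%:M + 0).
    rewrite (mul3DB pX pY vi v1 v2 (map_mx Bs u) 0 w 0 (Bz false)%:M) E !mulmx0 !subr0
      map_Bs_comm BX.unlock mulmxBl addrCA subrr addr0.
    by rewrite map_mxM.
  - move=> u [v1 [v2 [w E]]].
    exists (v1 *m (Bz true)%:M + 0), (v2 *m (Bz true)%:M + - map_mx Bs u), (w *m (Bz true)%:M + 0).
    rewrite (mul3DB pX pY vi v1 v2 0 (- map_mx Bs u) w 0 (Bz true)%:M) E !mulmx0 subr0 sub0r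
      mulmxN opprK map_Bs_comm BY.unlock mulmxBl addrCA subrr addr0.
    by rewrite map_mxM.
  - by exists 0, 0, (-1%:M); rewrite !mulmx0 subr0 add0r mulmxN mulmx1 opprK Bi.unlock.
have [v1 /choice[v2 /choice[w E]]] := choice (fun i : 'I_d => HS (delta_mx i 0)).
exists (\matrix_(i, j) v1 j i 0), (\matrix_(i, j) v2 j i 0), (\row_j w j 0 0).
apply/matrixP => i j; rewrite !mxE; have /matrixP/(_ i 0) := E j; rewrite !mxE eqxx andbT.
have -> : (Bs (i == j)%:R) = (i == j)%:R by rewrite rmorph_nat.
move=> <-; congr (_ - _ - _); first by apply: eq_bigr => k _; rewrite !mxE.
  by apply: eq_bigr => k _; rewrite !mxE.
by apply: eq_bigr => k _; rewrite !mxE ord1.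
Qed.

Hypothesis tau_generic : generic eps tau.

(** Where [j] vanishes, the quadruple relation loses its right-hand side and becomes the relation of
    [B]. A stable subspace of this kind is thus a finite-dimensional right [B]-module, so it is
    zero. *)
Lemma costable (P : 'cV[F]_d -> Prop) :
  (forall c u v, P u -> P v -> P (c *: u + v)) ->
  (forall g u, P u -> P (G g *m u)) -> (forall u, P u -> P (Xbar q *m u)) ->
  (forall u, P u -> P (Ybar q *m u)) -> (forall u, P u -> jbar q *m u = 0) ->
  forall u, P u -> u = 0.
Proof.
move=> PD PG PX PY Pj.
pose opz (z : bool) (u : 'cV[F]_d) := (if z then Ybar q else Xbar q) *m u.
apply: (no_finite_dimensional tau_generic (opz := opz)
  (opg := fun g u => G g *m u)) => //.
- by move=> c u v Hu Hv; rewrite Hu Hv scaler0 addr0.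
- exists d, (fun i => delta_mx i 0) => v; exists (fun i => v i 0).
  apply/eqP; rewrite subr_eq0; apply/eqP/matrixP => i j; rewrite ord1 summxE.
  rewrite (bigD1 i) //= big1 ?addr0 => [|k ki]; first by rewrite !mxE !eqxx mulr1.
  by rewrite !mxE eq_sym (negPf ki) mulr0.
- by move=> z c u v; rewrite /opz mulmxDr scalemxAr.
- by move=> g c u v; rewrite mulmxDr scalemxAr.
- by move=> z u /= ->; rewrite /opz mulmx0.
- by move=> [] u Pu; [exact: PY|exact: PX].
- by move=> g h v; rewrite mulmxA -GM (gT_comm eps).
- by move=> v; rewrite G1 mul1mx.
- move=> g z v; rewrite /opz !mulmxA; case: z; rewrite ?Xbar_equiv ?Ybar_equiv;
    by rewrite -scalemxAl.
- move=> v Pv; rewrite /opz !mulmxA.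
  have -> : \sum_g tau g *: (G g *m v) = (\sum_g tau g *: G g) *m v.
    by rewrite mulmx_suml; apply: eq_bigr => g _; rewrite scalemxAl.
  have -> : \sum_g tau g *: G g =
      ibar q *m jbar q - (Xbar q *m Ybar q - Ybar q *m Xbar q).
    by rewrite -quad_rel addrC addKr.
  by rewrite !mulmxBl -(mulmxA (ibar q)) Pj // mulmx0 sub0r opprK addrC subrKA subrr.
Qed.

(* Dually, the common annihilator of the constant rows in the image is a module over [B]
   (as [j] kills it), hence zero. *)
Lemma kernel_splitting : exists (r1 r2 : 'M[B]_d) (r3 : 'cV[B]_d),
  r1 *m pY + r2 *m pX + r3 *m vj = 1%:M.
Proof.
pose S (r : 'rV[F]_d) := exists (v1 v2 : 'rV[B]_d) (w : 'M[B]_1),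
  v1 *m pY + v2 *m pX + w *m vj = map_mx Bs r.
have S0 : S 0 by exists 0, 0, 0; rewrite !mul0mx !addr0 map_mx0.
have SD a u v : S u -> S v -> S (a *: u + v).
  move=> [v1 [v2 [w E]]] [v1' [v2' [w' E']]].
  exists ((Bs a)%:M *m v1 + v1'), ((Bs a)%:M *m v2 + v2'), ((Bs a)%:M *m w + w').
  by rewrite map_mxD map_BsZ -E -E'; exact: mul3DlB.
have SG g r : S r -> S (r *m G g).
  move=> [v1 [v2 [w E]]].
  exists ((Bg g * Bs (eps g)^-1)%:M *m (v1 *m U g)), ((Bg g * Bs (eps g))%:M *m (v2 *m U g)),
    ((Bg g)%:M *m (w *m (Bs (eps g ^+ n) * Bg g^-1%g)%:M)).
  rewrite map_Gr -E (mul3DrB pX pY (U g) vj v1 v2 w (Bg g)%:M) BY_BU BX_BU Bj_BU.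
  apply: eq_add3; try by rewrite scalar_shuffle_r.
  by rewrite !mulmxA.
have SX r : S r -> S (r *m Xbar q).
  move=> [v1 [v2 [w E]]].
  exists ((Bz false)%:M *m v1 + 0), ((Bz false)%:M *m v2 + map_mx Bs r), ((Bz false)%:M *m w + 0).
  rewrite (mul3DlB pX pY vj v1 v2 0 (map_mx Bs r) w 0 (Bz false)%:M) E !mul0mx add0r addr0
    -map_Bs_comm BX.unlock mulmxBr addrC subrK.
  by rewrite map_mxM.
have SY r : S r -> S (r *m Ybar q).
  move=> [v1 [v2 [w E]]].
  exists ((Bz true)%:M *m v1 + map_mx Bs r), ((Bz true)%:M *m v2 + 0), ((Bz true)%:M *m w + 0).
  rewrite (mul3DlB pX pY vj v1 v2 (map_mx Bs r) 0 w 0 (Bz true)%:M) E !mul0mx !addr0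
    -map_Bs_comm BY.unlock mulmxBr addrC subrK.
  by rewrite map_mxM.
have Sj : S (jbar q) by exists 0, 0, 1%:M; rewrite !mul0mx !add0r mul1mx Bj.unlock.
have HS : forall r, S r.
  apply: (proper_subspace_annihilator S0 SD) => u Hu.
  apply: (costable (P := fun u => forall r, S r -> r *m u = 0)) => //.
  - by move=> c x y Hx Hy r Sr; rewrite mulmxDr -scalemxAr Hx // Hy // scaler0 addr0.
  - by move=> g x Hx r Sr; rewrite mulmxA Hx //; exact: SG.
  - by move=> x Hx r Sr; rewrite mulmxA Hx //; exact: SX.
  - by move=> x Hx r Sr; rewrite mulmxA Hx //; exact: SY.
  - by move=> x; apply.
have [v1 /choice[v2 /choice[w E]]] := choice (fun i : 'I_d => HS (delta_mx 0 i)).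
exists (\matrix_(i, j) v1 i 0 j), (\matrix_(i, j) v2 i 0 j), (\col_i w i 0 0).
apply/matrixP => i j; rewrite !mxE; have /matrixP/(_ 0 j) := E i; rewrite !mxE eqxx /=.
have -> : Bs (j == i)%:R = (i == j)%:R by rewrite rmorph_nat eq_sym.
move=> <-; congr (_ + _ + _); first by apply: eq_bigr => k _; rewrite !mxE.
  by apply: eq_bigr => k _; rewrite !mxE.
by apply: eq_bigr => k _; rewrite !mxE ord1.
Qed.

End Splitting.

(** * Fox derivatives *)

Lemma fox_mulr (S : pzRingType) d (X Y Z : 'M[S]_d) (v1 v2 v3 : 'cV[S]_d) (c : 'M[S]_1) :
  X *m (v1 *m c) - Y *m (v2 *m c) + Z *m v3 *m c = (X *m v1 - Y *m v2 + Z *m v3) *m c.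
Proof. by rewrite !mulmxDl mulNmx !mulmxA. Qed.

Lemma fox_linear (S : pzRingType) d (X Y Z : 'M[S]_d) (v1 v2 v3 w1 w2 w3 : 'cV[S]_d) (c : 'M[S]_1) :
  X *m (v1 *m c + w1) - Y *m (v2 *m c + w2) + Z *m (v3 *m c + w3) =
  (X *m v1 - Y *m v2 + Z *m v3) *m c + (X *m w1 - Y *m w2 + Z *m w3).
Proof. by rewrite !mulmxDr !mulmxDl mulNmx !mulmxA opprD [X in X + _]addrACA [LHS]addrACA. Qed.

Lemma fox_stepY (S : pzRingType) d (X Y E0 E1 : 'M[S]_d) (A : 'M[S]_d) (v1 v2 u : 'cV[S]_d) y :
  Y *m E1 = E0 *m Y -> A *m u - Y *m u = u *m y ->
  X *m (v1 *m y) - Y *m (v2 *m y + E1 *m u) + E0 *m (A *m u) =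
  (X *m v1 - Y *m v2 + E0 *m u) *m y.
Proof.
move=> YE Au; rewrite mulmxDl mulmxBl mulmxDr opprD -!mulmxA -Au mulmxBr (mulmxA Y E1) YE.
by rewrite -!mulmxA -!addrA; do 2 congr (_ + _); exact: addrC.
Qed.

Lemma fox_stepX (S : pzRingType) d (X Y E0 E1 : 'M[S]_d) (A : 'M[S]_d) (v1 v2 u : 'cV[S]_d) x :
  X *m E1 = E0 *m X -> A *m u - X *m u = u *m x ->
  X *m (v1 *m x - E1 *m u) - Y *m (v2 *m x) + E0 *m (A *m u) =
  (X *m v1 - Y *m v2 + E0 *m u) *m x.
Proof.
move=> XE Au; rewrite mulmxDl mulmxBl mulmxBr -!mulmxA -Au mulmxBr (mulmxA X E1) XE.
by rewrite -!mulmxA [RHS]addrA -!addrA; congr (_ + _); rewrite addrCA; congr (_ + _); exact: addrC.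
Qed.

Section FoxDerivatives.
Variables (F : numClosedFieldType) (gT : finGroupType) (eps : primitive_char F gT).
Variables (tau : {ffun gT -> F}) (n d : nat) (q : quadruple eps tau n d).
Notation R := (crossed eps).
Notation B := (Btau eps tau).
Notation m := #|gT|.
Notation Bs := (Bs eps tau).
Notation Bz := (Bz eps tau).
Notation Bg := (Bg eps tau).
Notation Be := (Be eps tau).
Notation G := (Gbar q).
Notation pX := (BX q).
Notation pY := (BY q).
Notation vi := (Bi q).
Notation vj := (Bj q).
Notation U := (BU q).
Notation E := (BE q).
Notation pi := (to_B eps tau).

(* [(v1, v2, u)]: [u] is a vector of [L^1], and [v1], [v2] are noncommutative derivatives
   along [x] and [y], twisted by the projectors [E]. *)
Definition fox_mod : Type := 'cV[B]_d * 'cV[B]_d * 'cV[F]_d.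
HB.instance Definition _ := GRing.Zmodule.on fox_mod.

Definition fox_sc (c : F) (v : fox_mod) : fox_mod :=
  (v.1.1 *m (Bs c)%:M, v.1.2 *m (Bs c)%:M, c *: v.2).
(** The Leibniz rule for multiplication by [z]. The sign for [x] and the weights [1] and [m.-1], the
    latter meaning [-1], are chosen to make [fox_const], built from the last map of the monad,
    multiplicative. *)
Definition fox_z (z : bool) (v : fox_mod) : fox_mod :=
  if z then (v.1.1 *m (Bz true)%:M, v.1.2 *m (Bz true)%:M + E 1 *m map_mx Bs v.2, Ybar q *m v.2)
  else (v.1.1 *m (Bz false)%:M - E m.-1 *m map_mx Bs v.2, v.1.2 *m (Bz false)%:M, Xbar q *m v.2).
Definition fox_g (g : gT) (v : fox_mod) : fox_mod :=
  (v.1.1 *m (Bg g)%:M, v.1.2 *m (Bg g)%:M, G g *m v.2).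

Lemma foxP (u v : fox_mod) : u.1.1 = v.1.1 -> u.1.2 = v.1.2 -> u.2 = v.2 -> u = v.
Proof. by case: u => [[? ?] ?]; case: v => [[? ?] ?] /= -> -> ->. Qed.

Lemma map_BsZr k l c (A : 'M[F]_(k, l)) : map_mx Bs (c *: A) = map_mx Bs A *m (Bs c)%:M.
Proof. by rewrite map_BsZ Bs_mx_comm. Qed.

Lemma eps_expVm g : eps g ^- m.-1 = eps g.
Proof.
have e0 := eps_neq0 eps g; apply: (mulIf (expf_neq0 m.-1 e0)).
by rewrite mulVf ?expf_neq0 // -exprS prednK ?(card_gt0G gT) // eps_expm.
Qed.

Lemma BE_map_G c g (u : 'cV[F]_d) :
  E c *m map_mx Bs (G g *m u) = E c *m map_mx Bs u *m (Bs (eps g ^- c) * Bg g)%:M.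
Proof.
by rewrite map_G !mulmxA BE_BU -[X in X *m _ = _]mulmxA -Bs_mx_comm -mulmxA -scalar_mxM.
Qed.

Lemma mul_Bs_swap (A : 'cV[B]_d) c b :
  A *m (Bs c)%:M *m b%:M = A *m b%:M *m (Bs c)%:M.
Proof. by rewrite -[LHS]mulmxA -[RHS]mulmxA -!scalar_mxM Bs_comm. Qed.

Lemma mul_gz (A : 'cV[B]_d) g z :
  A *m (Bg g)%:M *m (Bz z)%:M =
  A *m (Bz z)%:M *m (Bg g)%:M *m (Bs (if z then (eps g)^-1 else eps g))%:M.
Proof.
rewrite -[LHS]mulmxA -[A *m _ *m (Bg g)%:M]mulmxA -[RHS]mulmxA -!scalar_mxM.
by rewrite Bgz Bs_comm.
Qed.

Lemma fox_axioms : action_axioms eps fox_sc fox_z fox_g.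
Proof.
split.
- by move=> c u v; apply: foxP; [exact: mulmxDl|exact: mulmxDl|exact: scalerDr].
- move=> c e v; apply: foxP; last exact: scalerDl.
    by rewrite /= (rmorphD Bs) (raddfD (@scalar_mx _ 1)) mulmxDr.
  by rewrite /= (rmorphD Bs) (raddfD (@scalar_mx _ 1)) mulmxDr.
- move=> c e v; apply: foxP; last by rewrite /= scalerA.
    by rewrite /= mulrC (rmorphM Bs) scalar_mxM mulmxA.
  by rewrite /= mulrC (rmorphM Bs) scalar_mxM mulmxA.
- move=> v; apply: foxP; last exact: scale1r.
    by rewrite /= (rmorph1 Bs) mulmx1.
  by rewrite /= (rmorph1 Bs) mulmx1.
- move=> [] u v; apply: foxP; try exact: mulmxDr; try exact: mulmxDl.
    by rewrite /= map_mxD mulmxDl mulmxDr addrACA.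
  by rewrite /= map_mxD mulmxDl mulmxDr opprD addrACA.
- by move=> g u v; apply: foxP; [exact: mulmxDl|exact: mulmxDl|exact: mulmxDr].
- move=> [] c v; apply: foxP; try exact: mul_Bs_swap; try by rewrite /= scalemxAr.
    by rewrite /= map_BsZr mul_Bs_swap mulmxA -mulmxDl.
  by rewrite /= map_BsZr mul_Bs_swap mulmxA -mulmxBl.
- by move=> g c v; apply: foxP; try exact: mul_Bs_swap; rewrite /= scalemxAr.
- move=> v; apply: foxP; last by rewrite /= G1 mul1mx.
    by rewrite /= Bg1 mulmx1.
  by rewrite /= Bg1 mulmx1.
- move=> g h v; apply: foxP; last by rewrite /= mulmxA -GM (gT_comm eps).
    by rewrite /= BgM scalar_mxM mulmxA.
  by rewrite /= BgM scalar_mxM mulmxA.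
- move=> g [] v; apply: foxP; try exact: mul_gz.
  + rewrite /= BE_map_G expr1 -Bs_comm scalar_mxM mulmxA mul_gz.
    by rewrite [in RHS](mulmxDl (v.1.2 *m (Bz true)%:M) (E 1 *m map_mx Bs v.2)) [in RHS]mulmxDl.
  + by rewrite /= mulmxA Ybar_equiv -scalemxAl mulmxA.
  + rewrite /= BE_map_G eps_expVm -Bs_comm scalar_mxM mulmxA mul_gz.
    by rewrite [in RHS](mulmxBl (v.1.1 *m (Bz false)%:M) (E m.-1 *m map_mx Bs v.2)) [in RHS]mulmxBl.
  + by rewrite /= mulmxA Xbar_equiv -scalemxAl mulmxA.
Qed.

Notation ax := fox_axioms.
Definition fox_act (a : R) (v : fox_mod) : fox_mod := act fox_sc fox_z fox_g a v.

Lemma fox_act_u a v : (fox_act a v).2 = act_mx q a *m v.2.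
Proof.
elim/crossed_ind: a => [|c a b IHa IHb|a z IH|a g IH].
- by rewrite /fox_act (act1l ax) act_mx1 mul1mx.
- rewrite /fox_act (actDl ax) (actZl ax) -!/(fox_act _ _) (raddfD (act_mx q)) /= act_mxZ.
  by rewrite IHa IHb mulmxDl scalemxAl.
- rewrite /fox_act (act_mul_letter ax) -/(fox_act _ _) act_mxM -mulmxA -IH.
  by case: z; rewrite /= ?act_mx_x ?act_mx_y.
- by rewrite /fox_act (act_mul_g ax) -/(fox_act _ _) act_mxM -mulmxA -IH /= act_mx_g.
Qed.

(** New terms in the derivatives come only from the third component. Once it vanishes, the action is
    right multiplication through [B]; this makes the derivatives [B]-linear on [H0]. *)
Lemma fox_act0 a v : v.2 = 0 ->
  fox_act a v = (v.1.1 *m (pi a)%:M, v.1.2 *m (pi a)%:M, 0).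
Proof.
move=> v0; have H1 : (fox_act a v).1 = (v.1.1 *m (pi a)%:M, v.1.2 *m (pi a)%:M).
  elim/crossed_ind: a => [|c a b IHa IHb|a z IH|a g IH].
  - rewrite /fox_act (act1l ax) (rmorph1 pi) !mulmx1; by case: v v0 => [[]].
  - rewrite /fox_act (actDl ax) (actZl ax) -!/(fox_act _ _) /= IHa IHb /=.
    rewrite (rmorphD pi) /= to_BZ (raddfD (@scalar_mx _ 1)) !mulmxDr.
    by rewrite -!mulmxA -!scalar_mxM Bs_comm.
  - rewrite /fox_act (act_mul_letter ax) -/(fox_act _ _) (rmorphM pi) /= scalar_mxM !mulmxA.
    have u0 : (fox_act a v).2 = 0 by rewrite fox_act_u v0 mulmx0.
    by case: z; rewrite /= u0 map_mx0 mulmx0 ?addr0 ?subr0 IH Bz.unlock.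
  - by rewrite /fox_act (act_mul_g ax) -/(fox_act _ _) (rmorphM pi) /= scalar_mxM !mulmxA IH
    Bg.unlock.
rewrite [LHS]surjective_pairing H1; congr (_, _).
by rewrite fox_act_u v0 mulmx0.
Qed.

Lemma fox_actM a b v : fox_act (a * b) v = fox_act b (fox_act a v).
Proof. exact: (actM ax). Qed.

Definition fox_const (v : fox_mod) : 'cV[B]_d :=
  pX *m v.1.1 - pY *m v.1.2 + E 0 *m map_mx Bs v.2.

(* The fundamental formula of the Fox calculus. *)
Lemma fox_const_act a v : fox_const (fox_act a v) = fox_const v *m (pi a)%:M.
Proof.
elim/crossed_ind: a => [|c a b IHa IHb|a z IH|a g IH].
- by rewrite /fox_act (act1l ax) (rmorph1 pi) mulmx1.
- rewrite /fox_act (actDl ax) (actZl ax) -!/(fox_act _ _) (rmorphD pi) /= to_BZ.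
  rewrite -Bs_comm (raddfD (@scalar_mx _ 1)) /= scalar_mxM mulmxDr mulmxA -IHa -IHb /fox_const /=.
  by rewrite map_mxD map_BsZr; exact: fox_linear.
- rewrite /fox_act (act_mul_letter ax) -/(fox_act _ _) (rmorphM pi) /= scalar_mxM mulmxA -IH.
  move: (fox_act a v) => {IH v} [[v1 v2] u]; rewrite /fox_const.
  have -> : pi (cr_letter eps z) = Bz z by rewrite Bz.unlock.
  case: z => /=.
    rewrite map_mxM; apply: fox_stepY; first exact: BY_BE.
    by rewrite BY.unlock mulmxBl opprB addrC subrK map_Bs_comm.
  rewrite map_mxM; apply: fox_stepX; first by rewrite BX_BE (prednK (card_gt0G gT)) BEm.
  by rewrite BX.unlock mulmxBl opprB addrC subrK map_Bs_comm.
- rewrite /fox_act (act_mul_g ax) -/(fox_act _ _) (rmorphM pi) /= scalar_mxM mulmxA -IH.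
  move: (fox_act a v) => {IH v} [[v1 v2] u]; rewrite /fox_const /=.
  have -> : pi (cr_g eps g) = Bg g by rewrite Bg.unlock.
  by rewrite BE_map_G expr0 invr1 (rmorph1 Bs) mul1r; exact: fox_mulr.
Qed.

End FoxDerivatives.

(** * Fox derivatives of the relators *)

Lemma rel_first (S : pzRingType) d (P M A : 'M[S]_d) (v u : 'cV[S]_d) (x y t : 'M[S]_1) :
  x *m y - y *m x = t -> A *m u - M *m u = u *m y ->
  (v *m x - P *m u) *m y - (v *m y *m x - P *m (A *m u)) - v *m t = P *m (M *m u).
Proof.
move=> <- Au; rewrite mulmxBl mulmxBr -!mulmxA -Au mulmxBr !opprB.
move: (v *m (x *m y)) (v *m (y *m x)) (P *m (A *m u)) (P *m (M *m u)) => a b c e.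
by rewrite !addrA [LHS](ACl (2*(1*7)*(3*4)*(5*6)))%AC /= subrr !addNr !addr0.
Qed.

Lemma rel_second (S : pzRingType) d (P M A : 'M[S]_d) (v u : 'cV[S]_d) (x y t : 'M[S]_1) :
  x *m y - y *m x = t -> A *m u - M *m u = u *m x ->
  (v *m x *m y + P *m (A *m u)) - (v *m y + P *m u) *m x - v *m t = P *m (M *m u).
Proof.
move=> <- Au; rewrite mulmxDl mulmxBr -!mulmxA -Au mulmxBr opprB.
move: (v *m (x *m y)) (v *m (y *m x)) (P *m (A *m u)) (P *m (M *m u)) => a b c e.
by rewrite !opprD opprK !addrA [LHS](ACl (5*(1*7)*(2*4)*(3*6)))%AC /= !subrr addNr !addr0.
Qed.

Section FoxRelators.
Variables (F : numClosedFieldType) (gT : finGroupType) (eps : primitive_char F gT).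
Variables (tau : {ffun gT -> F}) (n d : nat) (q : quadruple eps tau n d).
Notation R := (crossed eps).
Notation B := (Btau eps tau).
Notation m := #|gT|.
Notation Bs := (Bs eps tau).
Notation Bz := (Bz eps tau).
Notation Bg := (Bg eps tau).
Notation Be := (Be eps tau).
Notation G := (Gbar q).
Notation pX := (BX q).
Notation pY := (BY q).
Notation vi := (Bi q).
Notation vj := (Bj q).
Notation U := (BU q).
Notation E := (BE q).
Notation pi := (to_B eps tau).
Notation ax := (fox_axioms q).

Lemma fox_act_tau (v : fox_mod eps tau d) :
  fox_act q (cr_tau eps tau) v =
  (v.1.1 *m (pi (cr_tau eps tau))%:M, v.1.2 *m (pi (cr_tau eps tau))%:M,
   (\sum_g tau g *: G g) *m v.2).
Proof.
have HS : forall (h : gT -> F), fox_act q (\sum_g h g *: cr_g eps g) v =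
  (v.1.1 *m (pi (\sum_g h g *: cr_g eps g))%:M, v.1.2 *m (pi (\sum_g h g *: cr_g eps g))%:M,
   (\sum_g h g *: G g) *m v.2).
  move=> h; pose K a (M : 'M[F]_d) :=
    fox_act q a v = (v.1.1 *m (pi a)%:M, v.1.2 *m (pi a)%:M, M *m v.2).
  rewrite -/(K _ _); apply: (big_rec2 K); rewrite /K.
    by rewrite /fox_act (act0l ax) (rmorph0 pi) (raddf0 (@scalar_mx _ 1)) !mulmx0 mul0mx.
  move=> g a M _ IH; rewrite /fox_act (actDl ax) (actZl ax) -!/(fox_act _ _ _) IH.
  rewrite (rmorphD pi) /= to_BZ (raddfD (@scalar_mx _ 1)) -Bs_comm /= scalar_mxM !mulmxDr !mulmxA.
  have -> : fox_act q (cr_g eps g) v = fox_g q g v by rewrite /fox_act (act_g ax).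
  have -> : pi (cr_g eps g) = Bg g by rewrite Bg.unlock.
  by rewrite mulmxDl -scalemxAl.
exact: HS.
Qed.

(** The terms in the old derivatives cancel by the relation of [B]. The mixed terms leave
    [Y u - u y = (Y - y) u] and [X u - u x = (X - x) u], behind projectors that become [E 0] after
    passing the pencils. *)
Lemma fox_act_rel (v : fox_mod eps tau d) :
  fox_act q (cr_rel eps tau) v =
  (pY *m (E 0 *m map_mx Bs v.2), pX *m (E 0 *m map_mx Bs v.2), - (ibar q *m (jbar q *m v.2))).
Proof.
have relB : (Bz false)%:M *m (Bz true)%:M - (Bz true)%:M *m (Bz false)%:M =
  (pi (cr_tau eps tau))%:M :> 'M[B]_1.
  by rewrite -Btau_rel (raddfB (@scalar_mx _ 1)) /= !scalar_mxM.
have fz z (u : fox_mod eps tau d) : fox_act q (cr_letter eps z) u = fox_z q z u.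
  by rewrite /fox_act (act_letter ax).
have -> : fox_act q (cr_rel eps tau) v =
    fox_z q true (fox_z q false v) - fox_z q false (fox_z q true v) - fox_act q (cr_tau eps tau) v.
  rewrite -!fz -2!fox_actM /fox_act -!(actNl ax) -!(actDl ax).
  by congr (act _ _ _ _ _).
rewrite fox_act_tau; apply: foxP => /=.
- rewrite map_mxM (rel_first _ _ relB (M := pY)); last first.
    by rewrite BY.unlock mulmxBl opprB addrC subrK map_Bs_comm.
  by rewrite !mulmxA -BY_BE (prednK (card_gt0G gT)) BEm.
- rewrite map_mxM (rel_second _ _ relB (M := pX)); last first.
    by rewrite BX.unlock mulmxBl opprB addrC subrK map_Bs_comm.
  by rewrite !mulmxA BX_BE.
- rewrite [X in _ = - X]mulmxA -quad_rel !mulmxA !mulmxDl mulNmx opprD opprB.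
  by [].
Qed.

Definition fox (a : R) : fox_mod eps tau d := fox_act q a (0, 0, ibar q).
Definition fox1 a : 'cV[B]_d := (fox a).1.1.
Definition fox2 a : 'cV[B]_d := (fox a).1.2.

Lemma fox_u a : (fox a).2 = act_mx q a *m ibar q.
Proof. exact: fox_act_u. Qed.

Lemma fox_mul a b : fox (a * b) = fox_act q b (fox a).
Proof. exact: fox_actM. Qed.

Lemma foxDZ c a b : fox (c *: a + b) = fox_sc c (fox a) + fox b.
Proof. by rewrite /fox /fox_act (actDl ax) (actZl ax). Qed.

Lemma fox1D a b : fox1 (a + b) = fox1 a + fox1 b.
Proof. by rewrite /fox1 /fox /fox_act (actDl ax). Qed.

Lemma fox1N a : fox1 (- a) = - fox1 a.
Proof. by rewrite /fox1 /fox /fox_act (actNl ax). Qed.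

Lemma fox_letter a z : fox (a * cr_letter eps z) = fox_z q z (fox a).
Proof. by rewrite /fox /fox_act (act_mul_letter ax). Qed.

Lemma fox_gr a g : fox (a * cr_g eps g) = fox_g q g (fox a).
Proof. by rewrite /fox /fox_act (act_mul_g ax). Qed.

Lemma fox_equiv a : E m.-1 *m fox1 a = fox1 a /\ E 1 *m fox2 a = fox2 a.
Proof.
rewrite /fox1 /fox2; elim/crossed_ind: a => [|c a b [IHa1 IHa2] [IHb1 IHb2]|a z [IH1 IH2]|a g
  [IH1 IH2]].
- by rewrite /fox /fox_act (act1l ax) /= !mulmx0.
- by rewrite foxDZ /= !mulmxDr !mulmxA IHa1 IHa2 IHb1 IHb2.
- rewrite fox_letter; case: z => /=.
    by rewrite mulmxDr !mulmxA IH1 IH2 BE_idem.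
  by rewrite mulmxBr !mulmxA IH1 IH2 BE_idem.
- by rewrite fox_gr /= !mulmxA IH1 IH2.
Qed.

(** The derivatives of [a] and [e_n a] satisfy the cycle condition up to the projection by [E 0] of
    the vector [i.a], which is [d_L] of the class of [a] and so vanishes on [H0]. *)
Lemma fox_fundamental a :
  pX *m fox1 a - pY *m fox2 a + E 0 *m map_mx Bs (act_mx q a *m ibar q) =
  vi *m (Be n * pi a)%:M.
Proof.
rewrite -fox_u [LHS](fox_const_act q a (0, 0, ibar q)) /fox_const /= !mulmx0 subrr add0r.
by rewrite scalar_mxM mulmxA -BE_Bi Bi.unlock.
Qed.

(** The summand [lambda a] contributes [lambda(a) i], cancelling the third component [- i j (i.a)];
    the rest is the boundary of [E 0 (i.a)] without its last component. *)
Lemma fox_relator a : fox (a * cr_rel eps tau + (lambda q a)%:A) =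
  (pY *m (E 0 *m map_mx Bs (act_mx q a *m ibar q)),
   pX *m (E 0 *m map_mx Bs (act_mx q a *m ibar q)), 0).
Proof.
rewrite addrC foxDZ fox_mul fox_act_rel fox_u.
have -> : fox 1 = (0, 0, ibar q) by rewrite /fox /fox_act (act1l ax).
apply: foxP; rewrite /= ?mul0mx ?add0r //.
rewrite /lambda; move: (jbar q *m _) => w.
by rewrite [w]mx11_scalar mul_mx_scalar mxE eqxx mulr1n subrr.
Qed.

Lemma fox_killed a b : act_mx q a *m ibar q = 0 ->
  fox (a * b) = (fox1 a *m (pi b)%:M, fox2 a *m (pi b)%:M, 0).
Proof. by move=> a0; rewrite fox_mul fox_act0 // fox_u. Qed.

Lemma fox_gamma g : fox (cr_g eps g - (eps g ^+ n)%:A) = 0.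
Proof.
rewrite addrC -scaleNr foxDZ -[cr_g eps g]mul1r fox_gr.
have -> : fox 1 = (0, 0, ibar q) by rewrite /fox /fox_act (act1l ax).
apply: foxP; rewrite /= ?mul0mx ?add0r //.
by rewrite ibar_equiv scaleNr addNr.
Qed.

End FoxRelators.

(** * The embedding of [H^0] into the ring of quotients *)

Section FractionalEmbedding.
Variables (F : numClosedFieldType) (gT : finGroupType) (eps : primitive_char F gT).
Variables (tau : {ffun gT -> F}) (Q : unitRingType).
Variables (iota : {rmorphism Btau eps tau -> Q}).
Variables (n d : nat) (q : quadruple eps tau n d).
Notation R := (crossed eps).
Notation B := (Btau eps tau).
Notation m := #|gT|.
Notation Bs := (Bs eps tau).
Notation Bz := (Bz eps tau).
Notation Bg := (Bg eps tau).
Notation Be := (Be eps tau).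
Notation pX := (BX q).
Notation pY := (BY q).
Notation vi := (Bi q).
Notation vj := (Bj q).
Notation E := (BE q).
Notation pi := (to_B eps tau).
Notation mp := (map_mx iota).

Lemma X_pencilE : X_pencil iota q = mp pX.
Proof.
rewrite BX.unlock map_mxB map_scalar_mx; congr (_ - _); last first.
  by rewrite Bz.unlock.
by apply/matrixP => i j; rewrite !mxE Bs.unlock.
Qed.

Lemma Y_pencilE : Y_pencil iota q = mp pY.
Proof.
rewrite BY.unlock map_mxB map_scalar_mx; congr (_ - _); last first.
  by rewrite Bz.unlock.
by apply/matrixP => i j; rewrite !mxE Bs.unlock.
Qed.

Lemma scalarQ_iE : map_mx (scalarQ iota) (ibar q) = mp vi.
Proof. by apply/matrixP => i j; rewrite Bi.unlock !mxE Bs.unlock. Qed.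

Lemma scalarQ_jE : map_mx (scalarQ iota) (jbar q) = mp vj.
Proof. by apply/matrixP => i j; rewrite Bj.unlock !mxE Bs.unlock. Qed.

Variables Xinv Yinv : 'M[Q]_d.
Hypotheses (XinvP : mutually_inverse (mp pX) Xinv) (YinvP : mutually_inverse (mp pY) Yinv).

Definition psi (v1 : 'cV[B]_d) (w : B) : Q := iota w - (mp vj *m Yinv *m mp v1) 0 0.

Lemma psiD u v w x : psi (u + v) (w + x) = psi u w + psi v x.
Proof. by rewrite /psi (rmorphD iota) map_mxD mulmxDr mxE opprD addrACA. Qed.

Lemma psiN u w : psi (- u) (- w) = - psi u w.
Proof. by rewrite /psi (rmorphN iota) map_mxN mulmxN mxE opprB opprK addrC. Qed.

Lemma psiB u v w x : psi (u - v) (w - x) = psi u w - psi v x.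
Proof. by rewrite psiD psiN. Qed.

Lemma mulmx_scalar_col (S : pzRingType) k (A : 'M[S]_(k, 1)) b i :
  (A *m b%:M) i 0 = A i 0 * b.
Proof. by rewrite mxE big_ord1 mxE eqxx mulr1n. Qed.

Lemma psiM u w b : psi (u *m b%:M) (w * b) = psi u w * iota b.
Proof.
by rewrite /psi map_mxM map_scalar_mx mulmxA mulmx_scalar_col (rmorphM iota) mulrBl.
Qed.

Lemma psi_alpha c : psi (pY *m c) ((vj *m c) 0 0) = 0.
Proof.
have [_ YY] := YinvP; rewrite /psi map_mxM !mulmxA -(mulmxA (mp vj)) YY mulmx1 -map_mxM.
by rewrite [X in _ - X]mxE subrr.
Qed.

(* [phi a = e_n a - j (Y - y)^-1 v1(a)], with [v1] the Fox derivative along [x]. *)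
Definition phi (a : R) : Q := psi (fox1 q a) (Be n * pi a).

Lemma phiD a b : phi (a + b) = phi a + phi b.
Proof. by rewrite /phi fox1D (rmorphD pi) mulrDr psiD. Qed.

Lemma phiN a : phi (- a) = - phi a.
Proof. by rewrite /phi fox1N (rmorphN pi) mulrN psiN. Qed.

Lemma phi_mul a b : act_mx q a *m ibar q = 0 -> phi (a * b) = phi a * iota (pi b).
Proof.
by move=> a0; rewrite /phi /fox1 fox_killed //= (rmorphM pi) mulrA psiM.
Qed.

Lemma pi_rel : pi (cr_rel eps tau) = 0.
Proof.
rewrite -(rmorph0 pi); apply/to_quot_eq; rewrite subr0 -[X in ideal2 _ X]mul1r -[X in ideal2
  _ X]mulr1.
exact: Ideal2Gen.
Qed.

(** For the second kind of relator, the last component [e_n lambda(b)] equals [j E 0 (i.b)], which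
    completes the boundary, and [psi] kills boundaries. For the first kind, both the derivatives and
    [e_n (g - eps(g)^n)] vanish. *)
Lemma phi_relator a : L0_relator q a -> phi a = 0.
Proof.
case=> [g|b]; rewrite /phi.
  have -> : fox1 q (cr_g eps g - (eps g ^+ n)%:A) = 0 by rewrite /fox1 fox_gamma.
  have -> : Be n * pi (cr_g eps g - (eps g ^+ n)%:A) = 0.
    rewrite Be.unlock -(rmorphM pi) mulrBr cr_idem_mulg cr_scale_mulA mulr1 subrr.
    exact: (rmorph0 pi).
  by rewrite /psi (rmorph0 iota) map_mx0 mulmx0 mxE subrr.
rewrite /fox1 fox_relator /=; set c := E 0 *m _.
rewrite -(psi_alpha c); congr psi.
rewrite (rmorphD pi) (rmorphM pi) /= pi_rel mulr0 add0r /c mulmxA Bj_BE -mulmxA mul_scalar_mx mxE.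
congr (_ * _); rewrite Bj.unlock -map_mxM /lambda.
by move: (jbar q *m _) => e; transitivity (Bs (e 0 0)); [rewrite Bs.unlock | rewrite mxE].
Qed.

Lemma phi_rspan a : rspan (L0_relator q) a -> phi a = 0.
Proof.
elim=> [s b Hs||u v _ IHu _ IHv].
- by rewrite phi_mul ?phi_relator ?mul0r //; exact: act_mx_relator.
- by rewrite /phi /fox1 /fox /fox_act (act0l (fox_axioms q)) /= (rmorph0 pi) mulr0
    /psi (rmorph0 iota) map_mx0 mulmx0 mxE subrr.
- by rewrite phiD IHu IHv addr0.
Qed.

Lemma phi_congr a b : to_cyc (L0_relator q) a = to_cyc (L0_relator q) b -> phi a = phi b.
Proof.
by move/to_cyc_eq/phi_rspan; rewrite phiD phiN => /eqP; rewrite subr_eq0 => /eqP.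
Qed.

Lemma horner_letter_step z p c : horner_alg (cr_letter eps z) (p * 'X + c%:P) =
  c *: 1 + horner_alg (cr_letter eps z) p * cr_letter eps z.
Proof. by rewrite rmorphD rmorphM /= horner_algX horner_algC addrC. Qed.

Lemma fox1_polyY p : fox1 q (horner_alg (cr_letter eps true) p) = 0.
Proof.
elim/poly_ind: p => [|p c IH].
  by rewrite rmorph0 /fox1 /fox /fox_act (act0l (fox_axioms q)).
rewrite horner_letter_step /fox1 foxDZ fox_letter /=.
by rewrite {1}/fox /fox_act (act1l (fox_axioms q)) -/(fox1 q _) IH !mul0mx addr0.
Qed.

Lemma fox2_polyX p : fox2 q (horner_alg (cr_letter eps false) p) = 0.
Proof.
elim/poly_ind: p => [|p c IH].
  by rewrite rmorph0 /fox2 /fox /fox_act (act0l (fox_axioms q)).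
rewrite horner_letter_step /fox2 foxDZ fox_letter /=.
by rewrite {1}/fox /fox_act (act1l (fox_axioms q)) -/(fox2 q _) IH !mul0mx addr0.
Qed.

Lemma act_mx_letter z : act_mx q (cr_letter eps z) = if z then Ybar q else Xbar q.
Proof. by case: z; rewrite ?act_mx_y ?act_mx_x. Qed.

Lemma act_mx_charpoly z p : char_poly (if z then Ybar q else Xbar q) %| p ->
  act_mx q (horner_alg (cr_letter eps z) p) *m ibar q = 0.
Proof.
set A := if z then _ else _; have : act_mx q (cr_letter eps z) = A := act_mx_letter z.
have fD a b : act_mx q (a + b) = act_mx q a + act_mx q b := raddfD (act_mx q) a b.
(* Evaluating a polynomial at a matrix takes a positive size; generalizing over the action allows
   the case distinction on [d]. *)
move: (act_mx q) A (ibar q) (act_mx1 q) (act_mxM q) (act_mxZ q)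
  fD.
case: d => [|d'] f A v f1 fM fZ {}fD fA Hp; first by rewrite [LHS]flatmx0.
have -> : f (horner_alg (cr_letter eps z) p) = horner_mx A p.
  elim/poly_ind: p {Hp} => [|p c IH].
    by rewrite !rmorph0 -(scale0r (0 : R)) fZ scale0r.
  have lin a b : f (a * cr_letter eps z + b) = A *m f a + f b.
    by rewrite fD fM fA.
  rewrite horner_letter_step addrC lin IH fZ f1.
  by rewrite (mulrC p) rmorphD rmorphM /= horner_mx_X horner_mx_C scale_scalar_mx mulr1.
by have /dvdpP[r ->] := Hp; rewrite rmorphM /= Cayley_Hamilton mulr0 mul0mx.
Qed.

Lemma phi_polyY p : phi (horner_alg (cr_letter eps true) p) =
  iota (Be n) * polyQ iota true p.
Proof.
by rewrite /phi fox1_polyY /psi map_mx0 mulmx0 mxE subr0 (rmorphM iota).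
Qed.

Lemma inv_twist (T : pzRingType) k (M M' P P' : 'M[T]_k) :
  mutually_inverse M M' -> M *m P = P' *m M -> M' *m P' = P *m M'.
Proof.
move=> [MM' M'M] H; rewrite -[LHS]mulmx1 -MM' -mulmxA (mulmxA P') -H.
by rewrite -(mulmxA M) mulmxA M'M mul1mx.
Qed.

(** [(X - x)^-1] lowers the weight by one and [(Y - y)^-1] raises it back, while [i] and [j]
    exchange [e_n] with the projector [E 0]. *)
Lemma kappa_idem : kappa iota q Xinv Yinv * iota (Be n) = iota (Be n) * kappa iota q Xinv Yinv.
Proof.
rewrite /kappa mulrBl mulrBr mul1r mulr1; congr (_ - _).
rewrite scalarQ_iE scalarQ_jE -mulmx_scalar_col.
have -> : iota (Be n) * (mp vj *m Yinv *m Xinv *m mp vi) 0 0 =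
    ((iota (Be n))%:M *m (mp vj *m Yinv *m Xinv *m mp vi)) 0 0.
  by rewrite mul_scalar_mx [RHS]mxE.
have XE := inv_twist XinvP (etrans (esym (map_mxM iota pX (E m.-1)))
  (etrans (congr1 mp (BX_BE q m.-1)) (map_mxM iota _ pX))).
have YE := inv_twist YinvP (etrans (esym (map_mxM iota pY (E m.-1.+1)))
  (etrans (congr1 mp (BY_BE q m.-1)) (map_mxM iota _ pY))).
have Em : E m.-1.+1 = E 0 by rewrite (prednK (card_gt0G gT)) BEm.
rewrite {}Em in XE YE; rewrite -map_scalar_mx.
have iE : mp vi *m mp (Be n)%:M = mp (E 0) *m mp vi.
  by rewrite -[LHS]map_mxM -[RHS]map_mxM BE_Bi.
have jE : mp (Be n)%:M *m mp vj = mp vj *m mp (E 0).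
  by rewrite -[LHS]map_mxM -[RHS]map_mxM Bj_BE.
have -> : mp vj *m Yinv *m Xinv *m mp vi *m mp (Be n)%:M =
    mp vj *m (Yinv *m (Xinv *m mp (E 0))) *m mp vi.
  by rewrite -[LHS]mulmxA iE !mulmxA.
by rewrite XE [Yinv *m _]mulmxA YE !mulmxA jE.
Qed.

(** There is no derivative along [y], and [p(X) = 0], so the fundamental formula reads
    [(X - x) v1 = i e_n p(x)]. Solving for [v1] produces [kappa]. *)
Lemma phi_polyX p : char_poly (Xbar q) %| p -> phi (horner_alg (cr_letter eps false) p) =
  iota (Be n) * kappa iota q Xinv Yinv * polyQ iota false p.
Proof.
move=> Hp; have := fox_fundamental q (horner_alg (cr_letter eps false) p).
rewrite fox2_polyX mulmx0 subr0 (act_mx_charpoly (z := false) Hp) map_mx0 mulmx0 addr0.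
move/(congr1 (fun A => Xinv *m mp A)); have [_ XX] := XinvP.
rewrite !map_mxM mulmxA XX mul1mx /phi /psi => ->.
rewrite !mulmxA map_scalar_mx mulmx_scalar_col (rmorphM iota) -kappa_idem /kappa.
by rewrite scalarQ_iE scalarQ_jE !mulrBl !mul1r !mulrA.
Qed.

End FractionalEmbedding.

(** * Normal forms modulo a right ideal *)

Lemma delta_sum (K : pzRingType) (V : lmodType K) k (b : 'I_k -> V) i0 c :
  \sum_i (c * (i == i0)%:R) *: b i = c *: b i0.
Proof.
rewrite (bigD1 i0) //= big1 ?addr0 => [|i /negPf ne]; first by rewrite eqxx mulr1.
by rewrite ne mulr0 scale0r.
Qed.

Section DegreeReduction.
Variables (F : fieldType) (gT : finGroupType) (eps : primitive_char F gT).
Variables (tau : {ffun gT -> F}) (n : nat).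
Notation R := (crossed eps).
Notation cx := (cr_letter eps false).
Notation cy := (cr_letter eps true).

Lemma cr_g_swap g z : exists w, cr_letter eps z * cr_g eps g = w *: (cr_g eps g * cr_letter eps z).
Proof.
case: z; [exists (eps g)|exists (eps g)^-1]; rewrite ?cr_gx ?cr_gy scalerA;
  by rewrite ?mulVf ?mulfV ?eps_neq0 // scale1r.
Qed.

Lemma cr_g_swapX g z k : exists w, cr_letter eps z ^+ k * cr_g eps g = w *: (cr_g eps g *
  cr_letter eps z ^+ k).
Proof.
elim: k => [|k [w IH]]; first by exists 1; rewrite mul1r mulr1 scale1r.
have [w' E] := cr_g_swap g z; exists (w' * w).
rewrite exprSr -mulrA E cr_scale_mulA mulrA IH -scalerAl scalerA -mulrA.
by congr (_ *: _).
Qed.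

Inductive normal_lt (D : nat) : R -> Prop :=
| NormalLt0 : normal_lt D 0
| NormalLtD c k l a : (k + l < D)%N -> normal_lt D a ->
    normal_lt D (c *: (cy ^+ k * cx ^+ l) + a).

Lemma normal_lt_add D a b : normal_lt D a -> normal_lt D b -> normal_lt D (a + b).
Proof.
by elim=> [|c k l a' lt _ IH] Hb; rewrite ?add0r // -addrA; apply: NormalLtD => //; exact: IH.
Qed.

Lemma normal_lt_scale D c a : normal_lt D a -> normal_lt D (c *: a).
Proof.
elim=> [|c' k l a' lt _ IH]; first by rewrite scaler0; exact: NormalLt0.
by rewrite scalerDr scalerA; exact: NormalLtD.
Qed.

Lemma normal_lt_monomial D k l : (k + l < D)%N -> normal_lt D (cy ^+ k * cx ^+ l).
Proof.
by move=> lt; rewrite -[X in normal_lt _ X]addr0 -[X in X + _]scale1r; apply: NormalLtD lt _;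
  exact: NormalLt0.
Qed.

Lemma normal_ltW D D' a : (D <= D')%N -> normal_lt D a -> normal_lt D' a.
Proof.
move=> le; elim=> [|c k l b lt _ IH]; first exact: NormalLt0.
by apply: NormalLtD => //; exact: leq_trans lt le.
Qed.

Variable N : R -> Prop.
Hypothesis N0 : N 0.
Hypothesis ND : forall a b, N a -> N b -> N (a + b).
Hypothesis NM : forall a b, N a -> N (a * b).
Hypothesis Ngamma : forall g, N (cr_g eps g - (eps g ^+ n)%:A).
Hypothesis Nrel : forall a, exists c : F, N (a * cr_rel eps tau + c%:A).

Lemma right_ideal_scale c a : N a -> N (c *: a).
Proof. by move=> Ha; rewrite -[a]mulr1 -cr_scale_mulA; exact: NM. Qed.

(* Modulo [N], [a] is a combination of monomials [y^k x^l] with [k + l < D]. *)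
Definition low D a := exists2 r, normal_lt D r & N (a - r).

Lemma low_normal D r : normal_lt D r -> low D r.
Proof. by exists r => //; rewrite subrr. Qed.

Lemma low0 D : low D 0. Proof. exact/low_normal/NormalLt0. Qed.

Lemma lowD D a b : low D a -> low D b -> low D (a + b).
Proof.
move=> [r Hr Ha] [s Hs Hb]; exists (r + s); first exact: normal_lt_add.
by rewrite opprD addrACA; exact: ND.
Qed.

Lemma lowZ D c a : low D a -> low D (c *: a).
Proof.
move=> [r Hr Ha]; exists (c *: r); first exact: normal_lt_scale.
by rewrite -scalerBr; exact: right_ideal_scale.
Qed.

Lemma lowB D a b : low D a -> low D b -> low D (a - b).
Proof. by move=> Ha Hb; rewrite -scaleN1r; apply: lowD => //; exact: lowZ. Qed.

Lemma low_sum D (I : Type) (r : seq I) (f : I -> R) :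
  (forall i, low D (f i)) -> low D (\sum_(i <- r) f i).
Proof. by move=> H; elim/big_ind: _ => // [|u v]; [exact: low0|exact: lowD]. Qed.

Lemma lowW D D' a : (D <= D')%N -> low D a -> low D' a.
Proof. by move=> le [r Hr Ha]; exists r => //; exact: normal_ltW Hr. Qed.

Lemma low_N D a : N a -> low D a.
Proof. by exists 0; [exact: NormalLt0 | rewrite subr0]. Qed.

Lemma low_monomial D k l : (k + l < D)%N -> low D (cy ^+ k * cx ^+ l).
Proof. by move=> lt; exact/low_normal/normal_lt_monomial. Qed.

Lemma low_const D c : (0 < D)%N -> low D c%:A.
Proof.
by move=> D0; have := @low_monomial D 0 0 D0; rewrite mulr1 => H; exact: lowZ.
Qed.

Lemma low_linear D D' b : (forall k l, (k + l < D)%N -> low D' (cy ^+ k * cx ^+ l * b)) ->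
  forall a, low D a -> low D' (a * b).
Proof.
move=> H a [r Hr Ha]; rewrite -[a](subrK r) mulrDl; apply: lowD.
  exact/low_N/NM.
elim: Hr {Ha} => [|c k l a' lt _ IH]; first by rewrite mul0r; exact: low0.
by rewrite mulrDl -scalerAl; apply: lowD => //; apply: lowZ; exact: H.
Qed.

Lemma low_x D a : low D a -> low D.+1 (a * cx).
Proof.
apply: low_linear => k l lt; rewrite -mulrA -exprSr.
by apply: low_monomial; rewrite addnS.
Qed.

Lemma low_xX D e a : low D a -> low (D + e) (a * cx ^+ e).
Proof.
move=> Ha; elim: e => [|e IH]; first by rewrite addn0 mulr1.
by rewrite exprSr mulrA addnS; exact: low_x.
Qed.

Lemma low_g D a g : low D a -> low D (a * cr_g eps g).
Proof.
apply: low_linear => k l lt; have [w E1] := cr_g_swapX g false l; have [w' E2] := cr_g_swapX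
  g true k.
rewrite -mulrA E1 cr_scale_mulA mulrA E2 -scalerAl scalerA; apply: lowZ.
rewrite -[X in low _ X](subrK (eps g ^+ n *: (cy ^+ k * cx ^+ l))); apply: lowD.
  have -> : cr_g eps g * cy ^+ k * cx ^+ l - eps g ^+ n *: (cy ^+ k * cx ^+ l) =
      (cr_g eps g - (eps g ^+ n)%:A) * (cy ^+ k * cx ^+ l).
    by rewrite mulrBl -scalerAl mul1r mulrA.
  exact/low_N/NM/Ngamma.
exact/lowZ/low_monomial.
Qed.

(** Modulo [N], [a (xy - yx)] is [a tau] plus a constant, so moving [y] across powers of [x] lowers
    the total degree by at least two. *)
Lemma low_y_swap k l : low (k + l) (cy ^+ k * cx ^+ l * cy - cy ^+ k.+1 * cx ^+ l).
Proof.
elim: l => [|l IH]; first by rewrite !expr0 !mulr1 -exprSr subrr; exact: low0.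
set a' := cy ^+ k * cx ^+ l in IH *.
have -> : cy ^+ k * cx ^+ l.+1 * cy - cy ^+ k.+1 * cx ^+ l.+1 =
    a' * cr_rel eps tau + (a' * cy - cy ^+ k.+1 * cx ^+ l) * cx + a' * cr_tau eps tau.
  rewrite [cx ^+ l.+1]exprSr /cr_rel /a' mulrBl !mulrBr !mulrA.
  by rewrite addrAC subrK addrA subrK.
apply: lowD; [apply: lowD|].
- have [c Hc] := Nrel a'; rewrite -[X in low _ X](addrK c%:A); apply: lowB; first exact: low_N.
  by apply: low_const; rewrite addnS.
- by rewrite addnS; exact: low_x.
- rewrite mulr_sumr; apply: low_sum => g; rewrite cr_scale_mulA; apply: lowZ.
  by apply/low_g/low_monomial; rewrite addnS.
Qed.

Lemma low_y D a : low D a -> low D.+1 (a * cy).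
Proof.
apply: low_linear => k l lt; rewrite -[X in low _ X](subrK (cy ^+ k.+1 * cx ^+ l)).
apply: lowD; last exact: low_monomial.
by apply: lowW (low_y_swap k l); rewrite ltnW // ltnW.
Qed.

Lemma low_swap e k l : low (k + e + l) (cx ^+ e * cy ^+ k * cx ^+ l - cy ^+ k * cx ^+ (e + l)).
Proof.
rewrite exprD [X in _ - X]mulrA -mulrBl; apply: low_xX.
elim: k => [|k IH]; first by rewrite expr0 mulr1 mul1r subrr; exact: low0.
have -> : cx ^+ e * cy ^+ k.+1 - cy ^+ k.+1 * cx ^+ e =
    (cx ^+ e * cy ^+ k - cy ^+ k * cx ^+ e) * cy +
    (cy ^+ k * cx ^+ e * cy - cy ^+ k.+1 * cx ^+ e).
  by rewrite [in X in X - _ = _]exprSr mulrBl !mulrA addrA subrK.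
apply: lowD; first exact: low_y.
exact: lowW (leqnSn _) (low_y_swap k e).
Qed.

Lemma low_all a : exists D, low D a.
Proof.
elim/crossed_ind: a => [|c a b [D IHa] [D' IHb]|a [] [D IH]|a g [D IH]].
- by exists 1%N; rewrite -(scale1r 1); exact: low_const.
- exists (maxn D D'); apply: lowD; first by apply/lowZ/(lowW _ IHa)/leq_maxl.
  exact/(lowW _ IHb)/leq_maxr.
- by exists D.+1; exact: low_y.
- by exists D.+1; exact: low_x.
- by exists D; exact: low_g.
Qed.

Variables (d : nat) (p : bool -> {poly F}).
Hypothesis p_monic : forall z, p z \is monic.
Hypothesis p_size : forall z, size (p z) = d.+1.
Hypothesis Np : forall z, N (horner_alg (cr_letter eps z) (p z)).

Lemma low_leading z D b : (forall j, (j < d)%N -> low D (cr_letter eps z ^+ j * b)) ->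
  low D (cr_letter eps z ^+ d * b).
Proof.
move=> H; have [f Ef] : exists f : nat -> F, p z = \sum_(j < d) f j *: 'X^j + 'X^d.
  exists (fun j => (p z)`_j); rewrite -[LHS]coefK poly_def p_size big_ord_recr /=.
  have -> : (p z)`_d = 1.
    by have := p_monic z; rewrite monicE lead_coefE p_size => /eqP.
  by rewrite scale1r.
have E : horner_alg (cr_letter eps z) (p z) =
    \sum_(j < d) f j *: cr_letter eps z ^+ j + cr_letter eps z ^+ d.
  rewrite Ef rmorphD raddf_sum rmorphXn /= horner_algX; congr (_ + _).
  apply: eq_bigr => j _; rewrite /= -mul_polyC rmorphM rmorphXn /= horner_algC horner_algX.
  by rewrite -scalerAl mul1r.
have : low D (horner_alg (cr_letter eps z) (p z) * b) by exact/low_N/NM.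
rewrite E mulrDl => H1; rewrite -[X in low _ X](addKr ((\sum_(j < d) f j *: cr_letter eps z
  ^+ j) * b)).
rewrite addrC; apply: lowB => //; rewrite mulr_suml; apply: low_sum => j.
by rewrite -scalerAl; apply: lowZ; exact: H.
Qed.

(** [N] is a right ideal, so the polynomial in a letter reduces only powers standing on the far
    left. As [k + l] is at least [2 d], one exponent is at least [d]; a power of [x] is first
    brought to the left, up to lower degree. *)
Lemma low_step D k l : (2 * d <= D)%N -> k + l = D -> low D (cy ^+ k * cx ^+ l).
Proof.
move=> leD kl; have [ledk|ltkd] := leqP d k.
  rewrite -(subnKC ledk) exprD -mulrA; apply: low_leading => j ltj.
  by rewrite mulrA -exprD; apply: low_monomial; lia.
have ledl : (d <= l)%N by lia.
have -> : cy ^+ k * cx ^+ l = cx ^+ d * (cy ^+ k * cx ^+ (l - d)) -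
    (cx ^+ d * cy ^+ k * cx ^+ (l - d) - cy ^+ k * cx ^+ (d + (l - d))).
  by rewrite opprB mulrA addrC subrK subnKC.
apply: lowB; last by apply: lowW (low_swap d k (l - d)); lia.
apply: low_leading => j ltj.
rewrite mulrA -[X in low _ X](subrK (cy ^+ k * cx ^+ (j + (l - d)))); apply: lowD.
  by apply: lowW (low_swap j k (l - d)); lia.
by apply: low_monomial; lia.
Qed.

Lemma low_bounded a : low (2 * d) a.
Proof.
have [D] := low_all a; have [le|/ltnW le] := leqP D (2 * d); first exact: lowW.
rewrite -(subnKC le); elim: (D - 2 * d)%N => [|e IH]; first by rewrite addn0.
rewrite addnS => -[r Hr Ha]; apply: IH; rewrite -[a](subrK r).
apply: lowD; first exact: low_N.
elim: Hr {Ha} => [|c k l b lt _ IHr]; first exact: low0.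
apply: lowD => //; apply: lowZ; move: lt; rewrite ltnS leq_eqVlt => /orP[/eqP kl|lt].
  by apply: low_step => //; exact: leq_addr.
exact: low_monomial.
Qed.

Lemma low_finite : exists (k : nat) (b : 'I_k -> R), forall a, exists c : 'I_k -> F,
  N (a - \sum_i c i *: b i).
Proof.
(* The pair of exponents [k], [l] below [M] is coded by [k * M + l]. *)
pose M := (2 * d)%N; exists (M * M)%N, (fun i => cy ^+ (i %/ M) * cx ^+ (i %% M)) => a.
have [r Hr Ha] := low_bounded a; suff [c E] : exists c : 'I_(M * M) -> F,
  \sum_i c i *: (cy ^+ (i %/ M) * cx ^+ (i %% M)) = r by exists c; rewrite E.
elim: Hr {Ha} => [|c k l b lt _ [c' E]].
  by exists (fun=> 0); apply: big1 => i _; rewrite scale0r.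
have lti : (k * M + l < M * M)%N.
  by have ltk : (k < M)%N; [lia|]; have ltl : (l < M)%N; [lia|]; nia.
exists (fun i => c * (i == Ordinal lti)%:R + c' i).
under eq_bigr do rewrite scalerDl.
apply: etrans (big_split _ _ _ _ _) (congr2 +%R _ E).
rewrite (delta_sum (fun i : 'I_(M * M) => cy ^+ (i %/ M) * cx ^+ (i %% M))) /=.
have M0 : (0 < M)%N by lia.
have -> : ((k * M + l) %/ M)%N = k by rewrite divnMDl // divn_small ?addn0 //; lia.
by have -> : ((k * M + l) %% M)%N = l by rewrite modnMDl modn_small //; lia.
Qed.

End DegreeReduction.

Lemma delta_sum2 (K : pzRingType) (V : lmodType K) (M : nat -> nat -> V) c N k l :
  (k < N)%N -> (l < N)%N ->
  \sum_(k' < N) \sum_(l' < N) (c * ((k' == k :> nat) && (l' == l :> nat))%:R) *: M k' l' =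
  c *: M k l.
Proof.
move=> lek lel; rewrite (bigD1 (Ordinal lek)) //= (bigD1 (Ordinal lel)) //= !eqxx mulr1 !big1
  ?addr0 //.
  by move=> k'; rewrite -val_eqE /= => /negPf ne; rewrite big1 // => l' _; rewrite ne mulr0 scale0r.
by move=> l'; rewrite -val_eqE /= => /negPf ne; rewrite ne mulr0 scale0r.
Qed.

(** * Normal forms in [L0] and in [e_n B] *)

Section NormalForms.
Variables (F : numClosedFieldType) (gT : finGroupType) (eps : primitive_char F gT).
Variables (tau : {ffun gT -> F}) (n d : nat) (q : quadruple eps tau n d).
Notation R := (crossed eps).
Notation B := (Btau eps tau).
Notation m := #|gT|.
Notation Bs := (Bs eps tau).
Notation Bz := (Bz eps tau).
Notation Bg := (Bg eps tau).
Notation Be := (Be eps tau).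
Notation E := (BE q).
Notation pi := (to_B eps tau).
Notation cx := (cr_letter eps false).
Notation cy := (cr_letter eps true).

Lemma Be_idem k : Be k * Be k = Be k.
Proof.
rewrite [X in _ * X]BeE mulrA Bs_comm -mulrA 2!mulr_sumr.
rewrite (eq_bigr (fun=> Bs m%:R^-1 * Be k)) => [|g _].
  rewrite -mulr_suml -(raddf_sum Bs) sumr_const -[_ *+ _]mulr_natr mulVf ?card_neq0 //=.
  by rewrite (rmorph1 Bs) mul1r.
rewrite (mulrA (Be k)) Bs_comm -mulrA Be_Bg (mulrA (Bs (eps g ^+ k)^-1)) -(rmorphM Bs).
by rewrite mulVf ?expf_neq0 ?eps_neq0 //= (rmorph1 Bs) mul1r.
Qed.

Inductive normal : R -> Prop :=
| Normal0 : normal 0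
| NormalD c k l a : normal a -> normal (c *: (cy ^+ k * cx ^+ l) + a).

Lemma normal_add a b : normal a -> normal b -> normal (a + b).
Proof. by elim=> [|c k l a' _ IH] Hb; rewrite ?add0r // -addrA; apply: NormalD; exact: IH. Qed.

Lemma normal_scale c a : normal a -> normal (c *: a).
Proof.
elim=> [|c' k l a' _ IH]; first by rewrite scaler0; exact: Normal0.
by rewrite scalerDr scalerA; exact: NormalD.
Qed.

Lemma normal_monomial k l : normal (cy ^+ k * cx ^+ l).
Proof. by rewrite -[X in normal X]addr0 -[X in X + _]scale1r; exact/NormalD/Normal0. Qed.

Lemma normal_representative a : exists2 r, normal r & rspan (L0_relator q) (a - r).
Proof.
have Hg g : rspan (L0_relator q) (cr_g eps g - (eps g ^+ n)%:A).
  by rewrite -[X in rspan _ X]mulr1; exact/RspanGen/RelGamma.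
have Hr b : exists c, rspan (L0_relator q) (b * cr_rel eps tau + c%:A).
  by exists (lambda q b); rewrite -[X in rspan _ X]mulr1; exact/RspanGen/RelLambda.
have [D [r Hr' ar]] := low_all (Rspan0 _) (@RspanD _ _) (fun u b => @rspanM _ _ b u) Hg Hr a.
by exists r => //; elim: Hr' => [|c k l b _ _ IH]; [exact: Normal0 | exact: NormalD].
Qed.

Lemma normal_sum K (c : nat -> nat -> F) :
  normal (\sum_(k < K) \sum_(l < K) c k l *: (cy ^+ k * cx ^+ l)).
Proof.
elim/big_ind: _ => [||k _]; [exact: Normal0|exact: normal_add|].
elim/big_ind: _ => [||l _]; [exact: Normal0|exact: normal_add|].
exact/normal_scale/normal_monomial.
Qed.

Lemma pi_monomial k l : pi (cy ^+ k * cx ^+ l) = Bz true ^+ k * Bz false ^+ l.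
Proof. by rewrite Bz.unlock (rmorphM pi) /= !(rmorphXn pi). Qed.

Lemma normal_reconstruct r : normal r -> exists K, forall K', (K <= K')%N ->
  r = \sum_(k < K') \sum_(l < K') bcoef true n (pi r) k l *: (cy ^+ k * cx ^+ l).
Proof.
elim=> [|c k l a _ [K HK]].
  exists 0%N => K' _; rewrite big1 // => k _; rewrite big1 // => l _.
  by rewrite (rmorph0 pi) bcoef0 scale0r.
exists (maxn K (maxn k.+1 l.+1)) => K'; rewrite !geq_max => /and3P[leK lek lel].
have E1 := esym (delta_sum2 (fun k l => cy ^+ k * cx ^+ l) c lek lel).
apply: (etrans (congr2 +%R E1 (HK K' leK))).
rewrite -big_split; apply: eq_bigr => k' _ /=.
rewrite -big_split; apply: eq_bigr => l' _ /=.
by rewrite (rmorphD pi) /= to_BZ bcoefD bcoefZ pi_monomial -(bcoef_Bz_exp eps tau true n) scalerDl.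
Qed.

Hypothesis lt_n : (n < m)%N.

(** The monomials [y^k x^l] spanning [L0] are also the PBW monomials of [e_n B]. With [normal_lift]
    this identifies normal forms in [R] with [e_n B], although the relators of [L0] are not those of
    [B]. *)
Lemma normal_eq0 r : normal r -> Be n * pi r = 0 -> r = 0.
Proof.
move=> /normal_reconstruct[K /(_ K (leqnn K)) Er] r0.
have c0 k l : bcoef true n (pi r) k l = 0.
  have := bcoef_Be_mul true (pi r) k l lt_n lt_n.
  by rewrite eqxx mul1r => <-; rewrite r0 bcoef0.
by rewrite Er; apply: big1 => k _; apply: big1 => l _; rewrite c0 scale0r.
Qed.

Lemma normal_lift b : Be n * b = b -> exists2 r, normal r & Be n * pi r = b.
Proof.
move=> eb; have [K /(_ K (leqnn K)) Eb] := bcoef_reconstruct true b.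
exists (\sum_(k < K) \sum_(l < K) bcoef true n b k l *: (cy ^+ k * cx ^+ l)).
  exact: normal_sum.
rewrite [RHS]Eb (bigD1 (Ordinal lt_n)) //= [X in _ + X]big1 ?addr0 => [|mu ne].
  rewrite (raddf_sum pi) mulr_sumr; apply: eq_bigr => k _.
  rewrite (raddf_sum pi) mulr_sumr; apply: eq_bigr => l _ /=.
  by rewrite to_BZ pi_monomial mulrA Bs_comm -mulrA; congr (_ * _); rewrite /monom mulrA.
apply: big1 => k _; apply: big1 => l _.
have := bcoef_Be_mul true b k l lt_n (ltn_ord mu); rewrite eb => ->.
have /negPf -> : n != mu by apply: contra ne => /eqP E; apply/eqP/val_inj.
by rewrite mul0r (rmorph0 Bs) mul0r.
Qed.

Lemma subring_mx t k l p
    (A : 'M[B]_(k, l)) (C : 'M[B]_(l, p)) :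
  (forall i j, subring_of t (A i j)) -> (forall i j, subring_of t (C i j)) ->
  forall i j, subring_of t ((A *m C) i j).
Proof.
move=> HA HC i j; rewrite mxE; apply: subring_of_sum => h _.
by apply: SubM.
Qed.

Lemma subring_map t k l (A : 'M[F]_(k, l)) i j : subring_of t (map_mx Bs A i j).
Proof. by rewrite mxE; exact: SubS. Qed.

Lemma subring_scalar t (b : B) : subring_of t b -> forall k (i j : 'I_k), subring_of t (b%:M i j).
Proof. by move=> Hb k i j; rewrite mxE; case: eqP => _; rewrite ?mulr1n ?mulr0n //; exact:
  subring_of0. Qed.

Lemma subring_E t c i j : subring_of t (E c i j).
Proof.
rewrite BE.unlock summxE; apply: subring_of_sum => g _; apply: subring_mx.
  exact/subring_scalar/SubS.
rewrite BU.unlock; apply: subring_mx; first exact: subring_map.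
exact/subring_scalar/SubG.
Qed.

(** The letters [y] come first and contribute nothing to the derivative along [x]; afterwards it is
    multiplied by [x] only. *)
Lemma fox1_monomial k l i j : subring_of false (fox1 q (cy ^+ k * cx ^+ l) i j).
Proof.
elim: l i j => [|l IH] i j.
  have -> : fox1 q (cy ^+ k * cx ^+ 0) = 0.
    have := fox1_polyY q ('X^k); rewrite rmorphXn /= horner_algX expr0 mulr1 => <-.
    by rewrite /cr_letter.
  by rewrite mxE; exact: subring_of0.
rewrite exprSr mulrA /fox1 fox_letter /= [X in subring_of _ X]mxE [X in _ + X]mxE.
apply: subring_ofB; apply: subring_mx; first exact: IH.
- exact/subring_scalar/SubZ.
- exact: subring_E.
- exact: subring_map.
Qed.

Lemma fox1_normal r : normal r -> forall i j, subring_of false (fox1 q r i j).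
Proof.
elim=> [|c k l a _ IH] i j.
  have -> : fox1 q 0 = 0 by rewrite /fox1 /fox /fox_act (act0l (fox_axioms q)).
  by rewrite mxE; exact: subring_of0.
rewrite /fox1 foxDZ /= mxE; apply: SubD; last exact: IH.
apply: subring_mx; first exact: fox1_monomial.
exact/subring_scalar/SubS.
Qed.

(** Summing the constant coefficients over all weights isolates the term of the neutral element in
    [E 0], which gives back [u]. *)
Lemma E0_map_eq0 (u : 'cV[F]_d) : E 0 *m map_mx Bs u = 0 -> u = 0.
Proof.
move=> E0; apply/matrixP => i j; rewrite ord1.
have E1 : (E 0 *m map_mx Bs u) i 0 =
    \sum_g Bs (m%:R^-1 * (Gbar q g *m u) i 0) * Bg g^-1%g.
  rewrite BE.unlock mulmx_suml summxE; apply: eq_bigr => g _.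
  rewrite BU.unlock -!mulmxA -map_Bs_comm [X in _ *m X]mulmxA -map_mxM.
  rewrite mul_scalar_mx [LHS]mxE mulmx_scalar_col mxE mulrA -(rmorphM Bs).
  by rewrite expr0 mulr1.
have : \sum_(nu < m) bcoef true nu ((E 0 *m map_mx Bs u) i 0) 0 0 = 0.
  by rewrite E0 mxE; apply: big1 => nu _; exact: bcoef0.
rewrite E1 (eq_bigr (fun nu : 'I_m => \sum_g m%:R^-1 * (Gbar q g *m u) i 0 * eps g^-1%g ^+ nu)).
  rewrite exchange_big (bigD1 1%g) //= [X in _ + X = _]big1 ?addr0 => [|g g1].
    rewrite -mulr_sumr sum_eps_expr invg1 eqxx G1 mul1mx mulrAC mulVf ?card_neq0 // mul1r => ->.
    by rewrite mxE.
  by rewrite -mulr_sumr sum_eps_expr invg_eq1 (negPf g1) mulr0.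
move=> nu _; rewrite bcoef_sum; apply: eq_bigr => g _; rewrite bcoefZ.
rewrite -[Bg _]mulr1 bcoef_Bg_mul.
by have := bcoef_Bz_exp eps tau true nu 0 0 0 0; rewrite mulr1 => ->; rewrite mulr1.
Qed.

End NormalForms.

(** * Comparison of [H^0] with the homology of the monad *)

Lemma mul3sub (S : pzRingType) d k l (X Y : 'M[S]_d) (I : 'M[S]_(d, k))
    (v1 v2 u1 u2 : 'M[S]_(d, l)) (w w' : 'M[S]_(k, l)) :
  X *m (v1 - u1) - Y *m (v2 - u2) - I *m (w - w') =
  (X *m v1 - Y *m v2 - I *m w) - (X *m u1 - Y *m u2 - I *m w').
Proof. by rewrite !mulmxDr sub2D !mulmxN !opprD. Qed.

Section MonadKernel.
Variables (F : numClosedFieldType) (gT : finGroupType) (eps : primitive_char F gT).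
Variables (tau : {ffun gT -> F}) (Q : unitRingType).
Variables (iota : {rmorphism Btau eps tau -> Q}).
Variables (n d : nat) (q : quadruple eps tau n d).
Notation R := (crossed eps).
Notation B := (Btau eps tau).
Notation m := #|gT|.
Notation Bs := (Bs eps tau).
Notation Bz := (Bz eps tau).
Notation Be := (Be eps tau).
Notation pX := (BX q).
Notation pY := (BY q).
Notation vi := (Bi q).
Notation vj := (Bj q).
Notation E := (BE q).
Notation pi := (to_B eps tau).
Notation mp := (map_mx iota).

Record monad_kernel (v1 v2 : 'cV[B]_d) (w : B) : Prop := MonadKernel {
  mk_equiv1 : E m.-1 *m v1 = v1;
  mk_equiv2 : E 1 *m v2 = v2;
  mk_equivw : Be n * w = w;
  mk_eq : pX *m v1 - pY *m v2 - vi *m w%:M = 0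
}.

Lemma BXE : pX = map_mx Bs (Xbar q) - (Bz false)%:M. Proof. by rewrite BX.unlock. Qed.
Lemma BYE : pY = map_mx Bs (Ybar q) - (Bz true)%:M. Proof. by rewrite BY.unlock. Qed.

Lemma BE_predS : E m.-1.+1 = E 0. Proof. by rewrite (prednK (card_gt0G gT)) BEm. Qed.

Lemma monad_kernel_fox a : act_mx q a *m ibar q = 0 ->
  monad_kernel (fox1 q a) (fox2 q a) (Be n * pi a).
Proof.
move=> a0; have [E1 E2] := fox_equiv q a; split=> //; first by rewrite mulrA Be_idem.
by rewrite -fox_fundamental a0 map_mx0 mulmx0 addr0 subrr.
Qed.

Lemma monad_kernelB u1 u2 u v1 v2 v : monad_kernel u1 u2 u -> monad_kernel v1 v2 v ->
  monad_kernel (u1 - v1) (u2 - v2) (u - v).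
Proof.
move=> [U1 U2 U3 U4] [V1 V2 V3 V4]; split.
- by rewrite mulmxBr U1 V1.
- by rewrite mulmxBr U2 V2.
- by rewrite mulrBr U3 V3.
- by rewrite (raddfB (@scalar_mx _ 1)) [LHS]mul3sub U4 V4 subr0.
Qed.

Lemma monad_kernel_alpha c : E 0 *m c = c -> monad_kernel (pY *m c) (pX *m c) ((vj *m c) 0 0).
Proof.
move=> Ec; split.
- by rewrite mulmxA -BY_BE BE_predS -mulmxA Ec.
- by rewrite mulmxA -BX_BE -mulmxA Ec.
- by rewrite -{2}Ec mulmxA Bj_BE -mulmxA mul_scalar_mx [RHS]mxE.
- have := congr1 (fun A => A *m c) (monad_comp q); rewrite mul0mx -mulmxA Ec !mulmxBl => <-.
  by rewrite -!mulmxA; congr (_ - _ *m _); rewrite [RHS]mx11_scalar.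
Qed.

Hypothesis iota_inj : injective iota.
Hypothesis tau_generic : generic eps tau.
Hypothesis lt_n : (n < m)%N.
Variables Xinv Yinv : 'M[Q]_d.
Hypotheses (YinvP : mutually_inverse (mp pY) Yinv).
Notation psi := (psi iota q Yinv).
Notation phi := (phi iota q Yinv).

Lemma map_iota_inj k l : injective (fun A : 'M[B]_(k, l) => mp A).
Proof.
move=> A C /matrixP H; apply/matrixP => i j; apply: iota_inj.
by have := H i j; rewrite !mxE.
Qed.

(** The only candidate is [C = (Y - y)^-1 v1], over [Q]. Vanishing of [psi] says [w = j C], and the
    cycle condition then gives [v2 = (X - x) C]. The left inverse of the first map of the monad
    computes [C] from [v1], [v2], [w], so its entries lie in [B]. *)
Lemma psi_eq0 v1 v2 w : monad_kernel v1 v2 w -> psi v1 w = 0 ->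
  exists c : 'cV[B]_d, [/\ E 0 *m c = c, v1 = pY *m c, v2 = pX *m c & w = (vj *m c) 0 0].
Proof.
move=> [E1 E2 Ew Eq] psi0; have [YY YY'] := YinvP.
pose C := Yinv *m mp v1.
have C1 : mp v1 = mp pY *m C by rewrite mulmxA YY mul1mx.
have Cw : mp w%:M = mp vj *m C.
  apply/matrixP => i j; rewrite !ord1 map_scalar_mx mxE mulr1n.
  by apply/eqP; rewrite -subr_eq0 mulmxA; apply/eqP.
have CE : mp (E 0) *m C = C.
  have YE := inv_twist YinvP (etrans (esym (map_mxM iota pY (E m.-1.+1)))
    (etrans (congr1 mp (BY_BE q m.-1)) (map_mxM iota _ pY))).
  by rewrite BE_predS in YE; rewrite mulmxA -YE -mulmxA -map_mxM E1.
have C2 : mp v2 = mp pX *m C.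
  have H1 := congr1 (fun A => mp A) Eq; rewrite /= !map_mxB !map_mxM Cw C1 map_mx0 in H1.
  have H2 := congr1 (fun A => mp A *m C) (monad_comp q).
  rewrite /= map_mxM -mulmxA CE map_mx0 mul0mx !map_mxB !map_mxM !mulmxBl -!mulmxA in H2.
  have H3 : mp pY *m mp v2 = mp pY *m (mp pX *m C).
    have HH (V : zmodType) (a b b' e : V) : a - b - e = 0 -> a - b' - e = 0 -> b = b'.
      by move=> /eqP; rewrite addrAC subr_eq0 => /eqP <- /eqP; rewrite addrAC subr_eq0 => /eqP.
    exact: HH H1 H2.
  by rewrite -[LHS]mul1mx -YY' -mulmxA H3 mulmxA YY' mul1mx.
have [r1 [r2 [r3 Hr]]] := kernel_splitting q tau_generic.
pose c := r1 *m v1 + r2 *m v2 + r3 *m w%:M.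
have Ec : C = mp c.
  rewrite /c !map_mxD !map_mxM C1 C2 Cw -[LHS]mul1mx -(map_mx1 iota) -Hr.
  by rewrite !map_mxD !map_mxM !mulmxDl !mulmxA.
exists c; split.
- by apply: map_iota_inj; rewrite /= map_mxM -Ec.
- by apply: map_iota_inj; rewrite /= map_mxM -Ec.
- by apply: map_iota_inj; rewrite /= map_mxM -Ec.
- have Hw : w%:M = vj *m c by apply: map_iota_inj; rewrite /= map_mxM -Ec.
  by rewrite -Hw mxE eqxx.
Qed.

Lemma pencil_eq0 t (A : 'M[F]_d) (c : 'cV[B]_d) :
  (forall i, reduced t (((map_mx Bs A - (Bz t)%:M) *m c) i 0)) -> c = 0.
Proof. by move=> H; apply: (pencil_reduced_eq0 (Y := A)) => i; rewrite -mulmxBl. Qed.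

(** For a normal representative the derivative along [x] is free of [y], yet by [psi_eq0] it equals
    [(Y - y) c]. Uniqueness of division gives [c = 0], so the last component vanishes and with it
    the normal form. *)
Lemma phi_injective a : act_mx q a *m ibar q = 0 -> phi a = 0 -> rspan (L0_relator q) a.
Proof.
move=> a0 phi0; have [r nr ar] := normal_representative q a.
have r0 : act_mx q r *m ibar q = 0.
  by have := act_mx_rspan ar; rewrite (raddfB (act_mx q)) mulmxBl a0 sub0r => /eqP; rewrite
    oppr_eq0 => /eqP.
have phir : phi r = 0.
  have := phi_rspan YinvP ar.
  by rewrite phiD phiN phi0 sub0r => /eqP; rewrite oppr_eq0 => /eqP.
have [c [Ec E1 _ Ew]] := psi_eq0 (monad_kernel_fox r0) phir.
have c0 : c = 0.
  apply: (@pencil_eq0 true (Ybar q)) => i; apply: subring_reduced => /=.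
  by rewrite -BYE -E1; exact: fox1_normal.
have w0 : Be n * pi r = 0 by rewrite [LHS]Ew c0 mulmx0 mxE.
have r00 := normal_eq0 lt_n nr w0.
by rewrite -(subr0 a) -r00.
Qed.

(* Modulo a boundary, [v1] does not involve [y]; lifting the last component to a normal
   form [a], the two expressions of the cycle condition differ by [pX r - pY z = E0 u], and
   reducing with respect to [y] and then [x] forces [z = 0], [r = 0] and [u = 0]. *)
Lemma psi_kernel_phi v1 v2 w : monad_kernel v1 v2 w ->
  exists2 a, act_mx q a *m ibar q = 0 & psi v1 w = phi a.
Proof.
move=> K0; have [E1 _ _ _] := K0.
have [c0 [r0 [Hv Hr0]]] := pencil_decomp true (Ybar q) v1.
(* The projectors make the quotient and the remainder equivariant. Their entries involve only
   scalars and group elements, so [r] stays free of [y]. *)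
pose c := E 0 *m c0; pose r := E m.-1 *m r0.
have Ec : E 0 *m c = c by rewrite mulmxA BE_idem.
have Hv1 : v1 = pY *m c + r.
  have Hv' : v1 = pY *m c0 + r0.
    by rewrite Hv BYE (mulmxBl (map_mx Bs (Ybar q)) (Bz true)%:M c0).
  by rewrite -[LHS]E1 Hv' mulmxDr mulmxA -BY_BE BE_predS -mulmxA.
have Hr i j : subring_of false (r i j).
  by apply: subring_mx => [|i' j']; [exact: subring_E | rewrite ord1; exact: Hr0].
have K1 := monad_kernelB K0 (monad_kernel_alpha Ec).
have Er : v1 - pY *m c = r by rewrite Hv1 addrC addKr.
rewrite Er in K1; case: K1 => _ _ K1w K1e.
have [a na Ha] := normal_lift lt_n K1w.
have Hf := fox_fundamental q a; rewrite Ha in Hf.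
set u := act_mx q a *m ibar q in Hf; set v2' := v2 - pX *m c in K1e.
have key : pX *m (r - fox1 q a) - pY *m (v2' - fox2 q a) = E 0 *m map_mx Bs u.
  have HH (V : zmodType) (a1 a2 b1 b2 e x : V) : a1 - b1 - x = 0 -> a2 - b2 + e = x ->
      (a1 - a2) - (b1 - b2) = e.
    move=> /eqP; rewrite subr_eq0 => /eqP <- H.
    have -> : e = (a1 - b1) - (a2 - b2) by rewrite -H addrC addKr.
    by rewrite !opprB addrACA [RHS]addrACA; congr (_ + _); exact: addrC.
  rewrite (mulmxBr pX r) (mulmxBr pY v2').
  exact: (@HH ('cV[B]_d) _ _ _ _ _ _ K1e Hf).
have sub1 i j : subring_of false ((r - fox1 q a) i j).
  by rewrite mxE [X in _ + X]mxE; apply: subring_ofB; [exact: Hr | exact: fox1_normal].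
have subE t i j : subring_of t ((E 0 *m map_mx Bs u) i j).
  by apply: subring_mx; [exact: subring_E | exact: subring_map].
have z0 : v2' - fox2 q a = 0.
  apply: (@pencil_eq0 true (Ybar q)) => i; apply: subring_reduced => /=.
  rewrite -BYE.
  have -> : pY *m (v2' - fox2 q a) = pX *m (r - fox1 q a) - E 0 *m map_mx Bs u.
    have HH (V : zmodType) (x y z : V) : x - y = z -> y = x - z.
      by move=> <-; rewrite opprB addrC subrK.
    exact: (@HH ('cV[B]_d) _ _ _ key).
  rewrite mxE [X in _ + X]mxE; apply: subring_ofB; last exact: subE.
  apply: subring_mx => // i' j'; rewrite BX.unlock mxE [X in _ + X]mxE.
  by apply: subring_ofB; [exact: subring_map | exact/subring_scalar/SubZ].
rewrite z0 mulmx0 subr0 in key.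
have r1 : r - fox1 q a = 0.
  apply: (@pencil_eq0 false (Xbar q)) => i; apply: subring_reduced => /=.
  by rewrite -BXE key; exact: subE.
exists a.
  by apply: (E0_map_eq0 (q := q)); rewrite -key r1 mulmx0.
rewrite /phi Ha; move/eqP: r1; rewrite subr_eq0 => /eqP <-; rewrite -Er psiB.
by rewrite psi_alpha // subr0.
Qed.

End MonadKernel.

(** * The image of the embedding *)

Section Image.
Variables (F : numClosedFieldType) (gT : finGroupType) (eps : primitive_char F gT).
Variables (tau : {ffun gT -> F}) (Q : unitRingType).
Variables (iota : {rmorphism Btau eps tau -> Q}).
Variables (n d : nat) (q : quadruple eps tau n d).
Notation R := (crossed eps).
Notation B := (Btau eps tau).
Notation pi := (to_B eps tau).
Notation mp := (map_mx iota).
Hypothesis tau_generic : generic eps tau.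
Variables Xinv Yinv : 'M[Q]_d.
Hypotheses (XinvP : mutually_inverse (mp (BX q)) Xinv) (YinvP : mutually_inverse (mp (BY q)) Yinv).
Notation phi := (phi iota q Yinv).
Notation uM := (crQ iota (cr_idem eps n) * detY iota q).
Notation vM := (crQ iota (cr_idem eps n) * kappa iota q Xinv Yinv * detX iota q).

Definition det_poly z : {poly F} :=
  \det (map_mx polyC (if z then Ybar q else Xbar q) - 'X%:M).

Lemma det_polyE z : det_poly z = (-1) ^+ d * char_poly (if z then Ybar q else Xbar q).
Proof. by rewrite /det_poly -(opprK (_ - _)) -scaleN1r detZ opprB. Qed.

Lemma det_poly_killed z : act_mx q (horner_alg (cr_letter eps z) (det_poly z)) *m ibar q = 0.
Proof. by apply: act_mx_charpoly; rewrite det_polyE dvdp_mull. Qed.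

Lemma phi_detY : phi (horner_alg (cr_letter eps true) (det_poly true)) = uM.
Proof. by rewrite phi_polyY Be.unlock. Qed.

Lemma phi_detX : phi (horner_alg (cr_letter eps false) (det_poly false)) = vM.
Proof. by rewrite (phi_polyX XinvP) ?Be.unlock //; rewrite det_polyE dvdp_mull. Qed.

Definition in_ideal (x : Q) : Prop := exists b c : B, x = uM * iota b + vM * iota c.

Lemma in_ideal0 : in_ideal 0.
Proof. by exists 0, 0; rewrite (rmorph0 iota) !mulr0 addr0. Qed.

Lemma in_idealD x y : in_ideal x -> in_ideal y -> in_ideal (x + y).
Proof.
move=> [b [c ->]] [b' [c' ->]]; exists (b + b'), (c + c').
by rewrite !(rmorphD iota) !mulrDr addrACA.
Qed.

Lemma in_idealM x b : in_ideal x -> in_ideal (x * iota b).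
Proof.
move=> [c [e ->]]; exists (c * b), (e * b).
by rewrite !(rmorphM iota) mulrDl !mulrA.
Qed.

Lemma ideal_phi x : in_ideal x -> exists2 a, act_mx q a *m ibar q = 0 & phi a = x.
Proof.
move=> [b [c ->]].
exists (horner_alg (cr_letter eps true) (det_poly true) * of_quot b +
        horner_alg (cr_letter eps false) (det_poly false) * of_quot c).
  by rewrite (raddfD (act_mx q)) /= !act_mxM mulmxDl -!mulmxA !det_poly_killed !mulmx0 addr0.
rewrite phiD !phi_mul ?det_poly_killed // phi_detY phi_detX.
by rewrite [pi (of_quot b)]of_quotK [pi (of_quot c)]of_quotK.
Qed.

Let P (a : R) : Prop := act_mx q a *m ibar q = 0.
Let N (a : R) : Prop := P a /\ in_ideal (phi a).

Let PM a b : P a -> P (a * b).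
Proof. by rewrite /P => Pa; rewrite act_mxM -mulmxA Pa mulmx0. Qed.

Let PD a b : P a -> P b -> P (a + b).
Proof. by rewrite /P => Pa Pb; rewrite (raddfD (act_mx q)) mulmxDl Pa Pb addr0. Qed.

Let PZ c a : P a -> P (c *: a).
Proof. by rewrite /P => Pa; rewrite act_mxZ -scalemxAl Pa scaler0. Qed.

Let NM a b : N a -> N (a * b).
Proof. by move=> [Pa Ia]; split; [exact: PM | rewrite phi_mul //; exact: in_idealM]. Qed.

Let ND a b : N a -> N b -> N (a + b).
Proof.
by move=> [Pa Ia] [Pb Ib]; split; [exact: PD | rewrite phiD; exact: in_idealD].
Qed.

Let N_rspan a : rspan (L0_relator q) a -> N a.
Proof.
move=> Ha; split; first exact: act_mx_rspan.
by rewrite (phi_rspan YinvP Ha); exact: in_ideal0.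
Qed.

Let N_relator a : L0_relator q a -> N a.
Proof. by move=> Ha; apply: N_rspan; rewrite -[a]mulr1; exact: RspanGen. Qed.

Let cNZ c a : N a -> N (c *: a).
Proof. by move=> Na; rewrite -[a]mulr1 -cr_scale_mulA; exact: NM. Qed.

Let N_det z : N (horner_alg (cr_letter eps z) (det_poly z)).
Proof.
split; first exact: det_poly_killed.
case: z; [rewrite phi_detY; exists 1, 0 | rewrite phi_detX; exists 0, 1];
  by rewrite (rmorph0 iota) (rmorph1 iota) mulr0 mulr1 ?addr0 ?add0r.
Qed.

Let N_char z : N (horner_alg (cr_letter eps z) (char_poly (if z then Ybar q else Xbar q))).
Proof.
have -> : char_poly (if z then Ybar q else Xbar q) = ((-1) ^+ d)%:P * det_poly z.
  by rewrite det_polyE mulrA rmorphXn rmorphN1 -expr2 sqrr_sign mul1r.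
by rewrite rmorphM /= horner_algC -scalerAl mul1r; exact/cNZ/N_det.
Qed.

Let N_finite : exists (k : nat) (b : 'I_k -> R), forall a, exists c : 'I_k -> F,
  N (a - \sum_i c i *: b i).
Proof.
have Hg g : N (cr_g eps g - (eps g ^+ n)%:A) by exact/N_relator/RelGamma.
have Hr a : exists c, N (a * cr_rel eps tau + c%:A).
  by exists (lambda q a); exact/N_relator/RelLambda.
apply: (low_finite (N_rspan (Rspan0 _)) ND NM Hg Hr (p := fun z =>
    char_poly (if z then Ybar q else Xbar q)) (d := d)) => z.
- exact: char_poly_monic.
- by rewrite size_char_poly.
- exact: N_char.
Qed.

(** Consider [P] modulo [N]. The relation of [B] holds there because [phi] kills the products
    [v (xy - yx - tau)] for [v] in [P], and the quotient has finite dimension because [N] has finite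
    codimension in [R]. Hence it is zero. *)
Lemma phi_ideal a : act_mx q a *m ibar q = 0 -> in_ideal (phi a).
Proof.
move=> Pa; suff [] : N a by [].
apply: (no_finite_dimensional tau_generic (P := P) (N := N) (V := R)
  (opz := fun z v => v * cr_letter eps z) (opg := fun g v => v * cr_g eps g)).
- exact: N_rspan (Rspan0 _).
- by move=> c u v Nu Nv; apply: ND => //; exact: cNZ.
- by move=> c u v Pu Pv; apply: PD => //; exact: PZ.
- exact: N_finite.
- by move=> z c u v; rewrite mulrDl -scalerAl.
- by move=> g c u v; rewrite mulrDl -scalerAl.
- by move=> z u; exact: NM.
- by move=> z u; exact: PM.
- by move=> g u; exact: PM.
- by move=> g h v; rewrite -mulrA cr_gM.
- by move=> v; rewrite [cr_g eps 1%g](_ : _ = 1) ?mulr1.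
- move=> g z v; rewrite -!mulrA.
  case: z => /=; rewrite ?cr_gx ?cr_gy cr_scale_mulA ?scalerA ?mulrA //.
- move=> v Pv; have -> : v * cr_letter eps false * cr_letter eps true -
      v * cr_letter eps true * cr_letter eps false - \sum_g tau g *: (v * cr_g eps g) =
      v * cr_rel eps tau.
    rewrite /cr_rel !mulrBr !mulrA /cr_tau mulr_sumr; congr (_ - _).
    by apply: eq_bigr => g _; rewrite cr_scale_mulA.
  split; first exact: PM.
  by rewrite phi_mul // pi_rel (rmorph0 iota) mulr0; exact: in_ideal0.
- exact: Pa.
Qed.

End Image.

Lemma isomorphic_intro (A : pzRingType) (V W : lmodType A) (f : V -> W) :
  linear f -> injective f -> (forall w, exists v, f v = w) -> isomorphic V W.
Proof.
move=> flin finj /choice[g gK].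
exists (HB.pack_for {linear V -> W} f (GRing.isLinear.Build A V W *:%R f flin)).
by exists g => [v|]; [apply: finj; rewrite gK | exact: gK].
Qed.

Lemma isomorphic_sym (A : pzRingType) (V W : lmodType A) : isomorphic V W -> isomorphic W V.
Proof.
move=> [f [g fK gK]]; apply: (@isomorphic_intro _ _ _ g).
- by move=> a u v; apply: (can_inj fK); rewrite linearP !gK.
- exact: can_inj gK.
- by move=> v; exists (f v); rewrite fK.
Qed.

Section HomologyIdeal.
Variables (F : numClosedFieldType) (gT : finGroupType) (eps : primitive_char F gT).
Variables (tau : {ffun gT -> F}) (Q : unitRingType).
Variables (iota : {rmorphism Btau eps tau -> Q}).
Variables (n d : nat) (q : quadruple eps tau n d).
Notation R := (crossed eps).
Notation B := (Btau eps tau).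
Notation pi := (to_B eps tau).
Notation mp := (map_mx iota).
Hypothesis iota_inj : injective iota.
Hypothesis tau_generic : generic eps tau.
Hypothesis lt_n : (n < #|gT|)%N.
Variables Xinv Yinv : 'M[Q]_d.
Hypotheses (XinvP : mutually_inverse (mp (BX q)) Xinv) (YinvP : mutually_inverse (mp (BY q)) Yinv).
Notation phi := (phi iota q Yinv).
Notation uM := (crQ iota (cr_idem eps n) * detY iota q).
Notation vM := (crQ iota (cr_idem eps n) * kappa iota q Xinv Yinv * detX iota q).

Lemma H0_of_cyc (v : H0 q) : act_mx q (of_cyc (val v)) *m ibar q = 0.
Proof. by apply/eqP; rewrite -dLE of_cycK; exact: (valP v). Qed.

Lemma phi_in_ideal (v : H0 q) : (phi (of_cyc (val v)) : rmodQ iota) \in @frac_ideal_pred _ _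
  iota uM vM.
Proof. by apply/asboolP; exact: (phi_ideal tau_generic XinvP YinvP (H0_of_cyc v)). Qed.

Definition H0_to_ideal (v : H0 q) : nakajima_ideal iota q Xinv Yinv :=
  exist (fun x : rmodQ iota => x \in @frac_ideal_pred _ _ iota uM vM) _ (phi_in_ideal v).

Lemma H0_to_ideal_linear : linear H0_to_ideal.
Proof.
move=> b u v; apply: val_inj.
have -> : val (b *: H0_to_ideal u + H0_to_ideal v) =
    phi (of_cyc (val u)) * iota (b : B) + phi (of_cyc (val v)) :> Q by [].
rewrite -[in RHS](of_quotK (b : B)) -(phi_mul iota Yinv _ (H0_of_cyc u)) -phiD.
apply: (phi_congr YinvP).
apply: etrans (of_cycK _) (etrans (H0_valD (b *: u) v) _).
rewrite (raddfD (to_cyc (L0_relator q))) /=; congr (_ + _).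
exact: esym (of_cycK _).
Qed.

Lemma H0_isomorphic : isomorphic (H0 q) (nakajima_ideal iota q Xinv Yinv).
Proof.
apply: (isomorphic_intro H0_to_ideal_linear).
- move=> u v /(congr1 val) /= E; apply: val_inj.
  rewrite -[val u]of_cycK -[val v]of_cycK; apply/to_cyc_eq.
  apply: (phi_injective iota_inj tau_generic lt_n YinvP).
    by rewrite (raddfB (act_mx q)) mulmxBl !H0_of_cyc subrr.
  by rewrite phiD phiN [X in X - _]E subrr.
- move=> w; have /asboolP/(ideal_phi XinvP YinvP)[a a0 Ea] := valP w.
  have Ha : (to_cyc (L0_relator q) a : L0 q) \in @H0_pred _ _ _ _ _ _ q.
    by rewrite unfold_in /H0_pred dLE a0.
  exists (exist (fun x : L0 q => x \in @H0_pred _ _ _ _ _ _ q) _ Ha); apply: val_inj => /=.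
  by rewrite -[RHS]Ea; apply: (phi_congr YinvP); rewrite of_cycK.
Qed.

End HomologyIdeal.

(** * The class of the ideal *)

Section Diagonalization.
Variables (F : numClosedFieldType) (gT : finGroupType) (eps : primitive_char F gT).
Notation m := #|gT|.

Lemma repr_expg d (G : mx_representation F [set: gT] d.+1) g k : G (g ^+ k)%g = G g ^+ k.
Proof.
elim: k => [|k IH]; first by rewrite expg0 repr_mx1.
by rewrite expgS repr_mxM ?in_setT // IH exprS.
Qed.

(** A generator acts by a matrix whose [m]-th power is [1], and [T^m - 1] has the distinct roots
    [eps(g0)^i]; diagonalizing this one matrix diagonalizes the group. *)
Lemma weight_basis d (G : mx_representation F [set: gT] d) :
  exists (P P' : 'M[F]_d) (s : 'I_d -> nat), [/\ P *m P' = 1%:M, P' *m P = 1%:M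
    & forall g, P *m G g = diag_mx (\row_k eps g ^+ s k) *m P].
Proof.
case: d G => [|d] G.
  by exists 1%:M, 1%:M, (fun=> 0%N); split=> [||g]; rewrite ?mulmx1 // [LHS]flatmx0 [RHS]flatmx0.
have [g0 gen pz] := eps_primitive eps.
have Gm : G g0 ^+ m = 1.
  rewrite -repr_expg (_ : (g0 ^+ m)%g = 1%g) ?repr_mx1 //.
  by apply: (eps_inj (eps := eps)); rewrite epsX prim_expr_order.
have [P uP /diagonalizable_forPex[D /(simmxP uP) ED]] : diagonalizable (G g0).
  apply/diagonalizableP; exists [seq eps g0 ^+ i | i <- index_iota 0 m].
    rewrite map_inj_in_uniq ?iota_uniq // => i j; rewrite !mem_index_iota /= => li lj /eqP.
    by rewrite (eq_prim_root_expr pz) !modn_small // => /eqP.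
  rewrite big_map (factor_Xn_sub_1 pz); apply: mxminpoly_min.
  by rewrite rmorphB rmorphXn rmorph1 /= horner_mx_X Gm subrr.
have HD j : P *m (G g0 ^+ j) = diag_mx (\row_i (D 0 i) ^+ j) *m P.
  elim: j => [|j IH].
    rewrite [LHS]mulmx1 (_ : diag_mx _ = 1%:M) ?mul1mx //.
    by rewrite -diag_const_mx; congr diag_mx; apply/rowP => i; rewrite !mxE.
  rewrite exprS -[_ * _]/(_ *m _) mulmxA ED -mulmxA IH mulmxA mulmx_diag.
  by congr (diag_mx _ *m _); apply/rowP => i; rewrite !mxE exprS.
have Dm k : (D 0 k) ^+ m = 1.
  have := HD m; rewrite Gm [LHS]mulmx1 => /(congr1 (fun A => A *m invmx P)).
  rewrite mulmxK // mulmxV // => /matrixP/(_ k k).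
  by rewrite !mxE eqxx => /esym; rewrite !mulr1n.
have /choice[s Es] k : exists i, D 0 k = eps g0 ^+ i.
  by have [i Ei] := prim_rootP pz (Dm k); exists i.
exists P, (invmx P), s; split; rewrite ?mulmxV ?mulVmx // => g.
have [j ->] := gen g; rewrite repr_expg HD; congr (diag_mx _ *m _); apply/rowP => i.
by rewrite !mxE Es epsX exprAC.
Qed.

End Diagonalization.

Definition weight_seq N (w : 'I_N -> nat) : seq nat := [seq w i | i <- enum 'I_N].

Lemma size_weight_seq N (w : 'I_N -> nat) : size (weight_seq w) = N.
Proof. by rewrite size_map size_enum_ord. Qed.

Lemma nth_weight_seq N (w : 'I_N -> nat) (i : 'I_N) : nth 0%N (weight_seq w) i = w i.
Proof. by rewrite (nth_map i) ?size_enum_ord // nth_ord_enum. Qed.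

Lemma diag_mulmx (S : pzRingType) N k (e : 'I_N -> S) (A : 'M[S]_(N, k)) i j :
  (diag_mx (\row_i e i) *m A) i j = e i * A i j.
Proof. by rewrite mul_diag_mx mxE [X in X * _]mxE. Qed.

Section InducedCoordinates.
Variables (F : numClosedFieldType) (gT : finGroupType) (eps : primitive_char F gT).
Variables (tau : {ffun gT -> F}).
Notation B := (Btau eps tau).
Notation Be := (Be eps tau).
Variables (N : nat) (w : 'I_N -> nat) (Eb p p' : 'M[B]_N).
Hypotheses (p'p : p' *m p = 1%:M) (pp' : p *m p' = 1%:M).
Hypothesis pE : p *m Eb = diag_mx (\row_i Be (w i)) *m p.
Notation ind := (induced eps tau (weight_seq w)).
Notation ix i := (cast_ord (esym (size_weight_seq w)) i).

Definition ind_entry (v : ind) (i : 'I_N) : B := val v (ix i).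

Lemma ind_entryP v i : Be (w i) * ind_entry v i = ind_entry v i.
Proof.
by have /asboolP/(_ (ix i)) := valP v; rewrite /= nth_weight_seq Be.unlock.
Qed.

(** Identifies the induced module with the image of the projector [Eb], which [p] conjugates to a
    diagonal of idempotents. *)
Definition ind_get (v : ind) : 'cV[B]_N := p' *m \col_i ind_entry v i.

Lemma ind_get_equiv v : Eb *m ind_get v = ind_get v.
Proof.
have Ep : Eb *m p' = p' *m diag_mx (\row_i Be (w i)).
  by rewrite -[LHS]mul1mx -p'p -mulmxA (mulmxA p) pE -(mulmxA _ p) pp' mulmx1.
rewrite /ind_get mulmxA Ep -mulmxA; congr (_ *m _); apply/matrixP => i j.
by rewrite diag_mulmx [in LHS]mxE [RHS]mxE ind_entryP.
Qed.

Lemma ind_get_inj : injective ind_get.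
Proof.
move=> u v /(congr1 (mulmx p)); rewrite /ind_get !mulmxA pp' !mul1mx => /matrixP E.
apply/val_inj/ffunP => k; have := E (cast_ord (size_weight_seq w) k) 0.
by rewrite !mxE /ind_entry !cast_ordK.
Qed.

Lemma ind_get_linear (b : B^c) u v :
  ind_get (b *: u + v) = ind_get u *m (b : B)%:M + ind_get v.
Proof.
rewrite /ind_get -mulmxA -mulmxDr; congr (_ *m _); apply/matrixP => i j.
rewrite ord1 [RHS]mxE mulmx_scalar_col !mxE.
by rewrite /ind_entry /= !ffunE.
Qed.

Lemma ind_mk_mem (a : 'cV[B]_N) :
  ([ffun k => (p *m (Eb *m a)) (cast_ord (size_weight_seq w) k) 0]
     : {ffun 'I_(size (weight_seq w)) -> (B^c)^o}) \in @induced_pred _ _ eps tau (weight_seq w).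
Proof.
apply/asboolP => k; rewrite !ffunE mulmxA pE -mulmxA diag_mulmx.
have -> : nth 0%N (weight_seq w) k = w (cast_ord (size_weight_seq w) k).
  exact: (nth_weight_seq w (cast_ord (size_weight_seq w) k)).
by rewrite mulrA; have := Be_idem eps tau (w (cast_ord (size_weight_seq w) k)); rewrite
  Be.unlock => ->.
Qed.

Definition ind_mk (a : 'cV[B]_N) : ind :=
  exist (fun f => f \in @induced_pred _ _ eps tau (weight_seq w)) _ (ind_mk_mem a).

Lemma ind_mkK a : Eb *m a = a -> ind_get (ind_mk a) = a.
Proof.
move=> Ea; rewrite -[RHS]mul1mx -p'p -mulmxA /ind_get; congr (_ *m _).
apply/matrixP => i j; rewrite ord1 mxE /ind_entry /= ffunE Ea; congr (fun_of_matrix _ _ _).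
by apply: val_inj.
Qed.

End InducedCoordinates.

(* The homology [V] of a monad that is split at both ends, say [E0 -> ES -> E0] with
   projectors [ES], [E0], satisfies [V + E0 + E0 = ES]. *)
Section SplitMonad.
Variables (B : pzRingType) (N d : nat).
Variables (ES : 'M[B]_N) (E0 : 'M[B]_d) (bm sm0 : 'M[B]_(d, N)) .
Variables (am : 'M[B]_(N, d)) (s0 : 'M[B]_(N, d)) (r0 : 'M[B]_(d, N)).
Hypotheses (ESid : ES *m ES = ES) (E0id : E0 *m E0 = E0).
Hypotheses (Eb : E0 *m bm = bm *m ES) (Ea : am *m E0 = ES *m am).
Hypotheses (bs : bm *m s0 = 1%:M) (ra : r0 *m am = 1%:M) (ba : bm *m am *m E0 = 0).

Let kernel (v : 'cV[B]_N) := ES *m v = v /\ bm *m v = 0.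
Variables (V S T : lmodType B^c) (th : 'cV[B]_N -> V).
Hypothesis th_linear : forall (b : B^c) u v, kernel u -> kernel v ->
  th (u *m (b : B)%:M + v) = b *: th u + th v.
Hypothesis th_boundary : forall c, E0 *m c = c -> th (am *m c) = 0.
Hypothesis th_exact : forall v, kernel v -> th v = 0 ->
  exists2 c, E0 *m c = c & v = am *m c.
Hypothesis th_surj : forall x, exists2 v, kernel v & th v = x.

Variables (gS : S -> 'cV[B]_N) (mS : 'cV[B]_N -> S).
Hypothesis gS_linear : forall (b : B^c) u v, gS (b *: u + v) = gS u *m (b : B)%:M + gS v.
Hypothesis gS_equiv : forall v, ES *m gS v = gS v.
Hypothesis gS_inj : injective gS.
Hypothesis mSK : forall a, ES *m a = a -> gS (mS a) = a.
Variables (gT : T -> 'cV[B]_(d + d)) (mT : 'cV[B]_(d + d) -> T).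
Hypothesis gT_linear : forall (b : B^c) u v, gT (b *: u + v) = gT u *m (b : B)%:M + gT v.
Hypothesis gT_equiv : forall v, block_mx E0 0 0 E0 *m gT v = gT v.
Hypothesis gT_inj : injective gT.
Hypothesis mTK : forall a, block_mx E0 0 0 E0 *m a = a -> gT (mT a) = a.

Let sm := ES *m s0 *m E0.
Let rm := E0 *m r0 *m ES.
Let pr (v : 'cV[B]_N) := v - sm *m (bm *m v).

Let pr_linear (u : 'cV[B]_N) b v : pr (u *m b + v) = pr u *m b + pr v.
Proof. by rewrite /pr !mulmxDr opprD addrACA mulmxBl !mulmxA. Qed.

Let bm_equiv (v : 'cV[B]_N) : ES *m v = v -> E0 *m (bm *m v) = bm *m v.
Proof. by move=> Ev; rewrite mulmxA Eb -mulmxA Ev. Qed.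

Let bsm (u : 'cV[B]_d) : E0 *m u = u -> bm *m (sm *m u) = u.
Proof.
move=> Eu; rewrite /sm -!mulmxA Eu (mulmxA bm) -Eb -mulmxA (mulmxA bm) bs mul1mx.
exact: Eu.
Qed.

Let pr_kernel (v : 'cV[B]_N) : ES *m v = v -> kernel (pr v).
Proof.
move=> Ev; split; first by rewrite /pr mulmxBr Ev /sm !mulmxA ESid.
by rewrite /pr mulmxBr bsm ?subrr //; exact: bm_equiv.
Qed.

Let rm_equiv (v : 'cV[B]_N) : E0 *m (rm *m v) = rm *m v.
Proof. by rewrite /rm !mulmxA E0id. Qed.

Let ram (c : 'cV[B]_d) : E0 *m c = c -> rm *m (am *m c) = c.
Proof.
move=> Ec; rewrite /rm -{1}Ec (mulmxA am) Ea -!mulmxA (mulmxA ES) ESid (mulmxA ES am) -Ea.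
by rewrite -mulmxA Ec (mulmxA r0) ra mul1mx Ec.
Qed.

Let am_kernel (c : 'cV[B]_d) : E0 *m c = c -> kernel (am *m c).
Proof.
move=> Ec; split; first by rewrite mulmxA -Ea -mulmxA Ec.
by rewrite -{1}Ec !mulmxA ba mul0mx.
Qed.

Let ker_mul (u v : 'cV[B]_N) b : kernel u -> kernel v -> kernel (u *m b + v).
Proof.
move=> [Eu bu] [Ev bv]; split; first by rewrite mulmxDr mulmxA Eu Ev.
by rewrite mulmxDr mulmxA bu bv mul0mx addr0.
Qed.

Let tail (v : 'cV[B]_N) := col_mx (rm *m pr v) (bm *m v).

Let tail_equiv (v : 'cV[B]_N) : ES *m v = v -> block_mx E0 0 0 E0 *m tail v = tail v.
Proof. by move=> Ev; rewrite mul_block_col !mul0mx addr0 add0r rm_equiv bm_equiv. Qed.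

Let tail_linear (u : 'cV[B]_N) b v : tail (u *m b + v) = tail u *m b + tail v.
Proof.
rewrite /tail pr_linear mul_col_mx add_col_mx; congr col_mx.
  by rewrite mulmxDr mulmxA.
by rewrite mulmxDr mulmxA.
Qed.

Let split (v : S) : (V * T)%type := (th (pr (gS v)), mT (tail (gS v))).

Let split_linear : linear split.
Proof.
move=> b u v; rewrite /split gS_linear pr_linear th_linear; try exact: pr_kernel.
congr pair; apply: gT_inj; rewrite gT_linear !mTK ?tail_linear //; try exact: tail_equiv.
by rewrite mulmxDr mulmxA !tail_equiv.
Qed.

(** A vector [v] of the middle term goes to the class of its projection [pr v] to the kernel, the
    boundary coordinate [rm (pr v)] and the image [bm v]. Here [sm] and [rm] are the given
    splittings made equivariant by the projectors. *)
Lemma split_monad_isomorphic : isomorphic (V * T)%type S.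
Proof.
apply: isomorphic_sym; apply: (isomorphic_intro split_linear).
- have inj0 v : split v = 0 -> v = 0.
    move=> [th0 /(congr1 gT)]; rewrite mTK ?tail_equiv // => Et.
    have gT0 : gT 0 = 0.
      by have := gT_linear (-1) 0 0; rewrite scaleN1r addNr (raddfN (@scalar_mx _ 1)) mulmxN
        mulmx1 addNr.
    move: Et; rewrite gT0 -(col_mx0 B d d 1) => /eq_col_mx[r00 b00].
    have [c Ec Hc] := th_exact (pr_kernel (gS_equiv v)) th0.
    have c0 : c = 0 by rewrite -(ram Ec) -Hc r00.
    have : pr (gS v) = gS v by rewrite /pr b00 mulmx0 subr0.
    rewrite Hc c0 mulmx0 => g0; apply: gS_inj; rewrite -g0.
    by have := gS_linear (-1) 0 0; rewrite scaleN1r addNr (raddfN (@scalar_mx _ 1)) mulmxN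
      mulmx1 addNr.
  move=> u v E; apply/eqP; rewrite -subr_eq0; apply/eqP/inj0.
  by rewrite addrC -scaleN1r split_linear E scaleN1r addNr.
- move=> [x t]; have [k Kk Ek] := th_surj x.
  pose c := usubmx (gT t); pose u := dsubmx (gT t).
  have := gT_equiv t; rewrite -[gT t]vsubmxK -/c -/u mul_block_col !mul0mx addr0 add0r.
  move=> /eq_col_mx[Ec Eu].
  (* The cycle [k] has the right class but an arbitrary boundary coordinate; adding the boundary of
     [a] corrects that coordinate to [c] and keeps the class. *)
  pose a := c - rm *m k; have Ea' : E0 *m a = a by rewrite mulmxBr Ec rm_equiv.
  pose k' := k *m 1%:M + am *m a; have Kk' : kernel k' by apply: ker_mul => //; exact: am_kernel.
  have rk' : rm *m k' = c by rewrite mulmxDr mulmx1 (ram Ea') addrC subrK.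
  pose v := k' + sm *m u.
  have Ev : ES *m v = v by rewrite mulmxDr Kk'.1 /sm !mulmxA ESid.
  have bv : bm *m v = u by rewrite mulmxDr Kk'.2 add0r bsm.
  have prv : pr v = k' by rewrite /pr bv addrK.
  exists (mS v); rewrite /split mSK // prv; congr pair.
    by rewrite (th_linear 1) ?scale1r ?th_boundary ?addr0 //; exact: am_kernel.
  apply: gT_inj; rewrite mTK ?tail_equiv // /tail prv rk' bv.
  exact: vsubmxK.
Qed.

End SplitMonad.

Definition sum_fun N1 N2 T (w1 : 'I_N1 -> T) (w2 : 'I_N2 -> T) (i : 'I_(N1 + N2)) : T :=
  match fintype.split i with inl j => w1 j | inr j => w2 j end.

Lemma block_diagonalized (S : pzRingType) T (f : T -> S) N1 N2 (w1 : 'I_N1 -> T) (w2 : 'I_N2 -> T)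
    (E1 p1 : 'M[S]_N1) (E2 p2 : 'M[S]_N2) :
  p1 *m E1 = diag_mx (\row_i f (w1 i)) *m p1 -> p2 *m E2 = diag_mx (\row_i f (w2 i)) *m p2 ->
  block_mx p1 0 0 p2 *m block_mx E1 0 0 E2 =
  diag_mx (\row_i f (sum_fun w1 w2 i)) *m block_mx p1 0 0 p2.
Proof.
move=> H1 H2; have -> : \row_i f (sum_fun w1 w2 i) = row_mx (\row_i f (w1 i)) (\row_i f (w2 i)).
  by apply/rowP => i; rewrite !mxE /sum_fun; case: fintype.split => j; rewrite mxE.
by rewrite diag_mx_row !mulmx_block !mul0mx !mulmx0 !addr0 !add0r H1 H2.
Qed.

Lemma block_inverse (S : pzRingType) N1 N2 (p1 q1 : 'M[S]_N1) (p2 q2 : 'M[S]_N2) :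
  p1 *m q1 = 1%:M -> p2 *m q2 = 1%:M -> block_mx p1 0 0 p2 *m block_mx q1 0 0 q2 = 1%:M.
Proof.
move=> H1 H2; rewrite mulmx_block !mul0mx !mulmx0 !addr0 !add0r H1 H2.
exact: esym (scalar_mx_block _ _ _).
Qed.

(** * The ideal as the homology of the split monad *)

Section DimensionOneClass.
Variables (F : numClosedFieldType) (gT : finGroupType) (eps : primitive_char F gT).
Variables (tau : {ffun gT -> F}) (Q : unitRingType).
Variables (iota : {rmorphism Btau eps tau -> Q}).
Variables (n d : nat) (q : quadruple eps tau n d).
Notation B := (Btau eps tau).
Notation m := #|gT|.
Notation Bs := (Bs eps tau).
Notation Be := (Be eps tau).
Notation Bg := (Bg eps tau).
Notation pX := (BX q).
Notation pY := (BY q).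
Notation vi := (Bi q).
Notation vj := (Bj q).
Notation E := (BE q).
Notation mp := (map_mx iota).
Hypothesis iota_inj : injective iota.
Hypothesis tau_generic : generic eps tau.
Hypothesis lt_n : (n < m)%N.
Variables Xinv Yinv : 'M[Q]_d.
Hypotheses (XinvP : mutually_inverse (mp pX) Xinv) (YinvP : mutually_inverse (mp pY) Yinv).
Notation psi := (psi iota q Yinv).
Notation M := (nakajima_ideal iota q Xinv Yinv).
Notation uM := (crQ iota (cr_idem eps n) * detY iota q).
Notation vM := (crQ iota (cr_idem eps n) * kappa iota q Xinv Yinv * detX iota q).

(** This makes the image of [E c] an induced module, on the weights of [U] shifted by [c]: on a
    weight vector the average over the group in [E c] becomes, after inverting [g], the one that
    defines [Be]. *)
Lemma BE_diagonalized (P : 'M[F]_d) s c :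
  (forall g, P *m Gbar q g = diag_mx (\row_k eps g ^+ s k) *m P) ->
  map_mx Bs P *m E c = diag_mx (\row_k Be (s k + c)) *m map_mx Bs P.
Proof.
move=> HP; apply/matrixP => i j; rewrite diag_mulmx BE.unlock mulmx_sumr summxE.
rewrite mxE BeE mulr_sumr mulr_suml [RHS](reindex_inj invg_inj) /=; apply: eq_bigr => g _.
rewrite BU.unlock mulmxA Bs_mx_comm -mulmxA (mulmxA (map_mx Bs P)).
rewrite -map_mxM HP mul_scalar_mx [LHS]mxE map_Bs_comm mul_scalar_mx [X in _ * X]mxE.
rewrite [X in _ * (_ * X)]mxE (diag_mulmx (fun k => eps g ^+ s k)).
have -> (x y w : F) (b : B) : Bs x * (Bs y * b) * Bs w = Bs (x * y * w) * b.
  by rewrite [LHS]Bs_comm (mulrA (Bs x)) -(rmorphM Bs) [LHS]mulrA -(rmorphM Bs) (mulrC w).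
rewrite Bs_comm mulrA -(rmorphM Bs); congr (Bs _ * _).
by rewrite eps_inv exprVn invrK exprD; ring.
Qed.

Let bm : 'M[B]_(d, d + d + 1) := row_mx (row_mx pX (- pY)) (- vi).
Let am : 'M[B]_(d + d + 1, d) := col_mx (col_mx pY pX) vj.
Let ES : 'M[B]_(d + d + 1) := block_mx (block_mx (E m.-1) 0 0 (E 1)) 0 0 (Be n)%:M.

Let bmE k (v1 v2 : 'M[B]_(d, k)) w :
  bm *m col_mx (col_mx v1 v2) w = pX *m v1 - pY *m v2 - vi *m w.
Proof. by rewrite /bm !mul_row_col !mulNmx. Qed.

Let ESE (v1 v2 : 'cV[B]_d) (w : 'M[B]_1) : ES *m col_mx (col_mx v1 v2) w =
  col_mx (col_mx (E m.-1 *m v1) (E 1 *m v2)) ((Be n)%:M *m w).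
Proof. by rewrite /ES 2!mul_block_col !mul0mx !addr0 !add0r. Qed.

Let kernel_col (v1 v2 : 'cV[B]_d) (w : 'M[B]_1) :
  ES *m col_mx (col_mx v1 v2) w = col_mx (col_mx v1 v2) w ->
  bm *m col_mx (col_mx v1 v2) w = 0 -> monad_kernel q v1 v2 (w 0 0).
Proof.
rewrite ESE bmE => /eq_col_mx[/eq_col_mx[E1 E2] Ew] bv; split; [exact: E1|exact: E2|..].
- by rewrite -[in RHS]Ew mul_scalar_mx [RHS]mxE.
- by rewrite -mx11_scalar.
Qed.

Let kernelE (v : 'cV[B]_(d + d + 1)) : ES *m v = v -> bm *m v = 0 ->
  monad_kernel q (usubmx (usubmx v)) (dsubmx (usubmx v)) (dsubmx v 0 0).
Proof.
by have := @kernel_col (usubmx (usubmx v)) (dsubmx (usubmx v)) (dsubmx v); rewrite 2!vsubmxK.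
Qed.

Let thQ (v : 'cV[B]_(d + d + 1)) : Q := psi (usubmx (usubmx v)) (dsubmx v 0 0).
(** On cycles [thQ] lands in the ideal, by [psi_kernel_phi] and [phi_ideal]; [insubd] makes the map
    total, with default value [0] outside the ideal. *)
Let th (v : 'cV[B]_(d + d + 1)) : M := insubd (0 : M) (thQ v : rmodQ iota).

Let thQ_linear u v b : thQ (u *m b%:M + v) = thQ u * iota b + thQ v.
Proof.
rewrite -psiM -psiD /thQ !raddfD /= -!mul_usub_mx -mul_dsub_mx; congr (psi _ _).
by rewrite mxE mulmx_scalar_col.
Qed.

Let val_th v : ES *m v = v -> bm *m v = 0 -> val (th v) = thQ v :> Q.
Proof.
move=> Ev bv; rewrite /th insubdK //; apply/asboolP.
have [a a0 Ea] := psi_kernel_phi lt_n YinvP (kernelE Ev bv).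
by rewrite /thQ Ea; exact: phi_ideal.
Qed.

Let ESid : ES *m ES = ES.
Proof.
rewrite /ES !mulmx_block !mul0mx !mulmx0 !addr0 !add0r !BE_idem.
by rewrite -scalar_mxM Be_idem.
Qed.

Let bm_equiv : E 0 *m bm = bm *m ES.
Proof.
rewrite /bm /ES 2!mul_mx_row 2!mul_row_block !mulmx0 !addr0 !add0r.
have EX : E 0 *m pX = pX *m E m.-1 by rewrite BX_BE BE_predS.
have EY : E 0 *m - pY = - pY *m E 1 by rewrite mulmxN mulNmx BY_BE.
have Ei : E 0 *m - vi = - vi *m (Be n)%:M by rewrite mulmxN mulNmx BE_Bi.
by congr row_mx; [congr row_mx|].
Qed.

Let am_equiv : am *m E 0 = ES *m am.
Proof.
rewrite /am /ES 2!mul_col_mx 2!mul_block_col !mul0mx !addr0 !add0r.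
have EX : pX *m E 0 = E 1 *m pX by exact: BX_BE.
have EY : pY *m E 0 = E m.-1 *m pY by rewrite -BY_BE BE_predS.
by congr col_mx; [congr col_mx|exact: Bj_BE].
Qed.

Let bm_am : bm *m am *m E 0 = 0.
Proof. by rewrite bmE; exact: monad_comp. Qed.

Let th_linear (b : B^c) u v : ES *m u = u /\ bm *m u = 0 -> ES *m v = v /\ bm *m v = 0 ->
  th (u *m (b : B)%:M + v) = b *: th u + th v.
Proof.
move=> [Eu bu] [Ev bv]; apply: val_inj.
have -> : val (b *: th u + th v) = (val (th u) : Q) * iota (b : B) + val (th v) :> Q by [].
rewrite (val_th Eu bu) (val_th Ev bv) -thQ_linear; apply: val_th.
  by rewrite mulmxDr mulmxA Eu Ev.
by rewrite mulmxDr mulmxA bu bv mul0mx addr0.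
Qed.

Let th_boundary c : E 0 *m c = c -> th (am *m c) = 0.
Proof.
move=> Ec; apply: val_inj; apply: etrans (_ : _ = 0 :> Q); first apply: val_th.
- by rewrite mulmxA -am_equiv -mulmxA Ec.
- by rewrite -Ec !mulmxA bm_am mul0mx.
- rewrite /thQ /am 2!mul_col_mx !col_mxKu col_mxKd; exact: psi_alpha.
Qed.

Let th_exact v : ES *m v = v /\ bm *m v = 0 -> th v = 0 ->
  exists2 c, E 0 *m c = c & v = am *m c.
Proof.
move=> [Ev bv] /(congr1 val); rewrite (val_th Ev bv) => th0.
have [c [Ec E1 E2 Ew]] := psi_eq0 iota_inj tau_generic YinvP (kernelE Ev bv) th0.
exists c => //; rewrite -[LHS]vsubmxK -[usubmx v]vsubmxK E1 E2 /am 2!mul_col_mx.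
by congr col_mx; rewrite [LHS]mx11_scalar Ew -mx11_scalar.
Qed.

Let th_surj x : exists2 v, ES *m v = v /\ bm *m v = 0 & th v = x.
Proof.
have /asboolP/(ideal_phi XinvP YinvP)[a a0 Ea] := valP x.
have [E1 E2 Ew Eb] := monad_kernel_fox a0.
pose v := col_mx (col_mx (fox1 q a) (fox2 q a)) (Be n * to_B eps tau a)%:M.
have Ev : ES *m v = v by rewrite /v ESE E1 E2 -scalar_mxM Ew.
have bv : bm *m v = 0 by rewrite bmE.
exists v => //; apply: val_inj; apply: etrans (val_th Ev bv) _; rewrite -[RHS]Ea /thQ /v
  !col_mxKu col_mxKd mxE.
by rewrite eqxx.
Qed.

(** The middle term of the monad contributes [2 d + 1] weights and the two outer terms [d] each,
    whence dimension one. *)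
Lemma ideal_in_calR : in_calR M.
Proof.
have [P [P' [s [PP' P'P HP]]]] := weight_basis eps (Gbar q).
have HE c := BE_diagonalized c HP.
have pp' : map_mx Bs P *m map_mx Bs P' = 1%:M by rewrite -map_mxM PP' map_mx1.
have p'p : map_mx Bs P' *m map_mx Bs P = 1%:M by rewrite -map_mxM P'P map_mx1.
have [s1 [s2 [s3 Hs]]] := cokernel_splitting q.
have [r1 [r2 [r3 Hr]]] := kernel_splitting q tau_generic.
pose wS := sum_fun (sum_fun (fun k => s k + m.-1) (fun k => s k + 1)) (fun _ : 'I_1 => n).
pose wT := sum_fun (fun k => s k + 0) (fun k => s k + 0).
pose pT := block_mx (map_mx Bs P) 0 0 (map_mx Bs P).
pose pT' := block_mx (map_mx Bs P') 0 0 (map_mx Bs P').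
pose pS := block_mx pT 0 0 (1%:M : 'M[B]_1).
pose pS' := block_mx pT' 0 0 (1%:M : 'M[B]_1).
have EpT : pT *m block_mx (E 0) 0 0 (E 0) = diag_mx (\row_i Be (wT i)) *m pT.
  exact: block_diagonalized.
have EpS : pS *m ES = diag_mx (\row_i Be (wS i)) *m pS.
  apply: block_diagonalized; first exact: block_diagonalized.
  by rewrite mulmx1 mul1mx; apply/matrixP => i j; rewrite !ord1 !mxE eqxx !mulr1n.
have TT' : pT *m pT' = 1%:M by exact: block_inverse.
have T'T : pT' *m pT = 1%:M by exact: block_inverse.
have SS' : pS *m pS' = 1%:M by apply: block_inverse => //; rewrite mulmx1.
have S'S : pS' *m pS = 1%:M by apply: block_inverse => //; rewrite mulmx1.
exists (weight_seq wS), (weight_seq wT); split; first by rewrite !size_weight_seq addn1.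
apply: (@split_monad_isomorphic _ _ _ ES (E 0) bm am (col_mx (col_mx s1 s2) s3)
  (row_mx (row_mx r1 r2) r3) _ _ _ _ _ _ _ _ _ _ th _ _ _ _
  (ind_get (eps := eps) (tau := tau) pS') (ind_mk EpS) _ _ _ _
  (ind_get (eps := eps) (tau := tau) pT') (ind_mk EpT)).
- exact: ESid.
- exact: BE_idem.
- exact: bm_equiv.
- exact: am_equiv.
- by rewrite bmE.
- by rewrite /am 2!mul_row_col.
- exact: bm_am.
- exact: th_linear.
- exact: th_boundary.
- exact: th_exact.
- exact: th_surj.
- exact: ind_get_linear.
- exact: (ind_get_equiv S'S SS' EpS).
- exact: (ind_get_inj SS').
- exact: (ind_mkK S'S EpS).
- exact: ind_get_linear.
- exact: (ind_get_equiv T'T TT' EpT).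
- exact: (ind_get_inj TT').
- exact: (ind_mkK T'T EpT).
Qed.

End DimensionOneClass.

Theorem theorem5 (R : realType) (gT : finGroupType)
    (eps : primitive_char R[i] gT) (tau : {ffun gT -> R[i]})
    (tau_generic : generic eps tau)
    (Q : unitRingType) (iota : {rmorphism Btau eps tau -> Q})
    (iota_quotient : classical_quotient_ring iota)
    (n : 'I_#|gT|) (d : nat) (q : quadruple eps tau n d) :
  exists Xinv Yinv : 'M[Q]_d,
    [/\ mutually_inverse (X_pencil iota q) Xinv,
        mutually_inverse (Y_pencil iota q) Yinv,
        in_calR (nakajima_ideal iota q Xinv Yinv)
      & isomorphic (H0 q) (nakajima_ideal iota q Xinv Yinv)].
Proof.
have [iota_inj _ _ _] := iota_quotient.
have [_ [Xinv HX]] := pencil_inverse iota_quotient false (Xbar q).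
have [_ [Yinv HY]] := pencil_inverse iota_quotient true (Ybar q).
rewrite -BXE in HX; rewrite -BYE in HY.
exists Xinv, Yinv; split.
- by rewrite X_pencilE.
- by rewrite Y_pencilE.
- exact: ideal_in_calR.
- exact: H0_isomorphic.
Qed.
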